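(* Let $P_1,\dots,P_\nu\in\mathbb{S}^2$ have nonpositive $(2,2)$ entries and let $$\mathbf{V}=\left\{vI_k \;\middle|\; v\in\mathbb{C},\ \begin{pmatrix}1\\ v\end{pmatrix}^{*}P_i\begin{pmatrix}1\\ v\end{pmatrix}\ge 0\text{ for }i=1,\dots,\nu\right\}.$$ Let $\begin{pmatrix}A_\psi&B_\psi\\ C_\psi&D_\psi\end{pmatrix}\in\mathbb{R}^{(n_\psi+m_\psi)\times(n_\psi+k)}$ with $A_\psi\in\mathbb{R}^{n_\psi\times n_\psi}$ stable (Hurwitz) be given and abbreviate $J_\Psi:=\mathrm{diag}(J_\psi,J_\psi)$ for $J\in\{A,B,C,D\}$. Then the uncertain interconnection $$\begin{pmatrix}\dot x(t)\\ z(t)\end{pmatrix}=\begin{pmatrix}A&B\\ C&D\end{pmatrix}\begin{pmatrix}x(t)\\ w(t)\end{pmatrix},\quad w(t)=\Delta(z)(t),\quad t\ge0,\quad \Delta\in\mathbf{\Delta}(\mathbf{V}),$$ is robustly stable if there exist $X\in\mathbb{S}^{2n_\psi+n}$, $Y_1,\dots,Y_\nu\in\mathbb{S}^{n_\psi}$ and $M_1,\dots,M_\nu\in\mathbb{S}^{m_\psi}$ satisfying $$\begin{pmatrix} I&0\\ A_\psi&B_\psi\end{pmatrix}^T\begin{pmatrix}0&Y_i\\ Y_i&0\end{pmatrix}\begin{pmatrix} I&0\\ A_\psi&B_\psi\end{pmatrix}+\begin{pmatrix}C_\psi&D_\psi\end{pmatrix}^TM_i\begin{pmatrix}C_\psi&D_\psi\end{pmatrix}\succ0\quad\text{for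 all }i=1,\dots,\nu,$$ $$H^T\begin{pmatrix}0&X&0\\ X&0&0\\ 0&0&\sum_{i=1}^\nu P_i\otimes M_i\end{pmatrix}H\prec0\quad\text{with}\quad H=\begin{pmatrix}I&0&0\\ 0&I&0\\ A_\Psi&B_\Psi\begin{pmatrix}C\\ 0\end{pmatrix}&B_\Psi\begin{pmatrix}D\\ I_k\end{pmatrix}\\ 0&A&B\\ C_\Psi&D_\Psi\begin{pmatrix}C\\ 0\end{pmatrix}&D_\Psi\begin{pmatrix}D\\ I_k\end{pmatrix}\end{pmatrix},$$ and $$X-\begin{pmatrix}\sum_{i=1}^\nu P_i\otimes Y_i&0\\ 0&0\end{pmatrix}\succ0.$$
   Context: $\mathbb{S}^n$ is the set of real symmetric $n\times n$ matrices; $\otimes$ is the Kronecker product; ${}^*$ is the conjugate transpose; $L_{2e}^n$ is the space of locally square integrable functions $[0,\infty)\to\mathbb{R}^n$; $\mathrm{RH}_\infty^{m\times n}$ is the space of real rational $m\times n$ matrices without poles in the extended closed right half-plane. $A\in\mathbb{R}^{n\times n}$, $B\in\mathbb{R}^{n\times l}$, $C\in\mathbb{R}^{k\times n}$, $D\in\mathbb{R}^{k\times l}$ are given real matrices (here $l=k$). Uncertainties: $\Delta$ is a stable LTI system with input-output map $\Delta:L_{2e}^k\to L_{2e}^l$, $$\Delta(z)(t)=\int_0^tC_\Delta e^{A_\Delta(t-s)}B_\Delta z(s)\,ds+D_\Delta z(t),$$ for some real matrices $A_\Delta,B_\Delta,C_\Delta,D_\Delta$. The same symbol denotes its transfer matrix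 $\Delta(s)=C_\Delta(sI-A_\Delta)^{-1}B_\Delta+D_\Delta$; stability means $\Delta\in\mathrm{RH}_\infty^{l\times k}$. For $\mathbf{V}\subset\mathbb{C}^{l\times k}$, $\mathbf{\Delta}(\mathbf{V})$ is the set of all such $\Delta$ with $\Delta(i\omega)\in\mathbf{V}$ for all $\omega\in\mathbb{R}\cup\{\infty\}$. Robust stability: the interconnection is robustly stable if it is well-posed, i.e., $\det(I-DV)\ne0$ for all $V\in\mathbf{V}$, and if there exists a constant $M_0>0$ such that the state-trajectories satisfy $\lim_{t\to\infty}x(t)=0$ and $\|x(t)\|\le M_0\|x(0)\|$ for all $t\ge0$, for all initial conditions $x(0)\in\mathbb{R}^n$ and any $\Delta\in\mathbf{\Delta}(\mathbf{V})$. *)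

(* Defs.v *)
From HB Require Import structures.
From mathcomp Require Import all_boot all_order all_algebra.
From mathcomp Require Import all_classical all_reals all_analysis.
From mathcomp Require Import complex mxtens.

Set Implicit Arguments.
Unset Strict Implicit.
Unset Printing Implicit Defensive.

Import Order.TTheory GRing.Theory Num.Theory.
Import numFieldNormedType.Exports.

Local Open Scope classical_set_scope.
Local Open Scope complex_scope.
Local Open Scope sesquilinear_scope.
Local Open Scope ring_scope.

Section Matrices.
Variable R : realType.

Definition posdef n (M : 'M[R]_n) : Prop :=
  M \is symmetricmx /\
  forall x : 'cV[R]_n, x != 0 -> 0 < (x^T *m M *m x) 0 0.

Definition negdef n (M : 'M[R]_n) : Prop :=
  M \is symmetricmx /\
  forall x : 'cV[R]_n, x != 0 -> (x^T *m M *m x) 0 0 < 0.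

Definition complexmx m n (M : 'M[R]_(m, n)) : 'M[R[i]]_(m, n) :=
  map_mx (real_complex R) M.

Definition hurwitz n (M : 'M[R]_n) : Prop :=
  forall l : R[i], eigenvalue (complexmx M) l -> complex.Re l < 0.

Definition diag2 m n (J : 'M[R]_(m, n)) : 'M[R]_(m + m, n + n) :=
  block_mx J 0 0 J.

Lemma mul2n_addn p : (2 * p = p + p)%N.
Proof. by rewrite mul2n addnn. Qed.

(* The Kronecker product P (x) M of a 2 x 2 matrix P with M, with its dimension
   2 * p cast to p + p so that it can be used next to block matrices. *)
Definition kron2 p q (P : 'M[R]_2) (M : 'M[R]_(p, q)) : 'M[R]_(p + p, q + q) :=
  castmx (mul2n_addn p, mul2n_addn q) (P *t M).

Lemma kron2E p q (P : 'M[R]_2) (M : 'M[R]_(p, q)) :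
  kron2 P M = block_mx (P 0 0 *: M) (P 0 1 *: M) (P 1 0 *: M) (P 1 1 *: M).
Proof.
have cl r (i : 'I_r) : cast_ord (esym (mul2n_addn r)) (lshift r i)
    = mxtens_index (0 : 'I_2, i) by apply: val_inj; rewrite /= mul0n.
have cr r (i : 'I_r) : cast_ord (esym (mul2n_addn r)) (rshift r i)
    = mxtens_index (1 : 'I_2, i) by apply: val_inj; rewrite /= mul1n.
apply/matrixP => i j; rewrite castmxE /=.
case: (split_ordP i) => i' ->; case: (split_ordP j) => j' ->;
  rewrite ?cl ?cr tensmxE ?block_mxEul ?block_mxEur ?block_mxEdl ?block_mxEdr;
  by rewrite mxE.
Qed.

Definition expmx n (M : 'M[R]_n) : 'M[R]_n :=
  \matrix_(i, j) limn (series (fun k : nat => (M ^+ k) i j / k`!%:R)).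

Definition norm2 n (x : 'cV[R]_n) : R := Num.sqrt (\sum_i (x i 0) ^+ 2).

End Matrices.

Section RationalMatrices.
Variable R : realType.

Local Notation ratfun := {fraction {poly R}}.
Local Notation tofrac := (@FracField.tofrac {poly R}).

Definition ceval (p : {poly R}) (z : R[i]) : R[i] :=
  (map_poly (real_complex R) p).[z].

(* [ratfun_value g s v]: the rational function g has no pole at the point s of
   the extended complex plane and takes the value v there; [None] stands for
   the point at infinity, where the value is the limit of p / q, that is, the
   quotient of the coefficients of p and q of degree deg q. *)
Definition ratfun_value (g : ratfun) (s : option R[i]) (v : R[i]) : Prop :=
  exists p q : {poly R}, g = tofrac p / tofrac q /\
  match s with
  | Some z => ceval q z != 0 /\ v = ceval p z / ceval q z
  | None => q != 0 /\ (size p <= size q)%N /\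
            v = (p`_(size q).-1 / lead_coef q)%:C
  end.

Definition ratmx_value m n (G : 'M[ratfun]_(m, n)) (s : option R[i])
    (W : 'M[R[i]]_(m, n)) : Prop :=
  forall i j, ratfun_value (G i j) s (W i j).

Definition closed_RHP (s : option R[i]) : Prop :=
  if s is Some z then 0 <= complex.Re z else True.

Definition RHinf m n (G : 'M[ratfun]_(m, n)) : Prop :=
  forall s, closed_RHP s -> exists W, ratmx_value G s W.

Definition extended_iaxis (om : option R) : option R[i] :=
  omap (fun w : R => Complex 0 w) om.

End RationalMatrices.

(* A realization with k inputs and l outputs; it need not be minimal, and
   stability below is a condition on its transfer matrix only. *)
Record lti (R : realType) (k l : nat) := LTI {
  lti_dim : nat;
  lti_A : 'M[R]_lti_dim;
  lti_B : 'M[R]_(lti_dim, k);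
  lti_C : 'M[R]_(l, lti_dim);
  lti_D : 'M[R]_(l, k) }.

Section Interconnection.
Variable R : realType.

Local Notation mu := (@lebesgue_measure R).

Definition transfer k l (S : lti R k l) : 'M[{fraction {poly R}}]_(l, k) :=
  let cst m n (M : 'M[R]_(m, n)) :=
    map_mx (fun c => @FracField.tofrac {poly R} c%:P) M in
  cst _ _ (lti_C S)
    *m invmx ((@FracField.tofrac {poly R} 'X)%:M - cst _ _ (lti_A S))
    *m cst _ _ (lti_B S) + cst _ _ (lti_D S).

Definition integralmx n (a b : R) (f : R -> 'cV[R]_n) : 'cV[R]_n :=
  \col_i \int[mu]_(s in `[a, b]) (f s i 0).

Definition lti_map k l (S : lti R k l) (z : R -> 'cV[R]_k) (t : R) :
    'cV[R]_l :=
  integralmx 0 t (fun s => lti_C S *m expmx ((t - s) *: lti_A S) *m lti_B S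
                             *m z s)
  + lti_D S *m z t.

Definition uncertainty k l (V : set 'M[R[i]]_(l, k)) : set (lti R k l) :=
  [set S | RHinf (transfer S) /\
     forall (om : option R) W,
       ratmx_value (transfer S) (extended_iaxis om) W -> V W].

(* Signals are functions on R of which only the values on [0, +oo[ matter. *)
Definition L2e n (u : R -> 'cV[R]_n) : Prop :=
  forall i, measurable_fun (`[0, +oo[ : set R) (fun t : R => u t i 0) /\
    forall T : R, 0 <= T ->
      (\int[mu]_(t in `[0%R, T]) ((u t i 0) ^+ 2)%:E < +oo)%E.

(* The differential equation x' = A x + B w with w in L2e is understood in the
   sense of Caratheodory, i.e., in integrated form; the equations between L2e
   signals hold almost everywhere. *)
Definition state_trajectory n k l (A : 'M[R]_n) (B : 'M[R]_(n, l))
    (C : 'M[R]_(k, n)) (D : 'M[R]_(k, l)) (S : lti R k l)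
    (x : R -> 'cV[R]_n) : Prop :=
  {within (`[0, +oo[ : set R), continuous x} /\
  exists (w : R -> 'cV[R]_l) (z : R -> 'cV[R]_k),
    [/\ L2e w, L2e z,
        forall t : R, 0 <= t ->
          x t = x 0 + integralmx 0 t (fun s => A *m x s + B *m w s),
        {ae mu, forall t : R, 0 <= t -> z t = C *m x t + D *m w t} &
        {ae mu, forall t : R, 0 <= t -> w t = lti_map S z t}].

Definition well_posed k l (D : 'M[R]_(k, l)) (V : set 'M[R[i]]_(l, k)) : Prop :=
  forall W, V W -> \det (1%:M - complexmx D *m W) != 0.

Definition robustly_stable n k l (A : 'M[R]_n) (B : 'M[R]_(n, l))
    (C : 'M[R]_(k, n)) (D : 'M[R]_(k, l)) (V : set 'M[R[i]]_(l, k)) : Prop :=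
  well_posed D V /\
  exists M0 : R, 0 < M0 /\
    forall S, uncertainty V S ->
    forall x, state_trajectory A B C D S x ->
      x t @[t --> +oo] --> (0 : 'cV[R]_n) /\
      forall t : R, 0 <= t -> norm2 (x t) <= M0 * norm2 (x 0).

Definition repeated_set nu k (P : 'I_nu -> 'M[R]_2) : set 'M[R[i]]_k :=
  [set W | exists v : R[i], W = v%:M /\
     forall i, let e : 'cV[R[i]]_2 := col_mx (1%:M : 'M[R[i]]_1) (v%:M : 'M[R[i]]_1) in
       0 <= (e ^t* *m complexmx (P i) *m e) 0 0].

Definition multiplier_lmi np mp k (Ap : 'M[R]_np) (Bp : 'M[R]_(np, k))
    (Cp : 'M[R]_(mp, np)) (Dp : 'M[R]_(mp, k))
    (Y : 'M[R]_np) (M : 'M[R]_mp) : 'M[R]_(np + k) :=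
  let F := block_mx 1%:M 0 Ap Bp in
  let G := row_mx Cp Dp in
  F^T *m block_mx 0 Y Y 0 *m F + G^T *m M *m G.

Definition outer_factor n np mp k (A : 'M[R]_n) (B : 'M[R]_(n, k))
    (C : 'M[R]_(k, n)) (D : 'M[R]_k) (Ap : 'M[R]_np) (Bp : 'M[R]_(np, k))
    (Cp : 'M[R]_(mp, np)) (Dp : 'M[R]_(mp, k)) :
    'M[R]_(((np + np) + n) + ((np + np) + n) + (mp + mp), (np + np) + n + k) :=
  let CO := col_mx C (0 : 'M[R]_(k, n)) in
  let DI := col_mx D (1%:M : 'M[R]_k) in
  col_mx
    (col_mx
       (col_mx (row_mx (row_mx 1%:M 0) 0)
               (row_mx (row_mx 0 1%:M) 0))
       (col_mx (row_mx (row_mx (diag2 Ap) (diag2 Bp *m CO)) (diag2 Bp *m DI))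
               (row_mx (row_mx 0 A) B)))
    (row_mx (row_mx (diag2 Cp) (diag2 Dp *m CO)) (diag2 Dp *m DI)).

Definition stability_lmi nu n np mp k (A : 'M[R]_n) (B : 'M[R]_(n, k))
    (C : 'M[R]_(k, n)) (D : 'M[R]_k) (Ap : 'M[R]_np) (Bp : 'M[R]_(np, k))
    (Cp : 'M[R]_(mp, np)) (Dp : 'M[R]_(mp, k))
    (P : 'I_nu -> 'M[R]_2) (X : 'M[R]_((np + np) + n))
    (M : 'I_nu -> 'M[R]_mp) : 'M[R]_((np + np) + n + k) :=
  let H := outer_factor A B C D Ap Bp Cp Dp in
  H^T *m block_mx (block_mx 0 X X 0) 0 0 (\sum_i kron2 (P i) (M i)) *m H.

Definition coupling_lmi nu n np (P : 'I_nu -> 'M[R]_2)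
    (X : 'M[R]_((np + np) + n)) (Y : 'I_nu -> 'M[R]_np) :
    'M[R]_((np + np) + n) :=
  X - block_mx (\sum_i kron2 (P i) (Y i)) 0 0 0.

End Interconnection.

Arguments repeated_set {R nu} k P.

(* Main.v *)
Require Import Defs.
From HB Require Import structures.
From mathcomp Require Import all_boot all_order all_algebra.
From mathcomp Require Import all_classical all_reals all_analysis.
From mathcomp Require Import measurable_realfun.
From mathcomp Require Import complex polyrcf.
From mathcomp Require Import ring lra zify.
Set Implicit Arguments.
Unset Strict Implicit.
Unset Printing Implicit Defensive.
Import Order.TTheory GRing.Theory Num.Theory.
Import numFieldNormedType.Exports.
Local Open Scope complex_scope.
Local Open Scope ring_scope.

(** The constraints on the uncertainty are conditions at single frequencies; the
    proof turns them into inequalities on finite time intervals [[0, T]], with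
    a terminal term, and closes with a dissipation argument.

    An admissible uncertainty is scalar: its transfer matrix is [delta I] with
    [delta = b / a], [a] Hurwitz and [deg b <= deg a], and every [P i] satisfies
    [p11 |a|^2 + 2 p12 Re (conj a b) + p22 |b|^2 >= 0] on the imaginary axis
    ([repeated_uncertainty]). For such a pair there is a quadratic storage
    function ([scalar_kyp]), constructed by hand: the left-hand side is a
    polynomial in the frequency, hence a sum of squares, and a quadratic form
    in the derivatives of a function that vanishes on the imaginary axis is an
    exact derivative. As [p22 <= 0], the Lyapunov inequality shows that the
    storage function is nonnegative. Hence [h = delta g], started at rest,
    satisfies [int_0^T p11 g^2 + 2 p12 g h + p22 h^2 >= 0] for all [T]
    ([scalar_iqc]).

    A multiple of the identity commutes with the filter given by [Ap] and [Bp],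
    so the filter states of [z] and [w] are again related by [delta]. Instead
    of Laplace transforms, the proof uses that the polynomials act on signals,
    with the variable acting as integration from zero. Polynomials with nonzero
    constant term act injectively, by Gronwall's lemma ([op_signal_inj]), so
    that Cramer's rule carries identities between rational matrices over to
    signals ([scalar_lti_relation], [filter_commutes]). As the multiplier matrix
    inequality is strict, its matrix is of the form [G^T G], and the scalar
    inequalities for the entries of [G (xi, z)], with [xi] the filter state,
    add up to one for the whole form ([multiplier_iqc]). The part of the
    multiplier form with [Y i] is the derivative of the form [Y i] in the filter
    states. So the integral of the part with [M i] is bounded from below by a
    terminal value, which is what the coupling of [X] and [Y i] absorbs.

    Integrating the stability inequality then yields
    [e1 |x T|^2 + e2 int_0^T (|x|^2 + |w|^2) <= N |x 0|^2] with constants that do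
    not depend on the uncertainty ([dissipation]); the filters start at rest and
    contribute nothing to the right-hand side. This is the uniform bound, and
    [x] tends to zero because its squared norm and the derivative of that are
    integrable ([energy_cvg0]). Well-posedness follows from the two inequalities
    at zero states ([lmi_well_posed]). *)

(** * Nonnegative real polynomials *)

Section SumOfSquares.
Variable R : rcfType.
Implicit Types (p q u v a b c d : {poly R}).

Lemma horner_ge0_limit p (x : R) :
  (forall d : R, 0 < d -> exists2 y, `|y - x| < d & 0 <= p.[y]) -> 0 <= p.[x].
Proof.
move=> H; rewrite leNgt; apply/negP => px0.
have [d d0 Hd] := @poly_cont _ x p (- p.[x]) (ltac:(by rewrite oppr_gt0)).
have [y yd py] := H d d0.
have := Hd y yd; rewrite ltr_norml => /andP[_]; lra.
Qed.

Lemma poly_size2 p : (size p <= 2)%N -> p = p`_1 *: 'X + (p`_0)%:P.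
Proof.
move=> sp; apply/polyP => -[|[|i]]; rewrite !coefE //= ?mulr0 ?mulr1 ?add0r ?addr0 //.
by rewrite nth_default // (leq_trans sp).
Qed.

(** Induction on the degree: a complex root [al + i be] splits off the factor
    [(x - al)^2 + be^2], whether it is a real double root or one of a pair of
    conjugate roots, and the sums of two squares are closed under products. *)
Lemma sum_two_squares n p : (size p <= n.*2.+1)%N -> (forall x, 0 <= p.[x]) ->
  exists u v, [/\ p = u ^+ 2 + v ^+ 2, (size u <= n.+1)%N & (size v <= n.+1)%N].
Proof.
elim: n p => [|n IH] p sp p0.
  have pC := size1_polyC sp; exists (Num.sqrt p`_0)%:P, 0.
  rewrite expr0n addr0 -rmorphXn /= sqr_sqrtr -?pC ?size_polyC ?size_poly0 //; last first.
    by have := p0 0; rewrite {1}pC hornerC.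
  by split=> //; case: (_ != _).
have [sp1|sp1] := leqP (size p) 1.
  have [|u [v [-> su sv]]] := IH p _ p0; first by rewrite (leq_trans sp1).
  by exists u, v; split=> //; rewrite (leq_trans _ (leqnSn _)).
pose toC := map_poly (real_complex R).
have [z rz] : exists z, root (toC p) z.
  by apply/closed_rootP; rewrite size_map_poly neq_ltn sp1 orbT.
case: z rz => al be rz.
pose Q := ('X - al%:P) ^+ 2 + (be ^+ 2)%:P.
have QE x : Q.[x] = (x - al) ^+ 2 + be ^+ 2 by rewrite /Q !hornerE.
have lt2 : (size (be ^+ 2)%:P < size (('X - al%:P) ^+ 2 : {poly R}))%N.
  by rewrite size_exp_XsubC size_polyC; case: eqP.
have Qm : Q \is monic.
  by rewrite monicE /Q lead_coefDl // lead_coef_exp lead_coefXsubC expr1n.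
have sQ : size Q = 3 by rewrite /Q size_polyDl // size_exp_XsubC.
have Q0 : Q != 0 by rewrite -size_poly_eq0 sQ.
have sr : (size (p %% Q)%R <= 2)%N.
  by have := ltn_modp p Q; rewrite Q0 sQ.
have pE : p = p %/ Q * Q + p %% Q by exact: divp_eq.
set r := p %% Q in sr pE; set q := p %/ Q in pE.
have rE := poly_size2 sr.
have r0 : r = 0.
  have toCQ : (toC Q).[al +i* be] = 0.
    rewrite /toC rmorphD rmorphXn rmorphB /= map_polyX !map_polyC /= !hornerE.
    apply/eqP; rewrite eq_complex /= !(oppr0, addr0, subr0) expr2 /=; apply/andP; split; apply/eqP => /=; ring.
  have : (toC r).[al +i* be] = 0.
    move: rz; rewrite rootE pE /toC rmorphD rmorphM /= hornerD hornerM.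
    by rewrite -/(toC Q) toCQ mulr0 add0r => /eqP.
  rewrite rE /toC rmorphD /= map_polyZ /= map_polyX map_polyC /= !hornerE.
  move/eqP; rewrite eq_complex /= => /andP[/eqP h1 /eqP h2].
  (* For a nonreal root the remainder vanishes outright; a real root of a
     nonnegative polynomial is not simple. *)
  have [b0|b0] := eqVneq be 0; last first.
    have r1 : r`_1 = 0.
      by apply: (mulIf b0); move: h2; rewrite mul0r addr0; lra.
    have r2 : r`_0 = 0 by move: h1; rewrite r1; lra.
    by rewrite r1 r2 scale0r add0r.
  have r0E : r`_0 = - (r`_1 * al) by move: h1; rewrite b0; lra.
  pose p1 := q * ('X - al%:P) + (r`_1)%:P.
  have p1al : p1.[al] = r`_1 by rewrite /p1 !hornerE subrr mulr0 add0r.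
  have pp1 x : p.[x] = (x - al) * p1.[x].
    by rewrite {1}pE rE r0E hornerD hornerM QE b0 /p1 !hornerE /=; ring.
  have h0 : 0 <= p1.[al].
    apply: horner_ge0_limit => e e0; exists (al + e / 2).
      by rewrite (_ : _ - al = e / 2) ?ger0_norm; lra.
    have := p0 (al + e / 2); rewrite pp1 (_ : _ - al = e / 2) ?pmulr_rge0; lra.
  have h3 : 0 <= (- p1).[al].
    apply: horner_ge0_limit => e e0; exists (al - e / 2).
      by rewrite (_ : _ - al = - (e / 2)) ?normrN ?ger0_norm; lra.
    have := p0 (al - e / 2); rewrite pp1 (_ : _ - al = - (e / 2)) ?hornerN; last lra.
    by rewrite mulNr -mulrN pmulr_rge0 //; lra.
  have r1 : r`_1 = 0 by move: h0 h3; rewrite hornerN p1al; lra.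
  by rewrite r0E r1 mul0r oppr0 scale0r add0r.
move: pE; rewrite r0 addr0 => pE.
have q0 x : 0 <= q.[x].
  apply: horner_ge0_limit => e e0.
  have [y yx yal] : exists2 y, `|y - x| < e & y != al.
    have [xal|xal] := eqVneq x al; last by exists x => //; rewrite subrr normr0.
    exists (x + e / 2); first by rewrite (_ : _ - x = e / 2) ?ger0_norm; lra.
    by rewrite xal gt_eqF // ltrDl; lra.
  exists y => //; have := p0 y; rewrite pE hornerM QE pmulr_lge0 //.
  by apply: ltr_pwDl; rewrite ?sqr_ge0 // exprn_even_gt0 //= subr_eq0.
have sq : (size q <= n.*2.+1)%N.
  by rewrite /q size_divp // sQ leq_subLR (leq_trans sp) // doubleS.
have [u [v [qE su sv]]] := IH q sq q0.
have sX (w : {poly R}) : (size w <= n.+1 -> size (w * ('X - al%:P))%R <= n.+2)%N.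
  move=> sw; rewrite (leq_trans (size_polyMleq _ _)) // size_XsubC addn2 /=.
  by rewrite ltnS.
exists (u * ('X - al%:P) - be *: v), (v * ('X - al%:P) + be *: u); split.
- by rewrite pE qE /Q -!mul_polyC !rmorphXn /=; ring.
- rewrite (leq_trans (size_polyD _ _)) // geq_max sX //= size_polyN.
  by rewrite (leq_trans (size_scale_leq _ _)) // (leq_trans sv).
- rewrite (leq_trans (size_polyD _ _)) // geq_max sX //=.
  by rewrite (leq_trans (size_scale_leq _ _)) // (leq_trans su).
Qed.

End SumOfSquares.

(** * Quadratic forms on the imaginary axis *)

Section StorageFunction.
Variable R : rcfType.
Implicit Types (f g p q u v a b c d : {poly R}).

Definition ievalp (p : {poly R}) (w : R) : R[i] :=
  (map_poly (real_complex R) p).[Complex 0 w].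

Lemma ievalp0 w : ievalp 0 w = 0.
Proof. by rewrite /ievalp rmorph0 horner0. Qed.

Lemma ievalpC (k : R) w : ievalp k%:P w = k%:C.
Proof. by rewrite /ievalp map_polyC hornerC. Qed.

Lemma ievalpD p q w : ievalp (p + q) w = ievalp p w + ievalp q w.
Proof. by rewrite /ievalp rmorphD hornerD. Qed.

Lemma ievalpM p q w : ievalp (p * q) w = ievalp p w * ievalp q w.
Proof. by rewrite /ievalp rmorphM hornerM. Qed.

Lemma ievalpZ k p w : ievalp (k *: p) w = k%:C * ievalp p w.
Proof. by rewrite /ievalp map_polyZ hornerZ. Qed.

Lemma ievalpX w : ievalp 'X w = Complex 0 w.
Proof. by rewrite /ievalp map_polyX hornerX. Qed.

Lemma ievalp_sum (I : Type) (r : seq I) (F : I -> {poly R}) w :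
  ievalp (\sum_(i <- r) F i) w = \sum_(i <- r) ievalp (F i) w.
Proof. by rewrite /ievalp rmorph_sum horner_sum. Qed.

Lemma ievalp_compN p w : ievalp (p \Po (- 'X)) w = conjc (ievalp p w).
Proof.
elim/poly_ind: p => [|p c IH]; first by rewrite comp_poly0 ievalp0 rmorph0.
rewrite comp_polyD comp_polyM comp_polyX comp_polyC !ievalpD !ievalpM IH.
rewrite rmorphD rmorphM /= -scaleN1r ievalpZ ievalpX !ievalpC conjc_real.
congr (_ * _ + _).
by apply/eqP; rewrite eq_complex /=; apply/andP; split; apply/eqP => /=; ring.
Qed.

Lemma ievalp_eq0 p : (forall w, ievalp p w = 0) -> p = 0.
Proof.
move=> H; apply/eqP; apply: contraT => p0.
pose rs := [seq Complex 0 k%:R : R[i] | k <- iota 0 (size p)].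
have : (size rs < size (map_poly (real_complex R) p))%N.
  apply: max_poly_roots; first by rewrite map_poly_eq0.
    by apply/allP => _ /mapP[k _ ->]; rewrite rootE; apply/eqP/H.
  rewrite map_inj_uniq ?iota_uniq // => i j [] /eqP.
  by rewrite eqr_nat => /eqP.
by rewrite size_map_poly size_map size_iota ltnn.
Qed.

(** The real and imaginary parts of a real polynomial on the imaginary axis are
    real polynomials in the frequency. *)
Lemma ievalp_ReIm f : exists fr fi : {poly R},
  [/\ (size fr <= size f)%N, (size fi <= size f)%N &
      forall w, ievalp f w = Complex fr.[w] fi.[w]].
Proof.
have [n] := ubnP (size f); elim: n f => // n IH f sf.
elim/poly_ind: f sf => [|f c _] sf.
  by exists 0, 0; rewrite size_poly0; split=> // w; rewrite ievalp0 horner0.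
have [f0|f0] := eqVneq f 0.
  exists c%:P, 0; rewrite f0 mul0r add0r size_poly0; split=> // w.
  by rewrite ievalpC hornerC horner0.
have sfX : size (f * 'X + c%:P) = (size f).+1 by rewrite size_MXaddC (negPf f0).
have [|fr [fi [s1 s2 H]]] := IH f; first by rewrite sfX ltnS in sf.
exists (- fi * 'X + c%:P), (fr * 'X); rewrite sfX; split.
- by rewrite size_MXaddC; case: ifP => //; rewrite size_polyN.
- by rewrite (leq_trans (size_polyMleq _ _)) // size_polyX addn2.
move=> w; rewrite ievalpD ievalpM H ievalpX ievalpC !hornerE.
by apply/eqP; rewrite eq_complex /=; apply/andP; split; apply/eqP => /=; ring.
Qed.

(** Even and odd part of a polynomial in the frequency are, up to the factor i,
    values of real polynomials on the imaginary axis. *)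
Lemma even_odd_ievalp u : exists c d : {poly R},
  [/\ (size c <= size u)%N, (size d <= size u)%N &
      forall w, ievalp c w = ((u.[w] + u.[- w]) / 2)%:C /\
                ievalp d w = Complex 0 ((u.[w] - u.[- w]) / 2)].
Proof.
have [n] := ubnP (size u); elim: n u => // n IH u su.
elim/poly_ind: u su => [|u k _] su.
  exists 0, 0; rewrite size_poly0; split=> // w; rewrite ievalp0 !horner0.
  by rewrite subr0 addr0 mul0r.
have [u0|u0] := eqVneq u 0.
  exists k%:P, 0; rewrite u0 mul0r add0r size_poly0; split=> // w.
  rewrite ievalpC ievalp0 !hornerC subrr mul0r; split=> //; congr _%:C; lra.
have suX : size (u * 'X + k%:P) = (size u).+1 by rewrite size_MXaddC (negPf u0).
have [|c [d [s1 s2 H]]] := IH u; first by rewrite suX ltnS in su.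
exists (- d * 'X + k%:P), (c * 'X); rewrite suX; split.
- by rewrite size_MXaddC; case: ifP => //; rewrite size_polyN.
- by rewrite (leq_trans (size_polyMleq _ _)) // size_polyX addn2.
move=> w; have [H1 H2] := H w; rewrite ievalpD !ievalpM -scaleN1r ievalpZ.
rewrite H1 H2 ievalpX ievalpC !hornerE.
by split; apply/eqP; rewrite eq_complex /=; apply/andP; split; apply/eqP => /=; field.
Qed.

Definition sqnormc (z : R[i]) : R := complex.Re z ^+ 2 + complex.Im z ^+ 2.

Definition dotc (z z' : R[i]) : R :=
  complex.Re z * complex.Re z' + complex.Im z * complex.Im z'.

(** The left-hand side is an even polynomial in the frequency and, being
    nonnegative, of the form [u^2 + v^2]. By evenness the products of the even
    and the odd parts of [u] and [v] cancel, and each of the four remaining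
    squares is the squared modulus of a real polynomial on the imaginary axis. *)
Lemma nonneg_on_iaxis_sum_squares m (a b : {poly R}) (p11 p12 p22 : R) :
  (size a <= m.+1)%N -> (size b <= m.+1)%N ->
  (forall w, 0 <= p11 * sqnormc (ievalp a w)
    + 2 * p12 * dotc (ievalp a w) (ievalp b w) + p22 * sqnormc (ievalp b w)) ->
  exists2 cs : seq {poly R}, all (fun c => size c <= m.+1)%N cs &
    forall w, p11 * sqnormc (ievalp a w)
      + 2 * p12 * dotc (ievalp a w) (ievalp b w) + p22 * sqnormc (ievalp b w)
      = \sum_(c <- cs) sqnormc (ievalp c w).
Proof.
move=> sa sb H.
have [ar [ai [sar sai aE]]] := ievalp_ReIm a.
have [br [bi [sbr sbi bE]]] := ievalp_ReIm b.
pose N := p11 *: (ar ^+ 2 + ai ^+ 2) + (2 * p12) *: (ar * br + ai * bi)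
          + p22 *: (br ^+ 2 + bi ^+ 2).
have NE w : N.[w] = p11 * sqnormc (ievalp a w)
    + 2 * p12 * dotc (ievalp a w) (ievalp b w) + p22 * sqnormc (ievalp b w).
  by rewrite aE bE /N /sqnormc /dotc !hornerE /=; ring.
have sM (x y : {poly R}) : (size x <= m.+1 -> size y <= m.+1 ->
    size (x * y)%R <= m.*2.+1)%N.
  move=> sx sy; apply: leq_trans (size_polyMleq _ _) _; lia.
have sZ k (x : {poly R}) : (size x <= m.*2.+1 -> size (k *: x) <= m.*2.+1)%N.
  by move=> sx; exact: leq_trans (size_scale_leq _ _) _.
have sD (x y : {poly R}) : (size x <= m.*2.+1 -> size y <= m.*2.+1 ->
    size (x + y)%R <= m.*2.+1)%N.
  by move=> sx sy; rewrite (leq_trans (size_polyD _ _)) // geq_max sx.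
have := leq_trans sar sa; have := leq_trans sai sa => sai' sar'.
have := leq_trans sbr sb; have := leq_trans sbi sb => sbi' sbr'.
have sN : (size N <= m.*2.+1)%N.
  by rewrite /N !expr2; apply: (sD); [apply: (sD)|]; apply: (sZ); apply: (sD); exact: (sM).
have [|u [v [Nuv su sv]]] := sum_two_squares sN; first by move=> x; rewrite NE.
have [c1 [d1 [sc1 sd1 cd1]]] := even_odd_ievalp u.
have [c2 [d2 [sc2 sd2 cd2]]] := even_odd_ievalp v.
exists [:: c1; d1; c2; d2].
  rewrite /= andbT; apply/and4P; split.
  exact: leq_trans su. exact: leq_trans su. exact: leq_trans sv. exact: leq_trans sv.
move=> w; have Neven : N.[- w] = N.[w].
  rewrite !NE.
  have cj f : ievalp f (- w) = conjc (ievalp f w).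
    have [fr [fi [_ _ fE]]] := ievalp_ReIm f.
    rewrite -ievalp_compN /ievalp map_comp_poly rmorphN /= map_polyX horner_comp.
    rewrite hornerN hornerX; congr (_.[_]).
    by apply/eqP; rewrite eq_complex /= oppr0 !eqxx.
  rewrite !cj; case: (ievalp a w) => x1 x2; case: (ievalp b w) => y1 y2.
  by rewrite /sqnormc /dotc /=; ring.
rewrite -NE (_ : N.[w] = (N.[w] + N.[- w]) / 2); last by rewrite Neven; lra.
rewrite !big_cons big_nil; have [-> ->] := cd1 w; have [-> ->] := cd2 w.
by rewrite Nuv /sqnormc !hornerE /=; field.
Qed.

(** A quadratic form in [Y 0, ..., Y m] is the derivative of a quadratic form in
    [Y 0, ..., Y (m - 1)], where [Y j.+1] stands for the derivative of [Y j], as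
    soon as its alternating antidiagonal sums vanish: the coefficients of the
    latter are found by division by the sum of the two variables. *)
Section Telescope.
Variables (m : nat) (S : nat -> nat -> R).
Hypothesis S0l : forall i j, (m < i)%N -> S i j = 0.
Hypothesis S0r : forall i j, (m < j)%N -> S i j = 0.
Hypothesis Santi : forall k, \sum_(l < k.+1) (-1) ^+ l * S l (k - l) = 0.

Definition antidiff (i j : nat) : R :=
  \sum_(l < j.+1) (-1) ^+ l * S (i.+1 + l) (j - l).

Let Q := antidiff.

Lemma antidiff_gel i j : (m <= i)%N -> Q i j = 0.
Proof.
by move=> mi; rewrite /Q /antidiff big1 // => l _; rewrite S0l ?mulr0 //; lia.
Qed.

Lemma antidiff_ger i j : (m <= j)%N -> Q i j = 0.
Proof.
move=> mj; have := Santi (i.+1 + j); rewrite -addnS big_split_ord /=.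
rewrite big1 ?add0r; last first.
  by move=> l _; rewrite S0r ?mulr0 //; have := ltn_ord l; lia.
under eq_bigr => l _ do rewrite exprD -mulrA subnDl.
by rewrite -mulr_sumr => /eqP; rewrite mulf_eq0 signr_eq0 => /eqP.
Qed.

Lemma antidiffE i j :
  S i j = (if i is i'.+1 then Q i' j else 0) + (if j is j'.+1 then Q i j' else 0).
Proof.
have QS i' j' : S i'.+1 j' = Q i' j' + (if j' is j''.+1 then Q i'.+1 j'' else 0).
  rewrite {1}/Q /antidiff big_ord_recl /= addn0 subn0 expr0 mul1r.
  case: j' => [|j']; first by rewrite big_ord0 !addr0.
  rewrite -addrA -[LHS]addr0; congr (_ + _); rewrite /Q /antidiff -big_split big1 //=.
  by move=> l _; rewrite /bump /= add1n exprS addnS subSS addSnnS addnS; ring.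
case: i => [|i]; last exact: QS.
rewrite add0r; have := Santi j; rewrite big_ord_recl /= subn0 expr0 mul1r.
case: j => [|j]; first by rewrite big_ord0 addr0.
move/eqP; rewrite addr_eq0 => /eqP ->; rewrite /Q /antidiff -sumrN.
by apply: eq_bigr => l _; rewrite /bump /= add1n exprS subSS; ring.
Qed.

Lemma antidiff_form (Y : nat -> R) :
  \sum_(i < m.+1) \sum_(j < m.+1) S i j * (Y i * Y j) =
  \sum_(i < m) \sum_(j < m) Q i j * (Y i.+1 * Y j + Y i * Y j.+1).
Proof.
under eq_bigr => i _ do under eq_bigr => j _ do rewrite antidiffE mulrDl.
under eq_bigr => i _ do rewrite big_split /=.
rewrite big_split /= big_ord_recl /= big1 ?add0r; last by move=> j _; rewrite mul0r.
under [RHS]eq_bigr => i _ do under eq_bigr => j _ do rewrite mulrDr.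
under [RHS]eq_bigr => i _ do rewrite big_split /=.
rewrite [RHS]big_split /=; congr (_ + _).
  apply: eq_bigr => i _; rewrite big_ord_recr /= antidiff_ger // mul0r addr0.
  by apply: eq_bigr => j _; rewrite /bump /= add1n.
rewrite big_ord_recr /= [X in _ + X]big1 ?addr0; last first.
  by move=> [[|j] jm] _ /=; rewrite ?antidiff_gel ?mul0r.
apply: eq_bigr => i _; rewrite big_ord_recl /= mul0r add0r.
by apply: eq_bigr => j _; rewrite /bump /= add1n.
Qed.

End Telescope.

(** The value of [f(d/dt) y] at a time at which [y] has the derivatives [Y i]. *)
Definition polyval (f : {poly R}) m (Y : nat -> R) : R := \sum_(i < m.+1) f`_i * Y i.

(** A quadratic form in the derivatives of a function that vanishes on the
    exponentials of imaginary exponent is an exact derivative: the polynomial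
    in two variables formed by its coefficients vanishes at opposite arguments,
    which is the condition on the alternating antidiagonal sums. *)
Lemma polyval_quadratic_exact m (L : seq (R * ({poly R} * {poly R}))) :
  all (fun t : R * ({poly R} * {poly R}) => (size t.2.1 <= m.+1) && (size t.2.2 <= m.+1))%N L ->
  (forall w, \sum_(t <- L) t.1 * dotc (ievalp t.2.1 w) (ievalp t.2.2 w) = 0) ->
  exists Q : nat -> nat -> R, forall Y : nat -> R,
    2 * \sum_(t <- L) t.1 * (polyval t.2.1 m Y * polyval t.2.2 m Y) =
    \sum_(i < m) \sum_(j < m) Q i j * (Y i.+1 * Y j + Y i * Y j.+1).
Proof.
move=> /allP sL HL.
pose S i j := \sum_(t <- L) t.1 * (t.2.1`_i * t.2.2`_j + t.2.2`_i * t.2.1`_j).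
have S0l i j : (m < i)%N -> S i j = 0.
  move=> mi; rewrite /S big1_seq // => t /sL /andP[s1 s2].
  by rewrite !(@nth_default _ 0 _ i) ?(leq_trans s1) ?(leq_trans s2) // !mul0r addr0 mulr0.
have S0r i j : (m < j)%N -> S i j = 0.
  move=> mi; rewrite /S big1_seq // => t /sL /andP[s1 s2].
  by rewrite !(@nth_default _ 0 _ j) ?(leq_trans s1) ?(leq_trans s2) // !mulr0 addr0 mulr0.
pose N := \sum_(t <- L) t.1 *: ((t.2.1 \Po (- 'X)) * t.2.2 + (t.2.2 \Po (- 'X)) * t.2.1).
have N0 : N = 0.
  apply: ievalp_eq0 => w; rewrite /N ievalp_sum.
  rewrite [RHS](_ : 0 = (2 * \sum_(t <- L) t.1 * dotc (ievalp t.2.1 w) (ievalp t.2.2 w))%:C);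
    last by rewrite HL mulr0.
  rewrite mulr_sumr [RHS]rmorph_sum; apply: eq_bigr => t _.
  rewrite ievalpZ ievalpD !ievalpM !ievalp_compN.
  case: (ievalp t.2.1 w) => x1 x2; case: (ievalp t.2.2 w) => y1 y2.
  by apply/eqP; rewrite eq_complex /dotc /=; apply/andP; split; apply/eqP => /=; ring.
have coefN f k : (f \Po (- 'X))`_k = (-1) ^+ k * f`_k.
  elim/poly_ind: f k => [|f c IH] k; first by rewrite comp_poly0 coef0 mulr0.
  rewrite comp_polyD comp_polyM comp_polyX comp_polyC mulrN !coefD coefN !coefMX !coefC.
  case: k => [|k]; first by rewrite /= oppr0 expr0 mul1r.
  by rewrite /= IH exprS !addr0; ring.
have Santi k : \sum_(l < k.+1) (-1) ^+ l * S l (k - l)%N = 0.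
  have := congr1 (fun p : {poly R} => p`_k) N0; rewrite coef0 /N coef_sum => E.
  rewrite -[RHS]E /S.
  under eq_bigr => l _ do rewrite mulr_sumr.
  rewrite exchange_big /=; apply: eq_bigr => t _.
  rewrite coefZ coefD !coefM -big_split mulr_sumr /=; apply: eq_bigr => l _.
  by rewrite !coefN; ring.
exists (antidiff S) => Y; rewrite -(antidiff_form S0l S0r Santi) mulr_sumr.
under [RHS]eq_bigr => i _ do under eq_bigr => j _ do rewrite /S mulr_suml.
under [RHS]eq_bigr => i _ do rewrite exchange_big /=.
rewrite [RHS]exchange_big /=; apply: eq_bigr => t _.
have dbl f g : polyval f m Y * polyval g m Y =
    \sum_(i < m.+1) \sum_(j < m.+1) f`_i * g`_j * (Y i * Y j).
  rewrite /polyval mulr_suml; apply: eq_bigr => i _; rewrite mulr_sumr.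
  by apply: eq_bigr => j _; ring.
rewrite (_ : 2 * _ = t.1 * (polyval t.2.1 m Y * polyval t.2.2 m Y
    + polyval t.2.2 m Y * polyval t.2.1 m Y)); last by ring.
rewrite !dbl -big_split mulr_sumr; apply: eq_bigr => i _ /=.
rewrite -big_split mulr_sumr; apply: eq_bigr => j _ /=; ring.
Qed.

End StorageFunction.

(** * The Lyapunov inequality *)

Section Lyapunov.
Variable C : numClosedFieldType.
Local Notation "M ^H" := (map_mx Num.conj (M^T)) (at level 8, format "M ^H").

Lemma hermM m n p (A : 'M[C]_(m, n)) (B : 'M[C]_(n, p)) : (A *m B)^H = B^H *m A^H.
Proof. by rewrite trmx_mul map_mxM. Qed.

Lemma hermD m n (A B : 'M[C]_(m, n)) : (A + B)^H = A^H + B^H.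
Proof. by rewrite linearD map_mxD. Qed.

Lemma hermK m n (A : 'M[C]_(m, n)) : A^H^H = A.
Proof. by apply/matrixP => i j; rewrite !mxE conjCK. Qed.

Lemma mx11D (A B : 'M[C]_1) : (A + B) 0 0 = A 0 0 + B 0 0.
Proof. by rewrite mxE. Qed.

Lemma mx11M (A B : 'M[C]_1) : (A *m B) 0 0 = A 0 0 * B 0 0.
Proof. by rewrite mxE big_ord1. Qed.

Lemma mx11H (A : 'M[C]_1) : A^H 0 0 = (A 0 0)^*.
Proof. by rewrite !mxE. Qed.

Lemma row_normC n (v : 'rV[C]_n) : (v *m v^H) 0 0 = \sum_i `|v 0 i| ^+ 2.
Proof. by rewrite mxE; apply: eq_bigr => i _; rewrite !mxE normCK. Qed.

(** Induction on the dimension. The corner [q] of [Q] is nonnegative because [A]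
    has its first basis vector as an eigenvector, and if it is positive, then
    the Schur complement of [q] in [Q] satisfies the inequality for the rest of
    [A]. If [q] vanishes, then the inequality leaves no room for the
    off-diagonal entry [v] of its left-hand side; [v = 0] is a Sylvester
    equation for the row [r] next to [q], which has only the solution zero. *)
Lemma lyapunov_trig n (A Q : 'M[C]_n) : is_trig_mx A ->
  (forall i, A i i + (A i i)^* < 0) -> Q^H = Q ->
  (forall x : 'rV[C]_n, (x *m (A *m Q + Q *m A^H) *m x^H) 0 0 <= 0) ->
  forall x : 'rV[C]_n, 0 <= (x *m Q *m x^H) 0 0.
Proof.
elim: n A Q => [|n IH] A Q trA reA hQ hL x; first by rewrite thinmx0 !mul0mx mxE.
change (n.+1) with (1 + n)%N in A, Q, trA, reA, hQ, hL, x |- *.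
pose lam := ulsubmx A : 'M[C]_1; pose c := dlsubmx A; pose A2 := drsubmx A.
pose q := ulsubmx Q : 'M[C]_1; pose r := ursubmx Q; pose Q2 := drsubmx Q.
have AE : A = block_mx lam 0 c A2.
  by rewrite -[LHS]submxK -/lam -/c -/A2 (ursubmx_trig _ trA).
have := hQ; rewrite -{1 2}[Q]submxK tr_block_mx map_block_mx -/q -/r -/Q2.
rewrite submxK -[RHS]submxK -/q -/r -/Q2 => /eq_block_mx[q_real _ dlE hQ2].
have QE : Q = block_mx q r r^H Q2 by rewrite -[LHS]submxK dlE.
have re_lam : lam 0 0 + (lam 0 0)^* < 0.
  by have := reA (lshift n 0); rewrite AE block_mxEul.
have reA2 i : A2 i i + (A2 i i)^* < 0.
  by have := reA (rshift 1 i); rewrite AE block_mxEdr.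
have trA2 : is_trig_mx A2 by apply: drsubmx_trig.
clearbody lam c A2 q r Q2.
have LE (y : 'rV[C]_(1 + n)) : (y *m (A *m Q + Q *m A^H) *m y^H) 0 0 =
    (y *m A *m (y *m Q)^H) 0 0 + ((y *m A *m (y *m Q)^H) 0 0)^*.
  rewrite -mx11H -mx11D !hermM hermK; congr (fun_of_matrix _ 0 0).
  by rewrite mulmxDr mulmxDl !mulmxA !hQ.
have rowE (a : 'M[C]_1) (b : 'rV[C]_n) : (row_mx a b)^H = col_mx a^H b^H.
  by rewrite tr_row_mx map_col_mx.
have yA (a : 'M[C]_1) (b : 'rV[C]_n) :
    row_mx a b *m A = row_mx (a *m lam + b *m c) (b *m A2).
  by rewrite AE mul_row_block mulmx0 add0r.
have yQ (a : 'M[C]_1) (b : 'rV[C]_n) :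
    row_mx a b *m Q = row_mx (a *m q + b *m r^H) (a *m r + b *m Q2).
  by rewrite QE mul_row_block.
have qr : (q 0 0)^* = q 0 0 by rewrite -mx11H q_real.
have q0 : 0 <= q 0 0.
  have := hL (row_mx 1%:M 0); rewrite LE yA yQ !mul0mx !mul1mx !addr0 rowE mul_row_col.
  rewrite mul0mx addr0 q_real mx11M => h.
  by move: h; rewrite rmorphM /= qr -mulrDl nmulr_rle0.
(* The values of the form at [(al, v)] with [al] real are affine in [al], with
   a slope proportional to the squared norm of [v]. *)
have rq0 : q = 0 -> r = 0.
  move=> qE; pose v := lam *m r + r *m A2^H.
  have v0 : v = 0.
    pose k := (v *m v^H) 0 0; pose y := v.
    have k0 : 0 <= k by rewrite /k row_normC sumr_ge0 // => i _; rewrite exprn_ge0.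
    have kr : k^* = k by rewrite conj_Creal // ger0_real.
    pose L2 := drsubmx (A *m Q + Q *m A^H).
    have LmE : A *m Q + Q *m A^H = block_mx 0 v v^H L2.
      rewrite -[LHS]submxK -/L2 AE QE qE tr_block_mx map_block_mx !mulmx_block.
      rewrite add_block_mx block_mxKul block_mxKur block_mxKdl !linear0 !map_mx0.
      rewrite !(mulmx0, mul0mx, add0r, addr0); congr (block_mx _ _ _ _).
      by rewrite /v hermD !hermM hermK addrC.
    have form (al : C) : al^* = al ->
        (row_mx al%:M y *m (A *m Q + Q *m A^H) *m (row_mx al%:M y)^H) 0 0
        = 2 * al * k + (y *m L2 *m y^H) 0 0.
      move=> alr; rewrite LmE mul_row_block rowE mul_row_col mulmx0 add0r.
      have aH : (al%:M : 'M[C]_1)^H = al%:M by rewrite tr_scalar_mx map_scalar_mx /= alr.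
      rewrite aH mulmxDl !mx11D addrA; congr (_ + _).
      rewrite mul_mx_scalar mul_scalar_mx -scalemxAl.
      have sE (M : 'M[C]_1) : (al *: M) 0 0 = al * M 0 0 by rewrite mxE.
      rewrite !sE (_ : (y *m v^H) 0 0 = k) //.
      ring.
    have L2r : (y *m L2 *m y^H) 0 0 <= 0.
      by have := form 0 (rmorph0 _); rewrite mulr0 mul0r add0r => <-; exact: hL.
    have : k = 0.
      apply/eqP/negPn/negP => kn0.
      have kp : 0 < k by rewrite lt_def kn0.
      pose al := (1 - (y *m L2 *m y^H) 0 0) / (2 * k).
      have alr : al^* = al.
        apply: conj_Creal; apply: rpred_div; last by rewrite gtr0_real ?mulr_gt0.
        by apply: rpredB; rewrite ?rpred1 // ler0_real.
      have := hL (row_mx al%:M y); rewrite (form _ alr).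
      rewrite (_ : 2 * al * k = 1 - (y *m L2 *m y^H) 0 0); last by rewrite /al; field.
      by rewrite subrK ler10.
    move/eqP; rewrite /k row_normC psumr_eq0 => [/allP h|i _]; last by rewrite exprn_ge0.
    apply/rowP => i; have := h i (mem_index_enum _).
    by rewrite /= expf_eq0 /= normr_eq0 => /eqP ->; rewrite mxE.
  have rE : (A2 + ((lam 0 0)^*)%:M) *m r^H = 0.
    have := congr1 (fun M => M^H) v0; rewrite /v hermD !hermM hermK linear0 map_mx0.
    rewrite {1}(mx11_scalar lam) tr_scalar_mx map_scalar_mx /= mul_mx_scalar -mul_scalar_mx.
    by rewrite mulmxDl addrC.
  have unitA : (A2 + ((lam 0 0)^*)%:M) \in unitmx.
    rewrite unitmxE det_trig ?unitfE; last first.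
      apply/is_trig_mxP => i j ij; have /is_trig_mxP trA2' := trA2.
      by rewrite !mxE trA2' // -val_eqE ltn_eqF // mulr0n addr0.
    apply/prodf_neq0 => i _; rewrite !mxE eqxx mulr1n; apply: contraTneq isT => e.
    have := ltrD (reA2 i) re_lam.
    rewrite (_ : A2 i i + (A2 i i)^* + _ =
        (A2 i i + (lam 0 0)^*) + (A2 i i + (lam 0 0)^*)^*); last first.
      by rewrite rmorphD /= conjCK; ring.
    by rewrite e rmorph0 !addr0 ltxx.
  have r0 : r^H = 0 by rewrite -[LHS](mulKmx unitA) rE mulmx0.
  by rewrite -[r]hermK r0 linear0 map_mx0.
have [t tE] : exists t : 'cV[C]_n, t *m q + r^H = 0.
  have [q00|qn0] := eqVneq q 0.
    by exists 0; rewrite mul0mx add0r rq0 // linear0 map_mx0.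
  have qn : q 0 0 != 0 by apply: contraNneq qn0 => e; rewrite (mx11_scalar q) e raddf0.
  exists (- (q 0 0)^-1 *: r^H); rewrite {2}(mx11_scalar q) mul_mx_scalar scalerA.
  by rewrite mulrN divff // scaleN1r addNr.
pose T := row_mx t 1%:M : 'M[C]_(n, 1 + n).
pose Q' := t *m r + Q2.
have TQ : T *m Q = row_mx 0 Q' by rewrite /T QE mul_row_block !mul1mx tE.
have TA : T *m A = row_mx (t *m lam + c) A2 by rewrite /T AE mul_row_block mulmx0 !mul1mx add0r.
have TQT : T *m Q *m T^H = Q'.
  by rewrite TQ tr_row_mx map_col_mx mul_row_col mul0mx add0r trmx1 map_mx1 mulmx1.
have hQ' : Q'^H = Q' by rewrite -TQT !hermM hermK hQ mulmxA.
clearbody Q'.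
have IHQ : forall y : 'rV[C]_n, 0 <= (y *m Q' *m y^H) 0 0.
  apply: (IH A2) => // y; have := hL (y *m T).
  rewrite (_ : y *m T *m _ *m _ = y *m (T *m (A *m Q + Q *m A^H) *m T^H) *m y^H);
    last by rewrite hermM !mulmxA.
  suff -> : T *m (A *m Q + Q *m A^H) *m T^H = A2 *m Q' + Q' *m A2^H by [].
  have half : T *m A *m (T *m Q)^H = A2 *m Q'.
    by rewrite TA TQ tr_row_mx map_col_mx mul_row_col linear0 map_mx0 mulmx0 add0r hQ'.
  by rewrite -{2}hQ' -hermM -half !hermM !hermK mulmxDr mulmxDl !mulmxA !hQ.
pose x1 := lsubmx x : 'M[C]_1; pose x2 := rsubmx x.
have xE : x = row_mx (x1 - x2 *m t) 0 + x2 *m T.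
  by rewrite /T mul_mx_row mulmx1 add_row_mx subrK add0r -[LHS]hsubmxK.
set s := x1 - x2 *m t in xE; pose w : 'rV[C]_(1 + n) := row_mx s 0.
have wT : T *m Q *m w^H = 0.
  by rewrite TQ rowE mul_row_col mul0mx add0r linear0 map_mx0 mulmx0.
have Tw : w *m Q *m T^H = 0.
  have := congr1 (fun M => M^H) wT; rewrite !hermM hermK hQ linear0 map_mx0.
  by rewrite mulmxA.
have -> : x *m Q *m x^H = w *m Q *m w^H + x2 *m Q' *m x2^H.
  rewrite xE -/w hermD hermM !mulmxDl !mulmxDr !mulmxA Tw mul0mx addr0.
  rewrite -!mulmxA (mulmxA T) wT mulmx0 add0r; congr (_ + _).
  by rewrite -TQT !mulmxA.
rewrite mx11D addr_ge0 //.
rewrite /w yQ !mul0mx !addr0 rowE mul_row_col linear0 map_mx0 mulmx0 addr0.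
rewrite -mulmxA !mx11M mx11H mulrCA mulr_ge0 // -normCK exprn_ge0 //.
Qed.

(** A Schur triangularization turns the spectrum into a diagonal. *)
Lemma lyapunov_complex n (A Q : 'M[C]_n) :
  (forall l, eigenvalue A l -> l + l^* < 0) -> Q^H = Q ->
  (forall x : 'rV[C]_n, (x *m (A *m Q + Q *m A^H) *m x^H) 0 0 <= 0) ->
  forall x : 'rV[C]_n, 0 <= (x *m Q *m x^H) 0 0.
Proof.
move=> hA hQ hL x; have [n0|n0] := posnP n.
  by move: (n0) A Q hA hQ hL x => -> A Q *; rewrite thinmx0 !mul0mx mxE.
have [P Pu] := Schur A n0; have Punit := unitarymx_unit Pu.
have PH : P^H = invmx P by rewrite invmx_unitary.
rewrite /similar_to /= conjumx // -PH => trT.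
set T := P *m A *m P^H in trT; pose QT := P *m Q *m P^H.
have PK p (M : 'M[C]_(p, n)) : M *m P^H *m P = M by rewrite PH mulmxKV.
have trev i : T i i + (T i i)^* < 0.
  apply: hA; have : eigenvalue T (T i i).
    rewrite eigenvalue_root_char char_poly_trig // rootE horner_prod.
    by rewrite (bigD1 i) //= !hornerE subrr mul0r.
  case/eigenvalueP => v vT v0; apply/eigenvalueP; exists (v *m P).
    by rewrite scalemxAl -vT /T !mulmxA PK.
  by apply: contraNneq v0 => e; rewrite -[v](mulmxK Punit) e mul0mx.
have QTH : QT^H = QT by rewrite /QT !hermM hermK hQ mulmxA.
have LT (z : 'rV[C]_n) : (z *m (T *m QT + QT *m T^H) *m z^H) 0 0 <= 0.
  have := hL (z *m P); congr (_ <= _); congr (fun_of_matrix _ 0 0).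
  by rewrite /T /QT !hermM hermK !mulmxDr !mulmxDl !mulmxA !PK.
have := lyapunov_trig trT trev QTH LT (x *m P^H).
by rewrite /QT hermM hermK !mulmxA !PK.
Qed.

End Lyapunov.

Section RealLyapunov.
Variable R : rcfType.

Lemma conj_real_complex (x : R) : (x%:C)^* = x%:C :> R[i].
Proof. by apply: conj_Creal; rewrite complex_real. Qed.

Lemma conj_conjc (z : R[i]) : z^* = conjc z.
Proof. by []. Qed.

(** The complex statement applies since a real symmetric form takes, at a
    complex vector, the sum of its values at the real and the imaginary part. *)
Lemma lyapunov_psd n (A Q : 'M[R]_n) :
  (forall l : R[i], root (map_poly (real_complex R) (char_poly A)) l -> complex.Re l < 0) ->
  Q^T = Q ->
  (forall x : 'cV[R]_n, (x^T *m (A^T *m Q + Q *m A) *m x) 0 0 <= 0) ->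
  forall x : 'cV[R]_n, 0 <= (x^T *m Q *m x) 0 0.
Proof.
move=> hA hQ hL x.
pose cx p q (M : 'M[R]_(p, q)) := map_mx (real_complex R) M.
pose H p q (M : 'M[R[i]]_(p, q)) := map_mx Num.conj M^T.
have cxH p q (M : 'M[R]_(p, q)) : H _ _ (cx _ _ M) = cx _ _ M^T.
  by apply/matrixP => i j; rewrite !mxE conj_real_complex.
have cxM p q r (M1 : 'M[R]_(p, q)) (M2 : 'M[R]_(q, r)) :
  cx _ _ M1 *m cx _ _ M2 = cx _ _ (M1 *m M2) by rewrite /cx map_mxM.
have form (M : 'M[R]_n) (y : 'rV[R[i]]_n) : M^T = M ->
    let u := \col_i complex.Re (y 0 i) in let v := \col_i complex.Im (y 0 i) in
    (y *m cx _ _ M *m H _ _ y) 0 0 =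
      ((u^T *m M *m u) 0 0 + (v^T *m M *m v) 0 0)%:C.
  move=> hM u v.
  have yE : y = cx _ _ u^T + 'i%C *: cx _ _ v^T.
    by apply/rowP => i; rewrite !mxE [LHS]complexE.
  have HyE : H _ _ y = cx _ _ u - 'i%C *: cx _ _ v.
    apply/colP => i; rewrite !mxE conj_conjc; case: (y 0 i) => a b /=.
    by apply/eqP; rewrite eq_complex /=; apply/andP; split; apply/eqP => /=; ring.
  rewrite HyE {1}yE mulmxDl mulmxBr !mulmxDl -!scalemxAl -!scalemxAr scalerA.
  rewrite !cxM.
  have cross : v^T *m M *m u = u^T *m M *m v.
    by rewrite -[LHS](trmxK (_ *m u)) [X in X^T]mx11_scalar tr_scalar_mx -mx11_scalar
      !trmx_mul trmxK hM mulmxA.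
  rewrite cross !mxE /=; apply/eqP; rewrite eq_complex /=.
  by apply/andP; split; apply/eqP => /=; ring.
have charE : map_poly (real_complex R) (char_poly A) = char_poly (cx _ _ A^T).
  rewrite map_char_poly /cx -map_trmx /char_poly -[RHS]det_tr; congr (\det _).
  by rewrite /char_poly_mx linearB /= tr_scalar_mx !map_trmx trmxK.
have ev l : eigenvalue (cx _ _ A^T) l -> l + l^* < 0.
  rewrite eigenvalue_root_char -charE => /hA l0.
  by rewrite conj_conjc addcJ pmulr_rlt0 ?ltr0n // -[0 : R[i]]/(0%:C) ltcR.
have L (y : 'rV[R[i]]_n) : (y *m (cx _ _ A^T *m cx _ _ Q + cx _ _ Q *m H _ _ (cx _ _ A^T)) *m H _ _ y) 0 0 <= 0.
  rewrite cxH trmxK !cxM (_ : _ + _ = cx _ _ (A^T *m Q + Q *m A)); last by rewrite /cx map_mxD.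
  rewrite form; last by rewrite linearD /= !trmx_mul trmxK hQ addrC.
  by rewrite -[0 : R[i]]/(0%:C) lecR; apply: ler_wnDl; rewrite hL.
have hQc : H _ _ (cx _ _ Q) = cx _ _ Q by rewrite cxH hQ.
have := lyapunov_complex ev hQc L (cx _ _ x^T); rewrite -/(H _ _ _) cxH trmxK !cxM.
by rewrite mxE -[0 : R[i]]/(0%:C) lecR.
Qed.
End RealLyapunov.

(** * A storage function for a stable scalar transfer function *)

Section ScalarKYP.
Variable R : rcfType.

(** The Kalman-Yakubovich-Popov lemma for [b / a], with a quadratic storage function [Q] in
    the first [m] derivatives of a function [y]. The quadratic form in
    [a(d/dt) y] and [b(d/dt) y] differs from a sum of squares [c(d/dt) y ^ 2] by
    a form that vanishes on the imaginary axis, hence by the derivative of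
    such a [Q]. Along the solutions of [a(d/dt) y = 0] this derivative is at
    most zero, where the sign of [p22] enters, and since these solutions decay,
    [Q] is nonnegative. *)
Lemma scalar_kyp (a b : {poly R}) (p11 p12 p22 : R) (m := (size a).-1) :
  a \is monic -> (size b <= size a)%N ->
  (forall l : R[i], root (map_poly (real_complex R) a) l -> complex.Re l < 0) ->
  p22 <= 0 ->
  (forall w, 0 <= p11 * sqnormc (ievalp a w)
    + 2 * p12 * dotc (ievalp a w) (ievalp b w) + p22 * sqnormc (ievalp b w)) ->
  exists Q : nat -> nat -> R,
    (forall Y : nat -> R, 0 <= \sum_(i < m) \sum_(j < m) Q i j * (Y i * Y j)) /\
    (forall Y : nat -> R,
      \sum_(i < m) \sum_(j < m) Q i j * (Y i.+1 * Y j + Y i * Y j.+1) <=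
      p11 * polyval a m Y ^+ 2 + 2 * p12 * (polyval a m Y * polyval b m Y)
      + p22 * polyval b m Y ^+ 2).
Proof.
move=> am sb ha p22_le0 hN.
have a0 : a != 0 by apply: monic_neq0.
have sa : size a = m.+1 by rewrite /m prednK // size_poly_gt0.
have [|||cs /allP scs hcs] := @nonneg_on_iaxis_sum_squares _ m a b p11 p12 p22.
- by rewrite sa.
- by rewrite -sa.
- exact: hN.
pose L := [:: (p11, (a, a)); (2 * p12, (a, b)); (p22, (b, b))]
          ++ [seq (-1 : R, (c, c)) | c <- cs].
have sumL (F : {poly R} -> {poly R} -> R) : \sum_(t <- L) t.1 * F t.2.1 t.2.2 =
    p11 * F a a + 2 * p12 * F a b + p22 * F b b - \sum_(c <- cs) F c c.
  rewrite /L big_cat /= !big_cons big_nil big_map /= addr0 !addrA; congr (_ + _).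
  by rewrite -sumrN; apply: eq_bigr => c _; rewrite mulN1r.
have [||Q0 hQ0] := @polyval_quadratic_exact _ m L.
- apply/allP => t; rewrite /L mem_cat !inE => /orP[/or3P[]/eqP ->|/mapP[c /scs sc ->]] /=;
    rewrite -?sa ?leqnn ?sb //.
  by move: sc; rewrite -sa => ->.
- move=> w; rewrite (sumL (fun f g => dotc (ievalp f w) (ievalp g w))).
  have dd z : dotc z z = sqnormc z by rewrite /dotc /sqnormc -!expr2.
  under [X in _ - X]eq_bigr => c _ do rewrite dd.
  by rewrite !dd hcs subrr.
pose Q i j := Q0 i j / 2.
have hQ (Y : nat -> R) : \sum_(i < m) \sum_(j < m) Q i j * (Y i.+1 * Y j + Y i * Y j.+1) =
  p11 * polyval a m Y ^+ 2 + 2 * p12 * (polyval a m Y * polyval b m Y)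
      + p22 * polyval b m Y ^+ 2 - \sum_(c <- cs) polyval c m Y ^+ 2.
  have := hQ0 Y; rewrite (sumL (fun f g => polyval f m Y * polyval g m Y)).
  under [X in _ - X]eq_bigr => c _ do rewrite -expr2.
  rewrite -!expr2 => h; apply: (@mulfI _ 2); first by rewrite pnatr_eq0.
  rewrite h mulr_sumr; apply: eq_bigr => i _; rewrite mulr_sumr; apply: eq_bigr => j _.
  by rewrite /Q; field.
have cs0 Y : 0 <= \sum_(c <- cs) polyval c m Y ^+ 2.
  by apply: sumr_ge0 => c _; exact: sqr_ge0.
exists Q; split; last by move=> Y; rewrite hQ lerBlDr lerDl.
move=> Y; pose A := companionmx a : 'M[R]_m.
pose Qm : 'M[R]_m := \matrix_(i, j) (Q i j + Q j i).
(* [Z x] continues the initial data [x] by the derivative of order [m] of the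
   solution of [a(d/dt) y = 0], given by the last row of the companion matrix. *)
pose Z (x : 'cV[R]_m) (i : nat) : R :=
  if insub i is Some i' then x i' 0 else - \sum_(j < m) a`_j * x j 0.
have Zm x : Z x m = - \sum_(j < m) a`_j * x j 0 by rewrite /Z insubF // ltnn.
have Zi x (i : 'I_m) : Z x i = x i 0 by rewrite /Z valK.
have ZS x (i : 'I_m) : Z x i.+1 = (A *m x) i 0.
  rewrite mxE; have [im|im] := eqVneq (i : nat) m.-1.
    have -> : i.+1 = m by rewrite im; have := ltn_ord i; lia.
    rewrite Zm -sumrN; apply: eq_bigr => j _.
    by rewrite mxE -/m im eqxx mulNr.
  have im' : (i.+1 < m)%N by have := ltn_ord i; lia.
  rewrite (Zi x (Ordinal im')) (bigD1 (Ordinal im')) //= mxE -/m (negPf im) eqxx mul1r.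
  rewrite big1 ?addr0 // => j ji; rewrite mxE -/m (negPf im).
  by rewrite eq_sym -val_eqE /= in ji; rewrite (negPf ji) mul0r.
have Za x : polyval a m (Z x) = 0.
  rewrite /polyval big_ord_recr /= Zm.
  have -> : a`_m = 1 by move/monicP: am; rewrite lead_coefE.
  by rewrite mul1r; under eq_bigr => i _ do rewrite Zi; rewrite subrr.
have formE (x y : 'cV[R]_m) : (x^T *m Qm *m y) 0 0 =
    \sum_(i < m) \sum_(j < m) Q i j * (x i 0 * y j 0 + x j 0 * y i 0).
  rewrite -mulmxA mxE.
  under eq_bigr => i _ do rewrite !mxE mulr_sumr.
  under [RHS]eq_bigr => i _ do under eq_bigr => j _ do rewrite mulrDr.
  under [RHS]eq_bigr => i _ do rewrite big_split /=.
  rewrite [RHS]big_split /= [X in _ = _ + X]exchange_big -big_split /=.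
  apply: eq_bigr => i _; rewrite -big_split /=; apply: eq_bigr => j _.
  by rewrite mxE; ring.
pose x : 'cV[R]_m := \col_i Y i.
have : 0 <= (x^T *m Qm *m x) 0 0.
  apply: (@lyapunov_psd _ _ A).
  - by rewrite companionmxK.
  - by apply/matrixP => i j; rewrite !mxE addrC.
  move=> z; rewrite mulmxDr mulmxDl mxE.
  have -> : z^T *m (A^T *m Qm) *m z = (A *m z)^T *m Qm *m z by rewrite trmx_mul !mulmxA.
  have -> : z^T *m (Qm *m A) *m z = z^T *m Qm *m (A *m z) by rewrite !mulmxA.
  rewrite !formE.
  have := hQ (Z z); rewrite Za expr0n mul0r !mulr0 !add0r => h.
  have le0 : \sum_(i < m) \sum_(j < m) Q i j * (Z z i.+1 * Z z j + Z z i * Z z j.+1) <= 0.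
    rewrite h lerBlDr add0r; apply: le_trans (cs0 (Z z)).
    by rewrite mulr_le0_ge0 // sqr_ge0.
  have -> : \sum_(i < m) \sum_(j < m) Q i j * ((A *m z) i 0 * z j 0 + (A *m z) j 0 * z i 0)
    = \sum_(i < m) \sum_(j < m) Q i j * (Z z i.+1 * Z z j + Z z i * Z z j.+1).
    apply: eq_bigr => i _; apply: eq_bigr => j _; rewrite !ZS !Zi; ring.
  have -> : \sum_(i < m) \sum_(j < m) Q i j * (z i 0 * (A *m z) j 0 + z j 0 * (A *m z) i 0)
    = \sum_(i < m) \sum_(j < m) Q i j * (Z z i.+1 * Z z j + Z z i * Z z j.+1).
    apply: eq_bigr => i _; apply: eq_bigr => j _; rewrite !ZS !Zi; ring.
  lra.
rewrite formE (_ : \sum_(i < m) _ = 2 * \sum_(i < m) \sum_(j < m) Q i j * (Y i * Y j)).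
  by rewrite pmulr_rge0.
rewrite mulr_sumr; apply: eq_bigr => i _; rewrite mulr_sumr; apply: eq_bigr => j _.
by rewrite !mxE; ring.
Qed.

End ScalarKYP.

(** * Linear systems over the polynomials in an operator *)

Section OperatorAlgebra.
Variables (F : fieldType) (M : lmodType {poly F}).

(** A matrix of polynomials acts on the families of vectors of a module over the
    polynomial ring. *)
Definition mxact m n (P : 'M[{poly F}]_(m, n)) (v : 'I_n -> M) (i : 'I_m) : M :=
  \sum_j P i j *: v j.

Local Notation "A ^P" := (map_mx polyC A) (at level 8, format "A ^P").

Lemma mxactM m n p (P : 'M[{poly F}]_(m, n)) (Q : 'M[{poly F}]_(n, p)) v i :
  mxact (P *m Q) v i = mxact P (mxact Q v) i.
Proof.
rewrite /mxact; under eq_bigr => j _ do rewrite mxE scaler_suml.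
rewrite exchange_big /=; apply: eq_bigr => j _; rewrite scaler_sumr.
by apply: eq_bigr => l _; rewrite scalerA.
Qed.

Lemma mxact_scalar n (p : {poly F}) (v : 'I_n -> M) i : mxact p%:M v i = p *: v i.
Proof.
rewrite /mxact (bigD1 i) //= mxE eqxx big1 ?addr0 // => j ji.
by rewrite mxE eq_sym (negPf ji) scale0r.
Qed.

Lemma mxactD m n (P Q : 'M[{poly F}]_(m, n)) v i : mxact (P + Q) v i = mxact P v i + mxact Q v i.
Proof. by rewrite /mxact -big_split; apply: eq_bigr => j _; rewrite mxE scalerDl. Qed.

Lemma mxactZ m n p (Q : 'M[{poly F}]_(m, n)) v i : mxact (p *: Q) v i = p *: mxact Q v i.
Proof. by rewrite /mxact scaler_sumr; apply: eq_bigr => j _; rewrite mxE scalerA. Qed.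

Lemma mxact_scale m n p (Q : 'M[{poly F}]_(m, n)) v i :
  mxact Q (fun j => p *: v j) i = p *: mxact Q v i.
Proof.
rewrite /mxact scaler_sumr; apply: eq_bigr => j _.
by rewrite !scalerA mulrC.
Qed.

Lemma eq_mxact m n (Q : 'M[{poly F}]_(m, n)) u v i : u =1 v -> mxact Q u i = mxact Q v i.
Proof. by move=> uv; apply: eq_bigr => j _; rewrite uv. Qed.

(** The variable of the polynomials acts as integration from zero, so that
    [1 - 'X A] is the operator of the integrated equation [x' = A x + f]. *)
Definition volterra_mx n (A : 'M[F]_n) : 'M[{poly F}]_n := 1%:M - 'X *: A^P.

Lemma det_volterra_mx0 n (A : 'M[F]_n) : (\det (volterra_mx A)).[0] = 1.
Proof.
rewrite -[LHS]/(horner_eval 0 _) -det_map_mx /volterra_mx map_mxB map_mx1.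
rewrite (_ : map_mx _ ('X *: _) = 0) ?subr0 ?det1 //.
by apply/matrixP => i j; rewrite !mxE /= /horner_eval hornerM hornerX mul0r.
Qed.

(** The transfer matrix, expressed in the integrator and multiplied by the
    determinant of [volterra_mx] to clear the denominators. *)
Definition numer_mx d k l (A : 'M[F]_d) (B : 'M[F]_(d, k)) (C : 'M[F]_(l, d))
    (D : 'M[F]_(l, k)) : 'M[{poly F}]_(l, k) :=
  'X *: (C^P *m \adj (volterra_mx A) *m B^P) + \det (volterra_mx A) *: D^P.

Definition state_eq d k (A : 'M[F]_d) (B : 'M[F]_(d, k)) (x : 'I_d -> M)
    (u : 'I_k -> M) : Prop :=
  forall i, x i = 'X *: (mxact A^P x i + mxact B^P u i).

Lemma state_eq_volterra d k (A : 'M[F]_d) (B : 'M[F]_(d, k)) x u :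
  state_eq A B x u -> forall i, mxact (volterra_mx A) x i = 'X *: mxact B^P u i.
Proof.
move=> xE i; rewrite /volterra_mx -scaleN1r mxactD mxactZ mxact_scalar scale1r.
by rewrite scaleN1r mxactZ {1}xE scalerDr addrAC subrr add0r.
Qed.

Lemma state_eq_cramer d k (A : 'M[F]_d) (B : 'M[F]_(d, k)) x u :
  state_eq A B x u ->
  forall i, \det (volterra_mx A) *: x i = 'X *: mxact (\adj (volterra_mx A) *m B^P) u i.
Proof.
move=> /state_eq_volterra xE i; rewrite -mxact_scalar -mul_adj_mx mxactM.
rewrite (eq_mxact _ _ xE) mxact_scale; congr ('X *: _).
by rewrite mxactM.
Qed.

(** Together with [det_volterra_mx0] this makes [volterra_mx A] act injectively:
    the integrated state equation has at most one solution. *)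
Hypothesis M_inj : forall (p : {poly F}) (v : M), p.[0] != 0 -> p *: v = 0 -> v = 0.

Lemma state_eq_unique d k (A : 'M[F]_d) (B : 'M[F]_(d, k)) x y u v :
  state_eq A B x u -> state_eq A B y v -> u =1 v -> x =1 y.
Proof.
move=> xE yE uv i; apply/eqP; rewrite -subr_eq0; apply/eqP.
apply: (@M_inj (\det (volterra_mx A))); first by rewrite det_volterra_mx0 oner_eq0.
rewrite scalerBr (state_eq_cramer xE) (state_eq_cramer yE) -scalerBr.
by rewrite (eq_mxact _ _ uv) subrr scaler0.
Qed.

(** By Cramer's rule the output [w] satisfies [w = (numer_mx / det) z], and the
    determinant can be cancelled. *)
Lemma scalar_lti_relation d k (A : 'M[F]_d) (B : 'M[F]_(d, k)) (C : 'M[F]_(k, d))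
    (D : 'M[F]_k) (a b : {poly F}) x z w :
  a *: numer_mx A B C D = (b * \det (volterra_mx A))%:M ->
  state_eq A B x z -> (forall i, w i = mxact C^P x i + mxact D^P z i) ->
  forall i, a *: w i = b *: z i.
Proof.
move=> abN xE wE i; apply/eqP; rewrite -subr_eq0; apply/eqP.
apply: (@M_inj (\det (volterra_mx A))); first by rewrite det_volterra_mx0 oner_eq0.
have dw : \det (volterra_mx A) *: w i = mxact (numer_mx A B C D) z i.
  rewrite wE scalerDr /numer_mx mxactD !mxactZ; congr (_ + _).
  rewrite -mulmxA mxactM -!mxact_scale; apply: eq_mxact => j.
  exact: state_eq_cramer.
rewrite scalerBr scalerA mulrC -scalerA dw -mxactZ abN mxact_scalar.
by rewrite scalerA mulrC subrr.
Qed.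

(** Both sides are the state of the filter for the same input, as polynomials in
    the integrator commute with it. *)
Lemma filter_commutes d k (A : 'M[F]_d) (B : 'M[F]_(d, k)) (a b : {poly F}) x y z w :
  state_eq A B x z -> state_eq A B y w ->
  (forall i, a *: w i = b *: z i) -> forall i, a *: y i = b *: x i.
Proof.
have scaled c x' u : state_eq A B x' u ->
    state_eq A B (fun i => c *: x' i) (fun i => c *: u i).
  move=> xE i; rewrite !mxact_scale {1}xE -scalerDr !scalerA mulrC //.
move=> xE yE wz i.
exact: (state_eq_unique (scaled a _ _ yE) (scaled b _ _ xE) wz).
Qed.

End OperatorAlgebra.

(** * Transfer matrices in terms of the integrator *)

Section TransferMatrix.
Variable R : realType.
Local Notation ratfun := {fraction {poly R}}.
Local Notation tofrac := (@FracField.tofrac {poly R}).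

Definition cfrac (c : R) : ratfun := tofrac c%:P.

HB.instance Definition _ := GRing.RMorphism.copy cfrac (tofrac \o polyC).

(** Substitution of [1 / s] for the integrator. *)
Definition at_invX (q : {poly R}) : ratfun := (map_poly cfrac q).[(tofrac 'X)^-1].

Lemma at_invX_is_additive : additive at_invX.
Proof. by move=> p q; rewrite /at_invX rmorphB hornerD hornerN. Qed.

Lemma at_invX_is_multiplicative : multiplicative at_invX.
Proof.
by split=> [p q|]; rewrite /at_invX ?rmorphM ?hornerM ?rmorph1 ?hornerC.
Qed.

HB.instance Definition _ := GRing.isAdditive.Build _ _ at_invX at_invX_is_additive.
HB.instance Definition _ :=
  GRing.isMultiplicative.Build _ _ at_invX at_invX_is_multiplicative.

Lemma tofracX_neq0 : tofrac 'X != 0.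
Proof. by rewrite tofrac_eq0 polyX_eq0. Qed.

Lemma at_invXC c : at_invX c%:P = cfrac c.
Proof. by rewrite /at_invX map_polyC hornerC. Qed.

Lemma at_invXX : at_invX 'X = (tofrac 'X)^-1.
Proof. by rewrite /at_invX map_polyX hornerX. Qed.

(** The polynomial [X^m p(1/X)]: if [p] acts by differentiation on a function,
    then [revp m p] acts by integration on its derivative of order [m]. *)
Definition revp m (p : {poly R}) : {poly R} := \poly_(i < m.+1) p`_(m - i).

Lemma revp0 m p : (revp m p).[0] = p`_m.
Proof. by rewrite horner_coef0 coef_poly subn0. Qed.

Lemma at_invX_revp m (p : {poly R}) : (size p <= m.+1)%N -> at_invX (revp m p) = tofrac p / tofrac 'X ^+ m.
Proof.
move=> sp; apply: (mulIf (expf_neq0 m tofracX_neq0)).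
rewrite mulfVK ?expf_neq0 ?tofracX_neq0 // /revp poly_def rmorph_sum mulr_suml.
rewrite -{2}(coefK p) (_ : \poly_(i < size p) p`_i = \poly_(i < m.+1) p`_i); last first.
  by apply/polyP => i; rewrite !coef_poly; case: (ltnP i (size p)) => h;
     case: (ltnP i m.+1) => h'; rewrite // ?nth_default //; lia.
rewrite poly_def rmorph_sum (reindex_inj rev_ord_inj); apply: eq_bigr => i _ /=.
rewrite -!mul_polyC !rmorphM !rmorphXn /= at_invXC at_invXX subSS subKn -1?ltnS //.
rewrite -mulrA; congr (_ * _); rewrite exprVn.
apply: (mulfI (expf_neq0 (m - i) tofracX_neq0)).
rewrite mulVKf ?expf_neq0 ?tofracX_neq0 // -exprD subnK // -ltnS //.
Qed.

Lemma at_invX_inj q : at_invX q = 0 -> q = 0.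
Proof.
move=> q0; have [s0|s0] := posnP (size q); first by apply/eqP; rewrite -size_poly_eq0 s0.
pose m := (size q).-1.
have rr : revp m (revp m q) = q.
  apply/polyP => i; rewrite !coef_poly.
  have sq : size q = m.+1 by rewrite prednK.
  case: ltnP => im; last by rewrite nth_default // sq.
  by rewrite (_ : (m - i < m.+1)%N) ?subKn // ltnS leq_subr.
have /eqP := at_invX_revp (size_poly m.+1 (fun i => q`_(m - i))).
rewrite -/(revp m q) rr q0 eq_sym mulf_eq0 invr_eq0 expf_eq0 (negPf tofracX_neq0) andbF orbF.
by rewrite tofrac_eq0 => /eqP r0; rewrite -rr r0; apply/polyP => i; rewrite coef_poly !coef0; case: ifP.
Qed.

Lemma numer_mx_transfer k l (S : lti R k l) :
  map_mx at_invX (numer_mx (lti_A S) (lti_B S) (lti_C S) (lti_D S)) =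
  at_invX (\det (volterra_mx (lti_A S))) *: transfer S.
Proof.
have mapC m n (M : 'M[R]_(m, n)) : map_mx at_invX (map_mx polyC M) = map_mx cfrac M.
  by apply/matrixP => i j; rewrite !mxE at_invXC.
rewrite /numer_mx /transfer -!/cfrac -!/(map_mx cfrac _).
rewrite map_mxD 2!map_mxZ 2!map_mxM !mapC map_mx_adj /= at_invXX scalerDr; congr (_ + _).
set V := map_mx at_invX _; set W := (_%:M - _).
have VE : V = (tofrac 'X)^-1 *: W.
  rewrite /V /volterra_mx map_mxB map_mx1 map_mxZ mapC /W scalerBr /= at_invXX.
  by rewrite scale_scalar_mx mulVf ?tofracX_neq0.
have detV : at_invX (\det (volterra_mx (lti_A S))) = \det V by rewrite -det_map_mx.
have detV0 : \det V != 0.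
  rewrite -detV; apply: contraTneq isT => /at_invX_inj e.
  by have := det_volterra_mx0 (lti_A S); rewrite e horner0 => /eqP; rewrite eq_sym oner_eq0.
have Wunit : W \in unitmx.
  rewrite unitmxE unitfE; apply: contra_neq detV0 => W0.
  by rewrite VE detZ W0 mulr0.
have adjE : (tofrac 'X)^-1 *: \adj V = \det V *: invmx W.
  rewrite -[LHS](mulmxK Wunit) -scalemxAl scalemxAr -VE mul_adj_mx.
  by rewrite mul_scalar_mx.
by rewrite detV [LHS]scalemxAl [RHS]scalemxAl !scalemxAr adjE.
Qed.

End TransferMatrix.

(** * Uncertainties that are multiples of the identity *)

Section RepeatedUncertainty.
Variable R : realType.
Local Notation ratfun := {fraction {poly R}}.
Local Notation tofrac := (@FracField.tofrac {poly R}).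

Lemma ceval_iaxis (p : {poly R}) w : ceval p (Complex 0 w) = ievalp p w.
Proof. by []. Qed.

(** In lowest terms, a pole cannot be hidden by a common factor, so that the
    denominator shows where the function takes values. *)
Lemma ratfun_reduced (p q : {poly R}) : q != 0 ->
  exists b a : {poly R}, [/\ a \is monic, coprimep a b &
    tofrac p / tofrac q = tofrac b / tofrac a].
Proof.
move=> q0; pose d := gcdp p q.
have d0 : d != 0 by rewrite gcdp_eq0 (negPf q0) andbF.
have pE : p = p %/ d * d by rewrite divpK // dvdp_gcdl.
have qE : q = q %/ d * d by rewrite divpK // dvdp_gcdr.
set p' := p %/ d in pE; set q' := q %/ d in qE.
have q'0 : q' != 0 by apply: contra_neq q0 => e; rewrite qE e mul0r.
have lq' : lead_coef q' != 0 by rewrite lead_coef_eq0.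
pose c := (lead_coef q')^-1.
have c0 : c != 0 by rewrite invr_eq0.
exists (c *: p'), (c *: q'); split.
- by rewrite monicE lead_coefZ mulVf.
- rewrite coprimepZl // coprimepZr // coprimep_sym.
  rewrite /p' /q' coprimep_div_gcd //; by rewrite q0 orbT.
have tn (x : {poly R}) : x != 0 -> tofrac x != 0 by rewrite tofrac_eq0.
apply/eqP; rewrite eqr_div ?tn ?scaler_eq0 ?negb_or ?c0 //; apply/eqP.
by rewrite -!tofracM pE qE -!mul_polyC; congr (tofrac _); ring.
Qed.

Section ReducedFraction.
Variables (a b : {poly R}).
Hypotheses (am : a \is monic) (ab : coprimep a b).
Let g : ratfun := tofrac b / tofrac a.

Lemma ratfun_cross (p q : {poly R}) : q != 0 -> g = tofrac p / tofrac q ->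
  b * q = p * a.
Proof.
move=> q0 /eqP; rewrite /g eqr_div ?tofrac_eq0 ?(monic_neq0 am) // -!tofracM.
by rewrite tofrac_eq => /eqP.
Qed.

Lemma ratfun_value_reduced (z v : R[i]) : ratfun_value g (Some z) v ->
  ceval a z != 0 /\ v = ceval b z / ceval a z.
Proof.
move=> [p [q [gE [qz ->]]]].
have q0 : q != 0 by apply: contra_neq qz => ->; rewrite /ceval rmorph0 horner0.
have bq := ratfun_cross q0 gE.
have : a %| q by rewrite -(Gauss_dvdpr _ ab) bq dvdp_mull.
case/dvdpP => c qE.
have cM (x y : {poly R}) : ceval (x * y) z = ceval x z * ceval y z.
  by rewrite /ceval rmorphM hornerM.
have az : ceval a z != 0 by apply: contra_neq qz => e; rewrite qE cM e mulr0.
split=> //; apply/eqP; rewrite eqr_div // -!cM; apply/eqP; congr (ceval _ z).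
by rewrite -bq mulrC.
Qed.

Lemma ratfun_value_inf (v : R[i]) : ratfun_value g None v -> (size b <= size a)%N.
Proof.
move=> [p [q [gE [q0 [spq _]]]]]; have bq := ratfun_cross q0 gE.
have [->|b0] := eqVneq b 0; first by rewrite size_poly0.
have p0 : p != 0.
  apply: contra_neq b0 => p0; move: bq; rewrite p0 mul0r => /eqP.
  by rewrite mulf_eq0 (negPf q0) orbF => /eqP.
have := congr1 (fun x : {poly R} => size x) bq.
rewrite !size_mul ?(monic_neq0 am) //.
have hb : (0 < size b)%N by rewrite size_poly_gt0.
have hq : (0 < size q)%N by rewrite size_poly_gt0.
have hp : (0 < size p)%N by rewrite size_poly_gt0.
move: spq hb hq hp; move: (size a) (size b) (size p) (size q); lia.
Qed.

End ReducedFraction.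

Lemma quadratic_constraintE (P : 'M[R]_2) (v : R[i]) : P \is symmetricmx ->
  let e : 'cV[R[i]]_2 := col_mx (1%:M : 'M[R[i]]_1) (v%:M : 'M[R[i]]_1) in
  ((map_mx Num.conj e^T) *m complexmx P *m e) 0 0 =
  (P 0 0 + 2 * P 0 1 * complex.Re v + P 1 1 * sqnormc v)%:C.
Proof.
move=> hP e; have P10 : P 1 0 = P 0 1.
  have := is_hermitianmxP _ _ _ hP; rewrite expr0 scale1r => /matrixP/(_ 1 0).
  by rewrite !mxE.
have e0 : e 0 0 = 1.
  have -> : (0 : 'I_2) = lshift 1 (0 : 'I_1) by apply: val_inj.
  by rewrite [LHS](col_mxEu (1%:M : 'M[R[i]]_1) (v%:M : 'M[R[i]]_1) 0 0) mxE.
have e1 : e 1 0 = v.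
  have -> : (1 : 'I_2) = rshift 1 (0 : 'I_1) by apply: val_inj.
  by rewrite [LHS](col_mxEd (1%:M : 'M[R[i]]_1) (v%:M : 'M[R[i]]_1) 0 0) mxE.
clearbody e.
rewrite mxE big_ord_recl big_ord1 ![(_ *m complexmx P) 0 _]mxE !big_ord_recl !big_ord0.
rewrite (_ : lift ord0 ord0 = 1); last by apply: val_inj.
rewrite !mxE e0 e1 P10 rmorph1 !conj_conjc; case: v {e e0 e1} => x y.
apply/eqP; rewrite eq_complex /sqnormc /=; apply/andP; split; apply/eqP => /=; ring.
Qed.

(** On the imaginary axis the values of the transfer matrix are multiples of the
    identity; since a rational function is determined by its values there, the
    off-diagonal entries vanish and the diagonal ones coincide. *)
Lemma repeated_uncertainty nu k (P : 'I_nu -> 'M[R]_2) (S : lti R k.+1 k.+1) :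
  (forall i, P i \is symmetricmx) ->
  uncertainty (repeated_set k.+1 P) S ->
  exists a b : {poly R},
    [/\ a \is monic, (size b <= size a)%N,
        forall l : R[i], root (map_poly (real_complex R) a) l -> complex.Re l < 0,
        transfer S = (tofrac b / tofrac a)%:M &
        forall i w, 0 <= P i 0 0 * sqnormc (ievalp a w)
          + 2 * P i 0 1 * dotc (ievalp a w) (ievalp b w)
          + P i 1 1 * sqnormc (ievalp b w)].
Proof.
move=> hP [hH hV]; set T := transfer S in hH hV *; clearbody T.
have red i j : exists ba : {poly R} * {poly R}, [/\ ba.2 \is monic, coprimep ba.2 ba.1 &
    T i j = tofrac ba.1 / tofrac ba.2].
  have [W /(_ i j) [p [q [Tij [q0 _]]]]] := hH None I.
  by have [b [a [h1 h2 h3]]] := ratfun_reduced p q0; exists (b, a); rewrite Tij.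
have ax w : exists v : R[i], forall i j, ratfun_value (T i j) (Some (Complex 0 w)) (v *+ (i == j)).
  have [|W hW] := hH (Some (Complex 0 w)); first by rewrite /=.
  have [v [Wv _]] := hV (Some w) W hW.
  by exists v => i j; have := hW i j; rewrite Wv mxE.
have offdiag i j : i != j -> T i j = 0.
  move=> ij; have [[b a] /= [am ab Tij]] := red i j.
  suff b0 : b = 0 by rewrite Tij b0 rmorph0 mul0r.
  apply: ievalp_eq0 => w; have [v /(_ i j)] := ax w.
  rewrite (negPf ij) Tij => /(ratfun_value_reduced am ab)[az /eqP].
  by rewrite eq_sym mulf_eq0 invr_eq0 (negPf az) orbF => /eqP.
have [[b a] /= [am ab T00]] := red 0 0.
have diag i : T i i = tofrac b / tofrac a.
  have [[b' a'] /= [am' ab' Tii]] := red i i; rewrite Tii.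
  apply/eqP; rewrite eqr_div ?tofrac_eq0 ?(monic_neq0 am) ?(monic_neq0 am') // -!tofracM tofrac_eq.
  rewrite -subr_eq0; apply/eqP; apply: ievalp_eq0 => w.
  have [v hv] := ax w; have := hv 0 0; rewrite eqxx T00.
  move=> /(ratfun_value_reduced am ab)[az vE]; have := hv i i; rewrite eqxx Tii.
  move=> /(ratfun_value_reduced am' ab')[az' vE'].
  rewrite -scaleN1r ievalpD ievalpZ !ievalpM -!ceval_iaxis.
  have : ceval b' (Complex 0 w) / ceval a' (Complex 0 w)
         = ceval b (Complex 0 w) / ceval a (Complex 0 w) by rewrite -vE -vE'.
  move=> /eqP; rewrite eqr_div // => /eqP ->.
  by rewrite rmorphN rmorph1 mulN1r subrr.
exists a, b; split=> //.
- have [W /(_ 0 0)] := hH None I; rewrite T00; exact: ratfun_value_inf.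
- move=> l rl; rewrite ltNge; apply/negP => l0.
  have [W /(_ 0 0)] := hH (Some l) l0; rewrite T00.
  by move=> /(ratfun_value_reduced am ab)[/negP[]].
- apply/matrixP => i j; rewrite mxE; have [->|ij] := eqVneq i j; first by rewrite diag.
  by rewrite offdiag.
move=> i w.
have [|W hW] := hH (Some (Complex 0 w)); first by rewrite /=.
have [v [Wv hv]] := hV (Some w) W hW.
have h : 0 <= (P i 0 0 + 2 * P i 0 1 * complex.Re v + P i 1 1 * sqnormc v)%:C.
  by rewrite -(quadratic_constraintE v (hP i)); exact: hv i.
move: h.
have := hW 0 0; rewrite Wv mxE eqxx mulr1n T00.
move=> /(ratfun_value_reduced am ab)[az vE]; rewrite !ceval_iaxis in az vE.
rewrite -[0 : R[i]]/(0%:C) lecR.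
have bE : ievalp b w = v * ievalp a w by rewrite vE mulfVK.
rewrite bE; case: (ievalp a w) => x y; case: {vE Wv hW bE hv} v => s t h.
rewrite (_ : _ + _ = (P i 0 0 + 2 * P i 0 1 * s + P i 1 1 * (s ^+ 2 + t ^+ 2)) * (x ^+ 2 + y ^+ 2)).
  by apply: mulr_ge0; [exact: h | rewrite addr_ge0 ?sqr_ge0].
by rewrite /sqnormc /dotc /=; ring.
Qed.

(** The equation [transfer S = (b / a) I] in terms of the integrator and with the
    denominators cleared. *)
Lemma repeated_numer_mx k (S : lti R k.+1 k.+1) (a b : {poly R}) (m := (size a).-1) :
  a \is monic -> (size b <= size a)%N ->
  transfer S = (tofrac b / tofrac a)%:M ->
  revp m a *: numer_mx (lti_A S) (lti_B S) (lti_C S) (lti_D S) =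
  (revp m b * \det (volterra_mx (lti_A S)))%:M.
Proof.
move=> am sb TE.
have sa : size a = m.+1 by rewrite /m prednK // size_poly_gt0 monic_neq0.
have inj : injective (@at_invX R).
  by move=> x y /eqP; rewrite -subr_eq0 -rmorphB => /eqP /at_invX_inj /eqP;
     rewrite subr_eq0 => /eqP.
suff : map_mx (@at_invX R) (revp m a *: numer_mx (lti_A S) (lti_B S) (lti_C S) (lti_D S))
    = map_mx (@at_invX R) (revp m b * \det (volterra_mx (lti_A S)))%:M.
  by move=> /matrixP e; apply/matrixP => i j; apply: inj; have := e i j; rewrite !mxE.
rewrite map_mxZ numer_mx_transfer TE map_scalar_mx.
rewrite scalerA scale_scalar_mx rmorphM /= !at_invX_revp -?sa //.
have a0 : tofrac a != 0 by rewrite tofrac_eq0 monic_neq0.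
congr (_%:M).
have cancel (F : fieldType) (x y u v : F) : x != 0 -> x / u * v * (y / x) = y / u * v.
  by move=> x0; rewrite mulrC mulrA mulrA divfK //.
exact: cancel.
Qed.

End RepeatedUncertainty.

(** * Integration from zero *)

Section TriangleFubini.
Variable R : realType.
Local Notation mu := (@lebesgue_measure R).
Local Open Scope classical_set_scope.
Implicit Types f g c : R -> R.

Lemma integrable_bounded_mul (D : set R) c f (M : R) : measurable D ->
  measurable_fun D c -> (forall x, D x -> `|c x| <= M) ->
  mu.-integrable D (EFin \o f) -> mu.-integrable D (EFin \o (fun x => c x * f x)).
Proof.
move=> mD mc cM fi.
have -> : EFin \o (fun x => c x * f x) = ((EFin \o c) \* (EFin \o f))%E.
  by apply/funext => x /=; rewrite EFinM.
apply: integrableMr => //; exists M; split; first exact: num_real.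
by move=> N MN x Dx; apply: le_trans (cM x Dx) _; exact: ltW.
Qed.

Lemma Rintegral_swap_conv f g c (M : R) :
  mu.-integrable setT (EFin \o f) -> mu.-integrable setT (EFin \o g) ->
  measurable_fun setT c -> (forall x, `|c x| <= M) ->
  mu.-integrable setT (EFin \o (fun t => g t * \int[mu]_s (c (t - s) * f s))) /\
  \int[mu]_t (g t * \int[mu]_s (c (t - s) * f s)) =
  \int[mu]_s (f s * \int[mu]_t (c (t - s) * g t)).
Proof.
move=> fi gi mc cM.
have mf : measurable_fun setT f by have /integrableP[/measurable_EFinP] := fi.
have mg : measurable_fun setT g by have /integrableP[/measurable_EFinP] := gi.
pose F (x : R * R) : \bar R := (g x.1 * c (x.1 - x.2) * f x.2)%:E.
have mF : measurable_fun setT F.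
  apply/measurable_EFinP; apply: measurable_funM; last exact: measurableT_comp.
  apply: measurable_funM; first exact: measurableT_comp.
  by apply: measurableT_comp => //; exact: measurable_funB.
have mcl t : measurable_fun setT (fun s : R => c (t - s)).
  by apply: measurableT_comp => //; exact: measurable_funB.
have mcr s : measurable_fun setT (fun t : R => c (t - s)).
  by apply: measurableT_comp => //; exact: measurable_funB.
have cfi t : mu.-integrable setT (EFin \o (fun s => c (t - s) * f s)).
  exact: (@integrable_bounded_mul _ _ _ M).
have cgi s : mu.-integrable setT (EFin \o (fun t => c (t - s) * g t)).
  exact: (@integrable_bounded_mul _ _ _ M).
have M0 : 0 <= M by exact: le_trans (cM 0).
have iF : (mu \x mu)%E.-integrable setT F.
  apply/integrable12ltyP => //.
  have /integrableP[_ finf] := fi; have /integrableP[_ fing] := gi.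
  apply: (@le_lt_trans _ _ (\int[mu]_t (`|(g t)%:E| * (M%:E * \int[mu]_s `|(f s)%:E|)))%E).
    apply: ge0_le_integral => //.
    - by move=> t _; exact: integral_ge0.
    - apply: (@measurable_fun_fubini_tonelli_F _ _ _ _ _ mu (abse \o F)).
        exact: measurableT_comp.
      by move=> ?; exact: abse_ge0.
    - apply: emeasurable_funM; last exact: measurable_cst.
      by apply: measurableT_comp => //; exact/measurable_EFinP.
    move=> t _; rewrite muleA -ge0_integralZl //=; last 2 first.
    - by apply/measurable_EFinP; exact: measurableT_comp.
    - by rewrite lee_fin mulr_ge0.
    apply: ge0_le_integral => //=.
    - apply/measurable_EFinP; apply: measurableT_comp => //.
      apply: measurable_funM; last exact: mf.
      by apply: measurable_funM; [exact: measurable_cst | exact: mcl].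
    - apply: emeasurable_funM; first exact: measurable_cst.
      by apply/measurable_EFinP; exact: measurableT_comp.
    move=> s _; rewrite lee_fin !normrM; rewrite ler_wpM2r // ler_wpM2l //.
  rewrite ge0_integralZr //; last 2 first.
  - by apply: measurableT_comp => //; exact/measurable_EFinP.
  - by rewrite mule_ge0 ?lee_fin // integral_ge0.
  rewrite lte_mul_pinfty //; first exact: integral_ge0.
    by rewrite ge0_fin_numE //; exact: integral_ge0.
  rewrite lte_mul_pinfty // ?lee_fin //.
have := @integrable_fubini_F _ _ _ _ _ mu mu F iF; rewrite /fubini_F.
have := @Fubini _ _ _ _ _ mu mu F iF.
have -> : (fun x => \int[mu]_y F (x, y))%E =
    (EFin \o (fun t => g t * \int[mu]_s (c (t - s) * f s))).
  apply/funext => t; rewrite [RHS]/= -RintegralZl // /Rintegral fineK; last first.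
    apply: integrable_fin_num => //.
    have := integrableZl measurableT (g t) (cfi t).
    by apply: eq_integrable => // x _ /=; rewrite EFinM.
  by apply: eq_integral => s _; rewrite /F /= mulrA.
have -> : (fun y => \int[mu]_x F (x, y))%E =
    (fun s => (f s * \int[mu]_t (c (t - s) * g t))%:E).
  apply/funext => s; rewrite -RintegralZl // /Rintegral fineK; last first.
    apply: integrable_fin_num => //.
    have := integrableZl measurableT (f s) (cgi s).
    by apply: eq_integrable => // x _ /=; rewrite EFinM.
  by apply: eq_integral => t _; rewrite /F /=; congr EFin; ring.
by move=> /(congr1 fine) ? ?; split.
Qed.

(** Exchange of the order of integration over the triangle [0 <= s <= t <= T],
    for a kernel of convolution type. *)
Lemma Rintegral_swap_triangle f g c (T : R) :
  mu.-integrable `[0, T] (EFin \o f) -> mu.-integrable `[0, T] (EFin \o g) ->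
  {within `[0, T], continuous c} ->
  mu.-integrable `[0, T]
    (EFin \o (fun t => g t * \int[mu]_(s in `[0, t]) (c (t - s) * f s))) /\
  \int[mu]_(t in `[0, T]) (g t * \int[mu]_(s in `[0, t]) (c (t - s) * f s)) =
  \int[mu]_(s in `[0, T]) (f s * \int[mu]_(t in `[s, T]) (c (t - s) * g t)).
Proof.
move=> fi gi cc; pose D := `[0, T]%classic : set R.
have mD : measurable D by exact: measurable_itv.
have ext h : mu.-integrable D (EFin \o h) -> mu.-integrable setT (EFin \o (h \_ D)).
  by move=> hi; rewrite -restrict_EFin; apply/integrable_restrict; rewrite ?setTI.
have [M cM] : exists M, forall x, `|(c \_ D) x| <= M.
  have /compact_bounded[M [_ hM]] := continuous_compact cc (segment_compact (a:=0) (b:=T)).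
  exists (`|M| + 1) => x; rewrite patchE; case: ifPn => [xD|_]; last by rewrite normr0 addr_ge0.
  apply: (hM (`|M| + 1)); first by rewrite ltr_pwDr // ler_norm.
  by exists x => //; rewrite inE in xD.
have mc : measurable_fun setT (c \_ D).
  apply/(measurable_restrictT _ _).1 => //.
  exact: subspace_continuous_measurable_fun.
have [] := Rintegral_swap_conv (ext _ fi) (ext _ gi) mc cM.
have -> : (fun t => (g \_ D) t * \int[mu]_s ((c \_ D) (t - s) * (f \_ D) s)) =
    (fun t => g t * \int[mu]_(s in `[0, t]) (c (t - s) * f s)) \_ D.
  apply/funext => t; rewrite [RHS]patchE [X in X * _]patchE; case: ifPn => tD; last by rewrite mul0r.
  congr (_ * _); rewrite [RHS]Rintegral_mkcond; congr (Rintegral _ _); apply/funext => s.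
  rewrite !patchE /D !mem_setE !in_itv /=; move: tD; rewrite /D mem_setE in_itv /= => /andP[t0 tT].
  have [s0|s0] := leP 0 s; last by rewrite !mulr0.
  have [st|st] := leP s t; last by rewrite subr_ge0 leNgt st /= mul0r.
  by rewrite subr_ge0 st (le_trans st tT) /= lerBlDl (le_trans tT) ?lerDr.
have -> : (fun s => (f \_ D) s * \int[mu]_t ((c \_ D) (t - s) * (g \_ D) t)) =
    (fun s => f s * \int[mu]_(t in `[s, T]) (c (t - s) * g t)) \_ D.
  apply/funext => s; rewrite [RHS]patchE [X in X * _]patchE; case: ifPn => sD; last by rewrite mul0r.
  congr (_ * _); rewrite [RHS]Rintegral_mkcond; congr (Rintegral _ _); apply/funext => t.
  rewrite !patchE /D !mem_setE !in_itv /=; move: sD; rewrite /D mem_setE in_itv /= => /andP[s0 sT].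
  have [st|st] := leP s t; last by rewrite subr_ge0 leNgt st /= mul0r.
  have [tT|tT] := leP t T; last by rewrite andbF mulr0.
  by rewrite subr_ge0 st (le_trans s0 st) /= lerBlDl (le_trans tT) ?lerDr.
move=> iF eF; split; last by rewrite [LHS]Rintegral_mkcond [RHS]Rintegral_mkcond.
rewrite -restrict_EFin in iF.
by have := (integrable_restrict mu mD measurableT _).2 iF; rewrite setTI.
Qed.

End TriangleFubini.

Section Primitive.
Variable R : realType.
Local Notation mu := (@lebesgue_measure R).
Local Open Scope classical_set_scope.
Implicit Types f g : R -> R.

Definition primitive f (t : R) : R := \int[mu]_(s in `[0, t]) f s.
Local Notation J := primitive.

Definition loc_integrable f : Prop :=
  forall T : R, mu.-integrable `[0, T] (EFin \o f).

Lemma itv0_eq0 (T : R) : T < 0 -> `[0, T]%classic = set0 :> set R.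
Proof. by move=> T0; rewrite set_itv_ge // bnd_simp -ltNge. Qed.

Lemma loc_integrable_ge0 f :
  (forall T : R, 0 <= T -> mu.-integrable `[0, T] (EFin \o f)) -> loc_integrable f.
Proof.
move=> H T; have [|T0] := leP 0 T; first exact: H.
apply: (integrableS _ _ _ (H 0 (lexx 0))); try exact: measurable_itv.
by rewrite itv0_eq0.
Qed.

Lemma continuous_loc_integrable f :
  (forall T : R, 0 <= T -> {within `[0, T], continuous f}) -> loc_integrable f.
Proof.
move=> H; apply: loc_integrable_ge0 => T T0.
by apply: continuous_compact_integrable; [exact: segment_compact | exact: H].
Qed.

Lemma loc_integrable0 : loc_integrable (fun=> 0).
Proof. by move=> T; apply: integrable0. Qed.

Lemma loc_integrableD f g : loc_integrable f -> loc_integrable g ->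
  loc_integrable (fun t => f t + g t).
Proof. by move=> fi gi T; apply: (integrableD _ (fi T) (gi T)). Qed.

Lemma loc_integrableZ (k : R) f : loc_integrable f -> loc_integrable (fun t => k * f t).
Proof. by move=> fi T; apply: (integrableZl _ k (fi T)). Qed.

Lemma loc_integrable_sum (I : Type) (r : seq I) (F : I -> R -> R) :
  (forall i, loc_integrable (F i)) -> loc_integrable (fun t => \sum_(i <- r) F i t).
Proof.
move=> Fi; elim: r => [|i r IH].
  by under [X in loc_integrable X]eq_fun do rewrite big_nil; exact: loc_integrable0.
by under [X in loc_integrable X]eq_fun do rewrite big_cons; exact: loc_integrableD.
Qed.

Lemma eq_loc_integrable f g : (forall t, 0 <= t -> f t = g t) ->
  loc_integrable f -> loc_integrable g.
Proof.
move=> fg fi T; apply: eq_integrable (fi T) => // t; rewrite inE /= in_itv /= => /andP[t0 _].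
by rewrite fg.
Qed.

Lemma eq_primitive f g t : (forall s, 0 <= s <= t -> f s = g s) -> J f t = J g t.
Proof.
move=> fg; apply: eq_Rintegral => s; rewrite inE /= in_itv /= => st; exact: fg.
Qed.

Lemma primitive_neg f t : t < 0 -> J f t = 0.
Proof. by move=> t0; rewrite /J itv0_eq0 // Rintegral_set0. Qed.

Lemma primitive0 f : J f 0 = 0.
Proof. by rewrite /J set_itv1 Rintegral_set1. Qed.

Lemma primitiveD f g t : loc_integrable f -> loc_integrable g ->
  J (fun s => f s + g s) t = J f t + J g t.
Proof. by move=> fi gi; rewrite /J RintegralD. Qed.

Lemma primitiveZ k f t : loc_integrable f -> J (fun s => k * f s) t = k * J f t.
Proof. by move=> fi; rewrite /J RintegralZl. Qed.

Lemma primitive_cst0 t : J (fun=> 0) t = 0.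
Proof. by rewrite /J Rintegral_cst // mul0r. Qed.

Lemma primitive_sum (I : Type) (r : seq I) (F : I -> R -> R) t :
  (forall i, loc_integrable (F i)) ->
  J (fun s => \sum_(i <- r) F i s) t = \sum_(i <- r) J (F i) t.
Proof.
move=> Fi; elim: r => [|i r IH].
  rewrite big_nil -[RHS](primitive_cst0 t); apply: eq_primitive => s _.
  by rewrite big_nil.
rewrite big_cons -IH -primitiveD //; last exact: loc_integrable_sum.
by apply: eq_primitive => s _; rewrite big_cons.
Qed.

Lemma primitive_continuous f (T : R) : loc_integrable f -> 0 <= T ->
  {within `[0, T], continuous (J f)}.
Proof. by move=> fi T0; exact: parameterized_integral_continuous. Qed.

Lemma loc_integrable_primitive f : loc_integrable f -> loc_integrable (J f).
Proof.
by move=> fi; apply: continuous_loc_integrable => T; exact: primitive_continuous.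
Qed.

Lemma loc_integrable_mul_continuous f g : loc_integrable f ->
  (forall T, 0 <= T -> {within `[0, T], continuous g}) ->
  loc_integrable (fun t => g t * f t).
Proof.
move=> fi gc; apply: loc_integrable_ge0 => T T0.
have [M [_ hM]] := compact_bounded (continuous_compact (gc T T0) (segment_compact (a:=0) (b:=T))).
apply: (@integrable_bounded_mul _ _ _ _ (`|M| + 1)) => //.
  exact: subspace_continuous_measurable_fun (gc T T0).
by move=> x xT; apply: (hM (`|M| + 1)); [rewrite ltr_pwDr // ler_norm | exists x].
Qed.

Lemma le_primitive f g t : loc_integrable f -> loc_integrable g ->
  (forall s, 0 <= s <= t -> f s <= g s) -> J f t <= J g t.
Proof.
move=> fi gi fg; apply: le_Rintegral => // s; rewrite /= in_itv /=; exact: fg.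
Qed.

Lemma primitive_ge0 f t : (forall s, 0 <= s <= t -> 0 <= f s) -> 0 <= J f t.
Proof.
by move=> f0; apply: Rintegral_ge0 => s; rewrite /= in_itv /=; exact: f0.
Qed.

Lemma primitive_split f (s t : R) : loc_integrable f -> 0 <= s <= t ->
  J f t - J f s = \int[mu]_(x in `]s, t]) f x.
Proof.
by move=> fi /andP[s0 st]; rewrite /J Rintegral_itvB // ?bnd_simp.
Qed.

Lemma primitive_nondecreasing f (s t : R) : loc_integrable f ->
  (forall x, 0 <= x -> 0 <= f x) -> 0 <= s <= t -> J f s <= J f t.
Proof.
move=> fi f0 st; rewrite -subr_ge0 primitive_split //; apply: Rintegral_ge0 => x.
rewrite /= in_itv /= => /andP[sx _]; apply: f0; move: st => /andP[s0 _].
exact: le_trans s0 (ltW sx).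
Qed.

(** The product rule for primitives of integrable functions, by exchange of the
    order of integration over a triangle. *)
Lemma primitiveM f g t : loc_integrable f -> loc_integrable g -> 0 <= t ->
  J f t * J g t = J (fun s => f s * J g s + J f s * g s) t.
Proof.
move=> fi gi t0.
have c1 : {within `[0, t], continuous (fun=> 1 : R)}.
  by apply: continuous_subspaceT => x; exact: cvg_cst.
have fJg : loc_integrable (fun s => f s * J g s).
  have := loc_integrable_mul_continuous fi (fun T => primitive_continuous gi).
  by apply: eq_loc_integrable => s _; rewrite mulrC.
have gJf : loc_integrable (fun s => J f s * g s).
  exact: (loc_integrable_mul_continuous gi (fun T => primitive_continuous fi)).
rewrite primitiveD //.
have [_] := Rintegral_swap_triangle (fi t) (gi t) c1.
have -> : \int[mu]_(t0 in `[0, t]) (g t0 * \int[mu]_(s in `[0, t0]) (1 * f s))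
    = J (fun s => J f s * g s) t.
  apply: eq_primitive => s _; rewrite mulrC; congr (_ * _).
  by apply: eq_primitive => x _; rewrite mul1r.
move=> ->; rewrite -/(J _ t).
have -> : J (fun s => f s * \int[mu]_(x in `[s, t]) (1 * g x)) t =
    J (fun s => J g t * f s + (- 1) * (f s * J g s)) t.
  apply: eq_primitive => s st.
  have -> : \int[mu]_(x in `[s, t]) (1 * g x) = J g t - J g s.
    rewrite primitive_split // Rintegral_itv_obnd_cbnd.
      by apply: eq_Rintegral => x _; rewrite mul1r.
    apply: (integrableS _ _ _ (gi t)); try exact: measurable_itv.
    by apply: subset_itvr; rewrite bnd_simp; case/andP: st.
  by ring.
rewrite primitiveD ?primitiveZ //; try exact: loc_integrableZ.
by ring.
Qed.

End Primitive.

Section AlmostEverywhere.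
Variable R : realType.
Local Notation mu := (@lebesgue_measure R).
Local Notation J := primitive.
Local Open Scope classical_set_scope.
Implicit Types f g : R -> R.

Lemma ae_imp (P Q : R -> Prop) : (forall x, P x -> Q x) ->
  {ae mu, forall x, P x} -> {ae mu, forall x, Q x}.
Proof. by move=> PQ; apply: filterS => //; exact: (ae_filter_ringOfSetsType mu). Qed.

Lemma ae_imp2 (P P' Q : R -> Prop) : (forall x, P x -> P' x -> Q x) ->
  {ae mu, forall x, P x} -> {ae mu, forall x, P' x} -> {ae mu, forall x, Q x}.
Proof. by move=> PQ; apply: filterS2 => //; exact: (ae_filter_ringOfSetsType mu). Qed.

Lemma ae_neq (a : R) : {ae mu, forall x, x != a}.
Proof.
exists [set a]; split; first exact: measurable_set1.
  exact: lebesgue_measure_set1.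
by move=> x /= /negP; rewrite negbK => /eqP.
Qed.

Lemma measurable_fun_ge0 f :
  (forall T : R, 0 <= T -> measurable_fun (`[0, T] : set R) f) ->
  measurable_fun (`[0, +oo[ : set R) f.
Proof.
move=> mf; rewrite (_ : `[0, +oo[ = \bigcup_n `[0, n%:R]); last first.
  apply/seteqP; split=> x /=; rewrite in_itv /= andbT.
    by move=> x0; exists (Num.bound x) => //=; rewrite in_itv /= x0 /= ltW // archi_boundP.
  by move=> [n _]; rewrite /= in_itv /= => /andP[].
by apply/measurable_fun_bigcup => // n; exact: mf.
Qed.

Definition ae_eq_ge0 f g : Prop := {ae mu, forall t : R, 0 <= t -> f t = g t}.

Lemma primitive_ae f g t : loc_integrable f -> loc_integrable g ->
  ae_eq_ge0 f g -> J f t = J g t.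
Proof.
move=> fi gi fg; rewrite /J; congr fine; apply: ae_eq_integral => //.
- by have /integrableP[] := fi t.
- by have /integrableP[] := gi t.
apply: ae_imp fg => s fgs; rewrite /= in_itv /= => /andP[s0 _]; by rewrite fgs.
Qed.

(** By the Lebesgue differentiation theorem, for the difference extended by zero. *)
Lemma primitive_inj f g : loc_integrable f -> loc_integrable g ->
  (forall t, 0 <= t -> J f t = J g t) -> ae_eq_ge0 f g.
Proof.
move=> fi gi JE; pose d t := f t + (- 1) * g t.
have di : loc_integrable d by apply: loc_integrableD => //; exact: loc_integrableZ.
pose h := d \_ `[0, +oo[.
have hd t : 0 <= t -> h t = d t.
  by move=> t0; rewrite /h patchE mem_setE in_itv /= t0.
have hi y : mu.-integrable `[0, y] (EFin \o h).
  apply: eq_integrable (di y) => // x; rewrite inE /= in_itv /= => /andP[x0 _].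
  by rewrite hd.
have mh : measurable_fun setT h.
  apply/(measurable_restrictT _ _).1 => //; apply: measurable_fun_ge0 => T _.
  by have /integrableP[/measurable_EFinP] := di T.
have hloc : locally_integrable setT h.
  split => //; first exact: openT.
  move=> K _ cK; have [M [_ hM]] := compact_bounded cK.
  pose N := `|M| + 1.
  have KN : K `<=` `[- N, N].
    move=> x Kx; rewrite /= in_itv /= -ler_norml; apply: (hM N) => //.
    by rewrite /N ltr_pwDr // ler_norm.
  have hN : mu.-integrable `[- N, N] (EFin \o h).
    rewrite -restrict_EFin; apply/integrable_restrict => //.
    apply: (integrableS _ _ _ (di N)); try exact: measurable_itv.
      by apply: measurableI; exact: measurable_itv.
    by move=> x [] /=; rewrite !in_itv /= => /andP[_ ->]; rewrite andbT => ->.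
  have hK : mu.-integrable K (EFin \o h).
    by apply: (integrableS _ _ _ hN) => //; exact: compact_measurable.
  by have /integrableP[] := hK.
have := FTC1 hi hloc; apply: ae_imp2 (ae_neq 0) => x xn0 H x0.
have [|_] := H; first by rewrite /= lte_fin lt_def xn0.
have -> : (fun y => \int[mu]_(t in `[0, y]) h t) = cst 0.
  apply/funext => y /=; have [y0|y0] := leP 0 y; last exact: primitive_neg.
  rewrite -[LHS]/(J h y) (@eq_primitive _ _ d); last by move=> s /andP[s0 _]; rewrite hd.
  by rewrite primitiveD ?primitiveZ ?JE ?mulN1r ?subrr //; exact: loc_integrableZ.
rewrite derive1_cst hd // /d => /eqP; rewrite mulN1r eq_sym subr_eq0 => /eqP //.
Qed.

End AlmostEverywhere.

(** * The matrix exponential and linear filters *)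

Section MatrixExponential.
Variable R : realType.
Local Open Scope classical_set_scope.

Lemma cvg_lincomb (I : Type) (r : seq I) (c : I -> R) (u : I -> R^nat) :
  (forall i, cvgn (u i)) ->
  (fun n => \sum_(i <- r) c i * u i n) @ \oo --> \sum_(i <- r) c i * limn (u i).
Proof.
move=> cu; elim: r => [|i r IH].
  by under eq_fun do rewrite big_nil; rewrite big_nil; exact: cvg_cst.
under eq_fun do rewrite big_cons; rewrite big_cons; apply: cvgD => //.
by apply: cvgM; [exact: cvg_cst | exact: cu].
Qed.

Section Coefficients.
Variables (n : nat) (A : 'M[R]_n).

(** The Taylor coefficients in [t], without the powers of [t], of an entry of
    [A^d exp (t A)]: differentiation raises [d] by one. *)
Definition expmx_coeff (d : nat) (i j : 'I_n) (k : nat) : R := (A ^+ (k + d)) i j / k`!%:R.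

(** Comparison with the scalar exponential, for the sum of the moduli of the
    entries of [A]. *)
Lemma expmx_coeff_cvg d i j x : cvgn (pseries (expmx_coeff d i j) x).
Proof.
pose K : R := \sum_i \sum_j `|A i j|.
have K0 : 0 <= K by apply: sumr_ge0 => ? _; apply: sumr_ge0.
have bound k i' j' : `|(A ^+ k) i' j'| <= K ^+ k.
  elim: k i' j' => [|k IH] i' j'.
    by rewrite expr0 expr0 !mxE; case: (_ == _); rewrite ?normr1 ?normr0.
  rewrite exprS exprS [in leLHS]mxE; apply: le_trans (ler_norm_sum _ _ _) _.
  apply: (@le_trans _ _ (\sum_l `|A i' l| * K ^+ k)).
    by apply: ler_sum => l _; rewrite normrM ler_wpM2l.
  rewrite -mulr_suml ler_wpM2r ?exprn_ge0 // /K [leRHS](bigD1 i') //=.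
  by rewrite lerDl sumr_ge0 // => ? _; apply: sumr_ge0.
apply: normed_cvg.
apply: (@series_le_cvg _ _ (K ^+ d *: exp_coeff (K * `|x|))) => [k|k|k|].
- exact: normr_ge0.
- by rewrite mulr_ge0 ?exprn_ge0 // exp_coeff_ge0 // mulr_ge0.
- rewrite /= /expmx_coeff !normrM normfV (@ger0_norm _ k`!%:R) // normrX.
  rewrite [leRHS](_ : _ = K ^+ (k + d) / k`!%:R * `|x| ^+ k); last first.
    rewrite -[LHS]/(K ^+ d * ((K * `|x|) ^+ k / k`!%:R)) exprMn exprD; ring.
  by rewrite ler_wpM2r ?exprn_ge0 // ler_wpM2r ?invr_ge0.
apply: is_cvg_seriesZ; exact: is_cvg_series_exp_coeff.
Qed.

Lemma pseries_diffs_expmx_coeff d i j :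
  pseries_diffs (expmx_coeff d i j) = expmx_coeff d.+1 i j.
Proof.
apply/funext => k; rewrite /pseries_diffs /expmx_coeff factS natrM invfM addSnnS.
by rewrite mulrCA !mulrA mulfK // pnatr_eq0.
Qed.

Lemma expr_scalemx (t : R) k : (t *: A) ^+ k = t ^+ k *: A ^+ k.
Proof.
elim: k => [|k IH]; first by rewrite !expr0 scale1r.
rewrite !exprS IH -[LHS]/((t *: A) *m (t ^+ k *: A ^+ k)).
by rewrite -scalemxAl -scalemxAr scalerA.
Qed.

Lemma expmxE (t : R) i j : expmx (t *: A) i j = limn (pseries (expmx_coeff 0 i j) t).
Proof.
rewrite mxE; congr (lim (series _ @ \oo)); apply/funext => k.
by rewrite expr_scalemx mxE /expmx_coeff /= addn0; ring.
Qed.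

Lemma expmx0 i j : expmx (0 *: A) i j = (i == j)%:R.
Proof.
rewrite expmxE; apply: lim_near_cst => //; near=> m.
rewrite -[m]prednK; last by near: m; exists 1%N.
rewrite /pseries /series /= big_nat_recl // big1 ?addr0; last first.
  by move=> k _; rewrite expr0n mulr0.
by rewrite /expmx_coeff /= expr0 fact0 divr1 mulr1 mxE.
Unshelve. all: by end_near.
Qed.

Lemma is_derive_expmx_entry (t : R) i j :
  is_derive t (1 : R) (fun t => expmx (t *: A) i j) ((A *m expmx (t *: A)) i j).
Proof.
have -> : (fun t => expmx (t *: A) i j) = (fun t => limn (pseries (expmx_coeff 0 i j) t)).
  by apply/funext => s; exact: expmxE.
have -> : (A *m expmx (t *: A)) i j = limn (pseries (pseries_diffs (expmx_coeff 0 i j)) t).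
  rewrite pseries_diffs_expmx_coeff mxE.
  under eq_bigr => l _ do rewrite expmxE.
  apply/esym/cvg_lim => //.
  have -> : pseries (expmx_coeff 1 i j) t =
      (fun n => \sum_l A i l * pseries (expmx_coeff 0 l j) t n).
    apply/funext => N; rewrite /pseries /series /=.
    under [RHS]eq_bigr => l _ do rewrite mulr_sumr.
    rewrite exchange_big /=; apply: eq_bigr => k _.
    rewrite /expmx_coeff addn1 addn0 exprS mxE !mulr_suml; apply: eq_bigr => l _; ring.
  by apply: cvg_lincomb => l; exact: expmx_coeff_cvg.
apply: (@pseries_snd_diffs _ _ (`|t| + 1)); rewrite ?pseries_diffs_expmx_coeff;
  try exact: expmx_coeff_cvg.
by rewrite [ltRHS]ger0_norm ?addr_ge0 // ltrDl.
Qed.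

End Coefficients.
End MatrixExponential.

Section VariationOfConstants.
Variable R : realType.
Local Notation mu := (@lebesgue_measure R).
Local Notation J := primitive.
Local Open Scope classical_set_scope.

Definition convol (c f : R -> R) (t : R) : R := \int[mu]_(s in `[0, t]) (c (t - s) * f s).

Lemma continuous_lincomb (I : Type) (r : seq I) (c : I -> R) (u : I -> R -> R) :
  (forall i, continuous (u i)) -> continuous (fun x => \sum_(i <- r) c i * u i x).
Proof.
move=> cu; elim: r => [|i r IH].
  have -> : (fun x => \sum_(i <- [::]) c i * u i x) = cst 0.
    by apply/funext => x; rewrite big_nil.
  by move=> x; exact: cvg_cst.
have -> : (fun x => \sum_(j <- i :: r) c j * u j x) =
    (fun x => c i * u i x + \sum_(j <- r) c j * u j x).
  by apply/funext => x; rewrite big_cons.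
by move=> x; apply: cvgD; [apply: cvgM; [exact: cvg_cst | exact: cu] | exact: IH].
Qed.

Section Kernel.
Variables (c f : R -> R).
Hypotheses (cc : continuous c) (fi : loc_integrable f).

Lemma convol_integrand t : loc_integrable (fun s => c (t - s) * f s).
Proof.
apply: loc_integrable_mul_continuous => // T _; apply: continuous_subspaceT => x.
apply: continuous_comp; last exact: cc.
by apply: cvgB; [exact: cvg_cst | exact: cvg_id].
Qed.

Lemma loc_integrable1 : loc_integrable (fun=> 1 : R).
Proof.
by apply: continuous_loc_integrable => T _; apply: continuous_subspaceT => x; exact: cvg_cst.
Qed.

Lemma loc_integrable_convol : loc_integrable (convol c f).
Proof.
move=> T; have cT : {within `[0, T], continuous c} by exact: continuous_subspaceT.
have [] := Rintegral_swap_triangle (fi T) (loc_integrable1 T) cT => + _.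
by apply: eq_integrable => // t _ /=; rewrite mul1r.
Qed.

End Kernel.

(** A convolution with a continuously differentiable kernel is a primitive. *)
Lemma convol_primitive (c c' f : R -> R) t :
  (forall x, is_derive x (1 : R) c (c' x)) -> continuous c' -> loc_integrable f ->
  convol c f t = c 0 * J f t + J (convol c' f) t.
Proof.
move=> dc cc' fi; have [t0|t0] := leP 0 t; last first.
  by rewrite /convol itv0_eq0 // Rintegral_set0 !primitive_neg // mulr0 addr0.
have cT : {within `[0, t], continuous c'} by exact: continuous_subspaceT.
have [_] := Rintegral_swap_triangle (fi t) (@loc_integrable1 t) cT.
rewrite (_ : \int[mu]_(_ in _) _ = J (convol c' f) t); last first.
  by apply: eq_primitive => s _; rewrite mul1r.
move=> ->; rewrite -primitiveZ //.
have ccont : continuous c.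
  by move=> x; apply: differentiable_continuous; apply/derivable1_diffP; have [] := dc x.
have key s : 0 <= s <= t -> \int[mu]_(x in `[s, t]) (c' (x - s) * 1) = c (t - s) - c 0.
  move=> /andP[s0 st].
  under eq_Rintegral => x _ do rewrite mulr1.
  move: st; rewrite le_eqVlt => /predU1P[->|st].
    by rewrite set_itv1 Rintegral_set1 !subrr.
  have d x : is_derive x (1 : R) (fun x => c (x - s)) (c' (x - s)).
    have h := @is_derive1_comp _ c (fun y => y - s) x _ _ (dc (x - s))
      (is_deriveB (is_derive_id x 1) (is_derive_cst s x 1)).
    by move: h; rewrite subr0 mulr1; exact.
  rewrite /Rintegral (@continuous_FTC2 _ _ (fun x => c (x - s))) //=.
  - by rewrite subrr.
  - apply: continuous_subspaceT => x; apply: continuous_comp; last exact: cc'.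
    by apply: cvgB; [exact: cvg_id | exact: cvg_cst].
  - have dco x : {for x, continuous (fun x => c (x - s))}.
      by apply: differentiable_continuous; apply/derivable1_diffP; have [] := d x.
    split; first by move=> x _; have [] := d x.
      by apply: cvg_at_right_filter; exact: dco.
    by apply: cvg_at_left_filter; exact: dco.
  - by move=> x _; rewrite derive1E; have [_ ->] := d x.
have cfi := convol_integrand ccont fi t.
rewrite (_ : \int[mu]_(s in _) _ = J (fun s => c (t - s) * f s + (- c 0) * f s) t); last first.
  by apply: eq_primitive => s st; rewrite key //; ring.
rewrite primitiveD ?primitiveZ //; last exact: loc_integrableZ.
rewrite /convol /primitive; ring.
Qed.

Section State.
Variables (n : nat) (A : 'M[R]_n) (f : 'I_n -> R -> R).
Hypothesis fi : forall i, loc_integrable (f i).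

Definition conv_state (i : 'I_n) (t : R) : R :=
  \int[mu]_(s in `[0, t]) \sum_j expmx ((t - s) *: A) i j * f j s.

Let E i j t := expmx (t *: A) i j.

Let E_continuous i j : continuous (E i j).
Proof.
move=> x; apply: differentiable_continuous; apply/derivable1_diffP.
by have [] := is_derive_expmx_entry A x i j.
Qed.

Lemma conv_state_sum i t : conv_state i t = \sum_j convol (E i j) (f j) t.
Proof.
apply: (@primitive_sum _ _ _ (fun j s => E i j (t - s) * f j s)) => j.
by apply: convol_integrand.
Qed.

Lemma loc_integrable_conv_state i : loc_integrable (conv_state i).
Proof.
apply: (@eq_loc_integrable _ (fun t => \sum_j convol (E i j) (f j) t)).
  by move=> t _; rewrite conv_state_sum.
by apply: loc_integrable_sum => j; exact: loc_integrable_convol.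
Qed.

(** Variation of constants: [convol_primitive] for the kernel [exp (t A)], which
    is the identity at zero. *)
Lemma conv_stateE i t :
  conv_state i t = J (fun s => \sum_l A i l * conv_state l s + f i s) t.
Proof.
have dE j x : is_derive x (1 : R) (E i j) (\sum_l A i l * E l j x).
  have := is_derive_expmx_entry A x i j; rewrite mxE; exact.
have dE_continuous j : continuous (fun x => \sum_l A i l * E l j x).
  by apply: continuous_lincomb => l; exact: E_continuous.
have E0 j : E i j 0 = (i == j)%:R by exact: expmx0.
rewrite conv_state_sum.
under eq_bigr => j _ do rewrite (convol_primitive _ (dE j) (@dE_continuous j) (fi j)) E0.
rewrite big_split /= (bigD1 i) //= eqxx mul1r big1 ?addr0; last first.
  by move=> j ji; rewrite eq_sym (negPf ji) mul0r.
rewrite -primitive_sum; last by move=> j; exact: loc_integrable_convol.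
rewrite addrC -primitiveD //; last first.
  by apply: loc_integrable_sum => j; exact: loc_integrable_convol.
apply: eq_primitive => s _; congr (_ + _).
under [RHS]eq_bigr => l _ do rewrite conv_state_sum mulr_sumr.
rewrite exchange_big /=; apply: eq_bigr => j _.
have -> : convol (fun x => \sum_l A i l * E l j x) (f j) s =
    J (fun x => \sum_l A i l * (E l j (s - x) * f j x)) s.
  apply: eq_primitive => x _; rewrite mulr_suml; apply: eq_bigr => l _; ring.
rewrite primitive_sum; last first.
  by move=> l; apply: loc_integrableZ; exact: convol_integrand.
by apply: eq_bigr => l _; rewrite primitiveZ //; exact: convol_integrand.
Qed.

End State.
End VariationOfConstants.

(** * Signals as a module over the polynomials in the integrator *)

(** The polynomials in an endomorphism make a module over a commutative ring a
    module over the polynomial ring. *)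
Section PolynomialAction.
Variables (K : comNzRingType) (M : lmodType K) (J : {linear M -> M}).

Definition polyact (p : {poly K}) (v : M) : M := \sum_(i < size p) p`_i *: iter i J v.

Lemma polyactE n (p : {poly K}) v : (size p <= n)%N ->
  polyact p v = \sum_(i < n) p`_i *: iter i J v.
Proof.
move=> sp; rewrite /polyact (big_ord_widen _ (fun i => p`_i *: iter i J v) sp) big_mkcond.
apply: eq_bigr => i _; case: ltnP => // h; by rewrite nth_default // scale0r.
Qed.

Lemma polyactDl v : {morph polyact^~ v : p q / p + q}.
Proof.
move=> p q; pose n := maxn (size p) (size q).
rewrite !(@polyactE n) ?leq_maxl ?leq_maxr //; last exact: size_polyD.
by rewrite -big_split; apply: eq_bigr => i _; rewrite coefD scalerDl.
Qed.

Lemma iter_linear i : linear (iter i J).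
Proof. by elim: i => // i IH c u v; rewrite !iterS IH linearP. Qed.

Lemma polyactDr p : {morph polyact p : u v / u + v}.
Proof.
move=> u v; rewrite /polyact -big_split; apply: eq_bigr => i _ /=.
by rewrite -scalerDr -[u]scale1r iter_linear !scale1r.
Qed.

Lemma polyactC c v : polyact c%:P v = c *: v.
Proof. by rewrite (@polyactE 1) ?size_polyC_leq1 // big_ord1 coefC. Qed.

Lemma polyactX v : polyact 'X v = J v.
Proof.
by rewrite /polyact size_polyX !big_ord_recl big_ord0 !coefX /= scale0r add0r scale1r addr0.
Qed.

Lemma polyactMX p v : polyact (p * 'X) v = polyact p (J v).
Proof.
rewrite (@polyactE (size p).+1) ?(leq_trans (size_polyMleq _ _)) ?size_polyX ?addn2 //.
rewrite big_ord_recl coefMX /= scale0r add0r; apply: eq_bigr => i _.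
by rewrite coefMX -iterSr.
Qed.

Lemma polyactJ p v : polyact p (J v) = J (polyact p v).
Proof.
rewrite /polyact linear_sum; apply: eq_bigr => i _.
by rewrite linearZ -iterS iterSr.
Qed.

Lemma polyactA p q v : polyact p (polyact q v) = polyact (p * q) v.
Proof.
elim/poly_ind: p v => [|p c IH] v.
  by rewrite mul0r /polyact size_poly0 !big_ord0.
rewrite polyactDl polyactMX polyactC mulrDl polyactDl -polyactJ IH -mulrA.
rewrite [X in _ = polyact (p * X) v + _]mulrC mulrA polyactMX; congr (_ + _).
rewrite mul_polyC [RHS](@polyactE (size q)) ?size_scale_leq // /polyact scaler_sumr.
by apply: eq_bigr => i _; rewrite coefZ scalerA.
Qed.

(** The endomorphism occurs in the alias so that the module structure, which
    depends on it, can be inferred. *)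
Definition polymod : Type := let _ := J in M.
HB.instance Definition _ := GRing.Zmodule.copy polymod M.

Lemma polyact1 : left_id 1 polyact.
Proof. by move=> v; rewrite -[1]/(1%:P) polyactC scale1r. Qed.

HB.instance Definition _ := GRing.Zmodule_isLmodule.Build {poly K} polymod
  polyactA polyact1 polyactDr polyactDl.

End PolynomialAction.

Section SignalModule.
Variable R : realType.
Local Notation J := (@primitive R).

(** A locally integrable function is represented by its primitive: functions that
    agree almost everywhere are thereby identified, and integration from zero
    becomes an endomorphism. *)
Definition is_primitive : {pred (R -> R^o)} :=
  fun F => `[< exists2 f, loc_integrable f & F = J f >].

Lemma is_primitive_submod : submod_closed is_primitive.
Proof.
split=> [|c F G /asboolP[f fi ->] /asboolP[g gi ->]]; apply/asboolP.
  exists (fun=> 0); first exact: loc_integrable0.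
  by apply/funext => t; rewrite primitive_cst0.
exists (fun t => c * f t + g t).
  by apply: loc_integrableD => //; exact: loc_integrableZ.
by apply/funext => t; rewrite primitiveD ?primitiveZ //; exact: loc_integrableZ.
Qed.

HB.instance Definition _ := GRing.isSubmodClosed.Build R (R -> R^o) is_primitive is_primitive_submod.

Record signal := Signal { signal_fun :> R -> R^o; _ : signal_fun \in is_primitive }.
HB.instance Definition _ := [isSub for signal_fun].
HB.instance Definition _ := [Choice of signal by <:].
HB.instance Definition _ := [SubChoice_isSubLmodule of signal by <:].

Lemma signalE (x : signal) : exists2 f, loc_integrable f & signal_fun x = J f.
Proof. by have /asboolP := valP x. Qed.

Lemma is_primitiveJ f : loc_integrable f -> J f \in is_primitive.
Proof. by move=> fi; apply/asboolP; exists f. Qed.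

Lemma loc_integrable_signal (x : signal) : loc_integrable x.
Proof. by have [f fi ->] := signalE x; exact: loc_integrable_primitive. Qed.

Definition integrate (x : signal) : signal :=
  Signal (is_primitiveJ (loc_integrable_signal x)).

Lemma signal_addE (x y : signal) t : (x + y) t = x t + y t.
Proof. by []. Qed.

Lemma signal_scaleE c (x : signal) t : (c *: x) t = c * x t.
Proof. by []. Qed.

Lemma signal_sumE (I : Type) (r : seq I) (F : I -> signal) t :
  (\sum_(i <- r) F i) t = \sum_(i <- r) F i t.
Proof. by elim: r => [|i r IH]; rewrite ?big_nil // !big_cons signal_addE IH. Qed.

Lemma signalP (x y : signal) : (forall t, 0 <= t -> x t = y t) -> x = y.
Proof.
move=> xy; apply: val_inj; apply/funext => t /=.
have [|t0] := leP 0 t; first exact: xy.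
by have [f fi ->] := signalE x; have [g gi ->] := signalE y; rewrite !primitive_neg.
Qed.

Lemma integrate_linear : linear integrate.
Proof.
move=> c x y; apply: signalP => t t0 /=.
rewrite -[RHS]/(c * J x t + J y t) -primitiveZ ?primitiveD //;
  by [exact: loc_integrable_signal | apply: loc_integrableZ; exact: loc_integrable_signal].
Qed.

HB.instance Definition _ := GRing.isLinear.Build R signal signal _ integrate integrate_linear.
End SignalModule.

Section Injectivity.
Variable R : realType.
Local Notation mu := (@lebesgue_measure R).
Local Notation J := (@primitive R).
Local Open Scope classical_set_scope.

Lemma loc_integrable_norm (f : R -> R) : loc_integrable f -> loc_integrable (fun t => `|f t|).
Proof. by move=> fi T; have := integrable_abse (fi T). Qed.

Lemma norm_primitive_le (f : R -> R) t : loc_integrable f -> `|J f t| <= J (fun s => `|f s|) t.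
Proof. by move=> fi; exact: le_normr_Rintegral. Qed.

Lemma Rintegral_oc_cst (c a b : R) : a <= b -> \int[mu]_(x in `]a, b]) c = c * (b - a).
Proof.
move=> ab; transitivity (c * fine (@lebesgue_measure R `]a, b])); first exact: Rintegral_cst.
rewrite lebesgue_measure_itv /= lte_fin; move: ab; rewrite le_eqVlt => /predU1P[->|ab].
  by rewrite ltxx subrr.
by rewrite ab.
Qed.

Lemma primitive_cst (c t : R) : 0 <= t -> J (fun=> c) t = c * t.
Proof.
move=> t0; have ci : loc_integrable (fun=> c : R).
  by apply: eq_loc_integrable (loc_integrableZ c (@loc_integrable1 R)) => ? _; rewrite mulr1.
rewrite -[LHS]subr0 -[in LHS](primitive0 (fun=> c)) primitive_split ?lexx //.
by rewrite Rintegral_oc_cst // subr0.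
Qed.

(** Gronwall: on an interval so short that [K h < 1] the primitive cannot grow. *)
Lemma gronwall0 (phi : R -> R) (K T : R) : loc_integrable phi ->
  (forall t, 0 <= phi t) -> 0 <= T ->
  (forall t, 0 <= t <= T -> phi t <= K * J phi t) -> forall t, 0 <= t <= T -> phi t = 0.
Proof.
move=> pi p0 T0 pK.
pose K1 := `|K|; pose N := (Num.bound (K1 * T)).+1.
have K10 : 0 <= K1 by exact: normr_ge0.
have KTN : K1 * T < N%:R.
  apply: lt_trans (archi_boundP _) _; first exact: mulr_ge0.
  by rewrite ltr_nat.
have N0 : 0 < N%:R :> R by rewrite ltr0n.
pose h := T / N%:R.
have h0 : 0 <= h by rewrite divr_ge0.
have Kh : K1 * h < 1 by rewrite /h mulrA ltr_pdivrMr // mul1r.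
have J0 t : 0 <= J phi t by apply: primitive_ge0.
have step k : (k <= N)%N -> J phi (k%:R * h) = 0.
  elim: k => [|k IH] kN; first by rewrite mul0r primitive0.
  have khle : 0 <= k%:R * h <= k.+1%:R * h.
    by rewrite mulr_ge0 //= ler_wpM2r // ler_nat.
  have khT : k.+1%:R * h <= T.
    by rewrite /h mulrCA ler_piMr // ler_pdivrMr // mul1r ler_nat.
  have kh0 : 0 <= k.+1%:R * h by rewrite mulr_ge0.
  have := primitive_split pi khle; rewrite IH ?(ltnW kN) // subr0 => E.
  have : J phi (k.+1%:R * h) <= K1 * J phi (k.+1%:R * h) * h.
    rewrite {1}E; apply: (@le_trans _ _ (\int[mu]_(x in `]k%:R * h, k.+1%:R * h]) (K1 * J phi (k.+1%:R * h)))).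
      apply: le_Rintegral => //.
      - apply: (integrableS _ _ _ (pi (k.+1%:R * h))); try exact: measurable_itv.
        by apply: subset_itvr; rewrite bnd_simp; case/andP: khle.
      - have ci : loc_integrable (fun=> K1 * J phi (k.+1%:R * h)).
          by apply: eq_loc_integrable (loc_integrableZ _ (@loc_integrable1 R)) => ? _; rewrite mulr1.
        apply: (integrableS _ _ _ (ci (k.+1%:R * h))); try exact: measurable_itv.
        by apply: subset_itvr; rewrite bnd_simp; case/andP: khle.
      move=> x; rewrite /= in_itv /= => /andP[kx xk].
      have x0 : 0 <= x by apply: le_trans (ltW kx); rewrite mulr_ge0.
      apply: le_trans (pK x _) _; first by rewrite x0 (le_trans xk).
      apply: (@le_trans _ _ (K1 * J phi x)); first by rewrite ler_wpM2r // ler_norm.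
      by rewrite ler_wpM2l // primitive_nondecreasing // x0.
    have /andP[_ khle2] := khle; rewrite Rintegral_oc_cst // ler_wpM2l ?mulr_ge0 //.
    by rewrite -mulrBl -natrB // subSnn mul1r.
  move: (J0 (k.+1%:R * h)); nra.
have JT : J phi T = 0 by have := step N (leqnn N); rewrite /h mulrC divfK // gt_eqF.
move=> t /andP[t0 tT]; apply/eqP; rewrite eq_le p0 andbT.
apply: le_trans (pK t _) _; first by rewrite t0.
have -> : J phi t = 0.
  by apply/eqP; rewrite eq_le J0 andbT -JT primitive_nondecreasing // t0.
by rewrite mulr0.
Qed.

Definition op_signal : Type := polymod (@integrate R).
HB.instance Definition _ := GRing.Lmodule.on op_signal.

(** As [p] has a nonzero constant term, [p x = 0] expresses [x] by its iterated
    integrals, and Gronwall's lemma applies. *)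
Lemma op_signal_inj (p : {poly R}) (x : op_signal) : p.[0] != 0 -> p *: x = 0 -> x = 0.
Proof.
move=> p0 px; apply: signalP => t t0.
pose phi s := `|(x : signal R) s|.
have xi := @loc_integrable_signal R x.
have pi : loc_integrable phi by exact: loc_integrable_norm.
have J0 s : 0 <= J phi s by apply: primitive_ge0 => ? _; exact: normr_ge0.
have itb i s : 0 <= s <= t -> `|(iter i.+1 (@integrate R) x : signal R) s| <= t ^+ i * J phi s.
  elim: i s => [|i IH] s st.
    by rewrite expr0 mul1r /=; exact: norm_primitive_le.
  rewrite iterS; apply: le_trans (norm_primitive_le _ _) _; first exact: loc_integrable_signal.
  apply: (@le_trans _ _ (J (fun=> t ^+ i * J phi s) s)).
    apply: le_primitive.
    - exact/loc_integrable_norm/loc_integrable_signal.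
    - by apply: eq_loc_integrable (loc_integrableZ (t ^+ i * J phi s) (@loc_integrable1 R)) => ? _; rewrite mulr1.
    move=> r /andP[r0 rs]; case/andP: st => s0 st.
    apply: le_trans (IH r _) _; first by rewrite r0 (le_trans rs).
    by rewrite ler_wpM2l ?exprn_ge0 // primitive_nondecreasing // ?r0 // => ? _; exact: normr_ge0.
  case/andP: st => s0 st; rewrite primitive_cst // exprS.
  rewrite -mulrA mulrC; apply: ler_wpM2r => //.
  by rewrite mulr_ge0 ?exprn_ge0.
pose K := (\sum_(i < size p) `|p`_i.+1| * t ^+ i) / `|p.[0]|.
apply/eqP; rewrite -normr_eq0; apply/eqP.
apply: (@gronwall0 phi K t) => //; [by move=> s; exact: normr_ge0 | | by rewrite t0 lexx].
move=> s st; rewrite /K mulrAC ler_pdivlMr ?normr_gt0 // /phi -normrM mulrC.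
have := px; rewrite -[LHS]/(polyact _ p x) (@polyactE _ _ _ (size p).+1) // big_ord_recl /= => E.
have := congr1 (fun y : signal R => y s) E.
rewrite signal_addE signal_scaleE signal_sumE -horner_coef0 => {}E.
rewrite (_ : p.[0] * _ = - \sum_(i < size p)
    (p`_(bump 0 i) *: iter (bump 0 i) (@integrate R) x : signal R) s); last first.
  by apply/eqP; rewrite -addr_eq0; apply/eqP.
rewrite normrN mulr_suml; apply: le_trans (ler_norm_sum _ _ _) _.
apply: ler_sum => i _; rewrite signal_scaleE normrM -mulrA ler_wpM2l //.
exact: itb.
Qed.

End Injectivity.

(** * The quadratic constraint for scalar signals *)

Section SquareIntegrable.
Variable R : realType.
Local Notation mu := (@lebesgue_measure R).
Local Notation J := (@primitive R).
Local Open Scope classical_set_scope.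
Implicit Types f g : R -> R.
Local Notation D0 := (`[0%R, +oo[ : set R).

Definition sq_loc_integrable f : Prop :=
  measurable_fun D0 f /\ loc_integrable (fun t => f t ^+ 2).

Lemma measurable_itv0 f (T : R) : measurable_fun D0 f -> measurable_fun (`[0, T] : set R) f.
Proof.
move=> mf; apply: measurable_funS mf => // x /=; rewrite !in_itv /= andbT => /andP[]//.
Qed.

Lemma le_loc_integrable f g : measurable_fun D0 f ->
  (forall t, 0 <= t -> `|f t| <= g t) -> loc_integrable g -> loc_integrable f.
Proof.
move=> mf fg gi T; apply: le_integrable (gi T) => //.
  by apply/measurable_EFinP; exact: measurable_itv0.
move=> x; rewrite /= in_itv /= => /andP[x0 _]; rewrite lee_fin.
exact: le_trans (fg x x0) (ler_norm _).
Qed.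

Lemma sq_loc_integrableM f g : sq_loc_integrable f -> sq_loc_integrable g ->
  loc_integrable (fun t => f t * g t).
Proof.
move=> [mf fi] [mg gi]; apply: le_loc_integrable (loc_integrableD fi gi).
  exact: measurable_funM.
move=> t t0; rewrite normrM -[f t ^+ 2]real_normK ?num_real // -[g t ^+ 2]real_normK ?num_real //.
have := normr_ge0 (f t); have := normr_ge0 (g t); nra.
Qed.

Lemma continuous_sq_loc_integrable f :
  (forall T : R, 0 <= T -> {within `[0, T], continuous f}) -> sq_loc_integrable f.
Proof.
move=> fc; split; last first.
  have := loc_integrable_mul_continuous (continuous_loc_integrable fc) fc.
  by apply: eq_loc_integrable => t _; rewrite expr2.
apply: measurable_fun_ge0 => T T0; apply: subspace_continuous_measurable_fun (fc T T0) => //.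
Qed.

Lemma sq_loc_integrable_loc f : sq_loc_integrable f -> loc_integrable f.
Proof.
move=> fs; have c1 : sq_loc_integrable (fun=> 1).
  by apply: continuous_sq_loc_integrable => T _; apply: continuous_subspaceT => x; exact: cvg_cst.
by have := sq_loc_integrableM fs c1; apply: eq_loc_integrable => t _; rewrite mulr1.
Qed.

Lemma sq_loc_integrableD f g : sq_loc_integrable f -> sq_loc_integrable g ->
  sq_loc_integrable (fun t => f t + g t).
Proof.
move=> fs gs; split; first by apply: measurable_funD; [case: fs | case: gs].
have := loc_integrableD (loc_integrableD fs.2 (loc_integrableZ 2 (sq_loc_integrableM fs gs))) gs.2.
apply: eq_loc_integrable => t _; ring.
Qed.

Lemma sq_loc_integrableZ k f : sq_loc_integrable f -> sq_loc_integrable (fun t => k * f t).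
Proof.
move=> [mf fi]; split; first by apply: measurable_funM => //; exact: measurable_cst.
have := loc_integrableZ (k ^+ 2) fi; apply: eq_loc_integrable => t _; ring.
Qed.

Lemma sq_loc_integrable_sum (I : Type) (r : seq I) (c : I -> R) (F : I -> R -> R) :
  (forall i, sq_loc_integrable (F i)) -> sq_loc_integrable (fun t => \sum_(i <- r) c i * F i t).
Proof.
move=> Fi; elim: r => [|i r IH].
  have -> : (fun t => \sum_(i <- [::]) c i * F i t) = (fun=> 0).
    by apply/funext => t; rewrite big_nil.
  by apply: continuous_sq_loc_integrable => T _; apply: continuous_subspaceT => x; exact: cvg_cst.
have -> : (fun t => \sum_(j <- i :: r) c j * F j t) =
    (fun t => c i * F i t + \sum_(j <- r) c j * F j t).
  by apply/funext => t; rewrite big_cons.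
by apply: sq_loc_integrableD => //; exact: sq_loc_integrableZ.
Qed.

Lemma primitive_sq_loc_integrable f : loc_integrable f -> sq_loc_integrable (J f).
Proof.
by move=> fi; apply: continuous_sq_loc_integrable => T; exact: primitive_continuous.
Qed.

End SquareIntegrable.

Section ScalarIQC.
Variable R : realType.
Local Notation J := (@primitive R).

Definition to_signal (f : R -> R) (fi : loc_integrable f) : op_signal R :=
  Signal (is_primitiveJ fi).

Variables (a b : {poly R}) (p11 p12 p22 : R).
Let m := (size a).-1.
Hypotheses (am : a \is monic) (sb : (size b <= size a)%N)
  (ha : forall l : R[i], root (map_poly (real_complex R) a) l -> complex.Re l < 0)
  (p22_le0 : p22 <= 0)
  (hN : forall w, 0 <= p11 * sqnormc (ievalp a w)
    + 2 * p12 * dotc (ievalp a w) (ievalp b w) + p22 * sqnormc (ievalp b w)).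

(** Along the controllable realization of [b / a], started at rest with input [g],
    the storage function of [scalar_kyp] is nonnegative at [T] and grows at
    most by the integral. *)
Lemma scalar_iqc (g h : R -> R) (gs : sq_loc_integrable g) (hs : sq_loc_integrable h) T :
  0 <= T ->
  revp m a *: to_signal (sq_loc_integrable_loc hs) =
    revp m b *: to_signal (sq_loc_integrable_loc gs) ->
  0 <= J (fun t => p11 * g t ^+ 2 + 2 * p12 * (g t * h t) + p22 * h t ^+ 2) T.
Proof.
move=> T0 ahbg.
have [Q [Qpos Qdiss]] := scalar_kyp am sb ha p22_le0 hN.
rewrite -/m in Qpos Qdiss.
have sa : size a = m.+1 by rewrite /m prednK // size_poly_gt0 monic_neq0.
have am1 : a`_m = 1 by move/monicP: am; rewrite lead_coefE.
have gi := sq_loc_integrable_loc gs.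
(* The components [y i] of the state are the derivatives of the solution of
   [a(d/dt) y = g] that starts at rest, and [e] is the one of order [m]. *)
pose f (i : 'I_m) : R -> R := if i.+1 == m then g else fun=> 0.
have fi i : loc_integrable (f i).
  by rewrite /f; case: ifP => // _; exact: loc_integrable0.
pose y := conv_state (companionmx a : 'M[R]_m) f.
have yi i : loc_integrable (y i) by apply: loc_integrable_conv_state.
have ys i : sq_loc_integrable (y i).
  have -> : y i = J (fun s => \sum_l (companionmx a : 'M[R]_m) i l * y l s + f i s).
    by apply/funext => t; exact: conv_stateE.
  apply: primitive_sq_loc_integrable; apply: loc_integrableD => //.
  by apply: loc_integrable_sum => l; exact: loc_integrableZ.
pose e t := g t + \sum_(l < m) (- a`_l) * y l t.
have es : sq_loc_integrable e.
  by apply: sq_loc_integrableD => //; exact: sq_loc_integrable_sum.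
pose Y (i : nat) : R -> R := if insub i is Some i' then y i' else e.
pose Yt t (i : nat) := Y i t.
have Ys i : sq_loc_integrable (Y i) by rewrite /Y; case: insub.
have Yi i : loc_integrable (Y i) by exact: sq_loc_integrable_loc.
have Ym : Y m = e by rewrite /Y insubF // ltnn.
have Yy (i : 'I_m) : Y i = y i by rewrite /Y valK.
have YJ (i : 'I_m) : Y i = J (Y i.+1).
  rewrite Yy; apply/funext => t; rewrite /y (conv_stateE _ fi) -/y; refine (@eq_primitive R _ _ t _) => s _.
  have [im|im] := eqVneq i.+1 m.
    rewrite im Ym /e /f im eqxx addrC; congr (_ + _); apply: eq_bigr => l _.
    by rewrite mxE -/m ifT //; apply/eqP; lia.
  have im' : (i.+1 < m)%N by have := ltn_ord i; lia.
  rewrite /f (negPf im) addr0 -[i.+1]/(nat_of_ord (Ordinal im')) Yy.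
  rewrite (bigD1 (Ordinal im')) //= mxE -/m.
  have -> : (i == m.-1 :> nat) = false by apply/eqP; lia.
  rewrite eqxx mul1r big1 ?addr0 // => l li; rewrite mxE -/m.
  have -> : (i == m.-1 :> nat) = false by apply/eqP; lia.
  by rewrite eq_sym -val_eqE /= in li; rewrite (negPf li) mul0r.
have ga t : polyval a m (Yt t) = g t.
  rewrite /polyval /Yt big_ord_recr /= Ym am1 mul1r /e.
  rewrite addrCA -big_split big1 ?addr0 //= => l _.
  by rewrite Yy mulNr subrr.
pose h' t := polyval b m (Yt t).
have h's : sq_loc_integrable h'.
  rewrite /h' /polyval.
  exact: (@sq_loc_integrable_sum _ _ (index_enum 'I_m.+1) (fun i => b`_i) (fun i => Y i)).
have h'i := sq_loc_integrable_loc h's.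
pose E := to_signal (sq_loc_integrable_loc es).
have JY k (i : nat) : (i + k = m)%N -> J (Y i) = (iter k (@integrate R) E : signal R).
  elim: k i => [|k IH] i ik; first by rewrite addn0 in ik; rewrite ik Ym.
  have im : (i < m)%N by lia.
  have := YJ (Ordinal im); rewrite /= => ->.
  by rewrite (IH i.+1) //; lia.
(* Each [Y i] is the iterated integral of [e] of order [m - i], so that
   differentiation of [Y 0] by [p] is [revp m p] in the integrator, on [e]. *)
have revE (p : {poly R}) t : (size p <= m.+1)%N ->
    (revp m p *: E : signal R) t = J (fun s => polyval p m (Yt s)) t.
  move=> sp; rewrite -[LHS]/((polyact (@integrate R) (revp m p) E : signal R) t).
  rewrite (@polyactE _ _ _ m.+1) ?size_poly // signal_sumE /polyval.
  rewrite primitive_sum; last by move=> i; apply: loc_integrableZ; exact: Yi.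
  rewrite [RHS](reindex_inj rev_ord_inj); apply: eq_bigr => i _.
  rewrite signal_scaleE coef_poly ltn_ord primitiveZ; last exact: Yi.
  rewrite [in RHS]/= subSS; congr (_ * _).
  by rewrite (@JY i (m - i)%N) // subnK // -ltnS.
have aE : revp m a *: E = to_signal gi.
  apply: signalP => t t0; rewrite revE ?sa // -[RHS]/(J g t).
  by apply: eq_primitive => s _; exact: ga.
have bE : revp m b *: E = to_signal h'i.
  by apply: signalP => t t0; rewrite revE -?sa.
have hh' : to_signal (sq_loc_integrable_loc hs) = to_signal h'i.
  apply/eqP; rewrite -subr_eq0; apply/eqP.
  apply: (@op_signal_inj _ (revp m a)); first by rewrite revp0 am1 oner_eq0.
  rewrite scalerBr ahbg -bE; apply/eqP; rewrite subr_eq0; apply/eqP.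
  rewrite (_ : to_signal _ = to_signal gi); last exact: signalP.
  by rewrite -aE !scalerA mulrC.
have hae : ae_eq_ge0 h h'.
  apply: primitive_inj => [||t t0]; [exact: sq_loc_integrable_loc | exact: h'i |].
  exact: (congr1 (fun x : signal R => x t) hh').
have si (u : R -> R) : sq_loc_integrable u ->
    loc_integrable (fun t => p11 * g t ^+ 2 + 2 * p12 * (g t * u t) + p22 * u t ^+ 2).
  move=> us; apply: loc_integrableD; last exact: loc_integrableZ us.2.
  apply: loc_integrableD; first exact: loc_integrableZ gs.2.
  by apply: loc_integrableZ; exact: sq_loc_integrableM.
rewrite (@primitive_ae _ _ (fun t => p11 * g t ^+ 2 + 2 * p12 * (g t * h' t) + p22 * h' t ^+ 2));
  try exact: si; last first.
  by apply: ae_imp hae => t ht t0; rewrite ht.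
pose dQ t := \sum_(i < m) \sum_(j < m) Q i j * (Y i.+1 t * Y j t + Y i t * Y j.+1 t).
have Yii i j : loc_integrable (fun t => Y i.+1 t * Y j t + Y i t * Y j.+1 t).
  by apply: loc_integrableD; exact: sq_loc_integrableM.
have dQi : loc_integrable dQ.
  by do 2 (apply: loc_integrable_sum => ?); exact: loc_integrableZ.
apply: (@le_trans _ _ (J dQ T)); last first.
  apply: le_primitive => //; first exact: si.
  by move=> s _; have := Qdiss (Yt s); rewrite ga.
rewrite /dQ primitive_sum; last first.
  by move=> i; apply: loc_integrable_sum => ?; exact: loc_integrableZ.
rewrite (_ : \sum_(i < m) _ = \sum_(i < m) \sum_(j < m) Q i j * (Y i T * Y j T)); first exact: (Qpos (Yt T)).
apply: eq_bigr => i _; rewrite primitive_sum; last by move=> j; exact: loc_integrableZ.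
apply: eq_bigr => j _; rewrite primitiveZ //; congr (_ * _).
by rewrite [in RHS]YJ [in RHS](YJ j) primitiveM // -!YJ.
Qed.

End ScalarIQC.

(** * Quadratic forms *)

Section PositiveDefinite.
Variable R : realType.

Lemma symmetricmxP n (M : 'M[R]_n) : reflect (M^T = M) (M \is symmetricmx).
Proof.
apply: (iffP (is_hermitianmxP _ _ _)); rewrite expr0 scale1r map_mx_id //.
Qed.

Definition bilin m n (M : 'M[R]_(m, n)) (u : 'cV[R]_m) (v : 'cV[R]_n) : R :=
  (u^T *m M *m v) 0 0.

Lemma bilinDl m n (M : 'M[R]_(m, n)) u u' v : bilin M (u + u') v = bilin M u v + bilin M u' v.
Proof. by rewrite /bilin linearD /= !mulmxDl mxE. Qed.

Lemma bilinDr m n (M : 'M[R]_(m, n)) u v v' : bilin M u (v + v') = bilin M u v + bilin M u v'.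
Proof. by rewrite /bilin mulmxDr mxE. Qed.

Lemma bilinD m n (M N : 'M[R]_(m, n)) u v : bilin (M + N) u v = bilin M u v + bilin N u v.
Proof. by rewrite /bilin mulmxDr mulmxDl mxE. Qed.

Lemma bilinZ m n c (M : 'M[R]_(m, n)) u v : bilin (c *: M) u v = c * bilin M u v.
Proof. by rewrite /bilin -scalemxAr -scalemxAl mxE. Qed.

Lemma bilin0 m n u v : bilin (0 : 'M[R]_(m, n)) u v = 0.
Proof. by rewrite /bilin mulmx0 mul0mx mxE. Qed.

Lemma bilin0l m n (M : 'M[R]_(m, n)) v : bilin M 0 v = 0.
Proof. by rewrite /bilin trmx0 !mul0mx mxE. Qed.

Lemma bilin0r m n (M : 'M[R]_(m, n)) u : bilin M u 0 = 0.
Proof. by rewrite /bilin mulmx0 mxE. Qed.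

Lemma bilinZl m n c (M : 'M[R]_(m, n)) u v : bilin M (c *: u) v = c * bilin M u v.
Proof. by rewrite /bilin linearZ /= -!scalemxAl mxE. Qed.

Lemma bilinZr m n c (M : 'M[R]_(m, n)) u v : bilin M u (c *: v) = c * bilin M u v.
Proof. by rewrite /bilin -scalemxAr mxE. Qed.

Lemma bilin_sum m n (I : Type) (r : seq I) (M : I -> 'M[R]_(m, n)) u v :
  bilin (\sum_(i <- r) M i) u v = \sum_(i <- r) bilin (M i) u v.
Proof. by elim: r => [|i r IH]; rewrite ?big_nil ?bilin0 // !big_cons bilinD IH. Qed.

Lemma bilin_congr m n p q (M : 'M[R]_(m, n)) (A : 'M[R]_(m, p)) (B : 'M[R]_(n, q)) u v :
  bilin (A^T *m M *m B) u v = bilin M (A *m u) (B *m v).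
Proof. by rewrite /bilin trmx_mul !mulmxA. Qed.

Lemma bilinE m n (M : 'M[R]_(m, n)) u v :
  bilin M u v = \sum_i \sum_j M i j * (u i 0 * v j 0).
Proof.
rewrite /bilin mxE exchange_big; apply: eq_bigr => j _.
by rewrite mxE mulr_suml; apply: eq_bigr => i _; rewrite mxE; ring.
Qed.

Lemma bilinC m n (M : 'M[R]_(m, n)) u v : bilin M u v = bilin M^T v u.
Proof.
rewrite !bilinE exchange_big; apply: eq_bigr => i _; apply: eq_bigr => j _.
by rewrite mxE; ring.
Qed.

Lemma bilin_block m1 m2 n1 n2 (M11 : 'M[R]_(m1, n1)) (M12 : 'M[R]_(m1, n2))
    (M21 : 'M[R]_(m2, n1)) (M22 : 'M[R]_(m2, n2)) u1 u2 v1 v2 :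
  bilin (block_mx M11 M12 M21 M22) (col_mx u1 u2) (col_mx v1 v2) =
  bilin M11 u1 v1 + bilin M12 u1 v2 + bilin M21 u2 v1 + bilin M22 u2 v2.
Proof.
rewrite /bilin tr_col_mx mul_row_block mul_row_col !mulmxDl !mxE; ring.
Qed.

Lemma bilin1 n (u v : 'cV[R]_n) : bilin 1%:M u v = \sum_i u i 0 * v i 0.
Proof. by rewrite /bilin mulmx1 mxE; apply: eq_bigr => i _; rewrite mxE. Qed.

(** Induction on the dimension: the Schur complement of the first diagonal entry
    is again positive definite. *)
Lemma cholesky n (L : 'M[R]_n) : posdef L -> exists G : 'M[R]_n, L = G^T *m G.
Proof.
elim: n L => [|n IH] L [/symmetricmxP hL pL].
  by exists 0; apply/matrixP => -[].
change (n.+1) with (1 + n)%N in L, hL, pL |- *.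
pose al := ulsubmx L : 'M[R]_1; pose r := ursubmx L; pose L2 := drsubmx L.
have := hL; rewrite -{1 2}[L]submxK tr_block_mx -/al -/r -/L2 => /eq_block_mx[_ _ dlE hL2].
have LE : L = block_mx al r r^T L2 by rewrite -[LHS]submxK dlE.
clearbody al r L2.
have al0 : 0 < al 0 0.
  have := pL (col_mx 1%:M 0); rewrite -/(bilin _ _ _) LE bilin_block !bilin0l !bilin0r !addr0.
  rewrite {1}/bilin trmx1 mul1mx mulmx1; apply.
  apply/eqP => /colP /(_ (lshift n 0)); rewrite col_mxEu !mxE eqxx => /eqP.
  by rewrite oner_eq0.
pose s := Num.sqrt (al 0 0).
have s2 : s * s = al 0 0 by rewrite -expr2 sqr_sqrtr // ltW.
have s0 : s != 0 by rewrite sqrtr_eq0 -ltNge.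
have [G2 G2E] : exists G2 : 'M[R]_n, L2 - (al 0 0)^-1 *: (r^T *m r) = G2^T *m G2.
  apply: IH; split.
    by apply/symmetricmxP; rewrite linearB linearZ /= trmx_mul trmxK hL2.
  move=> x x0; pose c := - (al 0 0)^-1 *: (r *m x) : 'M[R]_1.
  have := pL (col_mx c x); rewrite -/(bilin _ _ _) LE bilin_block => pos.
  have {}pos : 0 < bilin al c c + bilin r c x + bilin r^T x c + bilin L2 x x.
    apply: pos; apply: contra_neq x0 => /colP e; apply/colP => i.
    by have := e (rshift 1 i); rewrite col_mxEd !mxE.
  have rc : bilin r c x = c 0 0 * (r *m x) 0 0.
    by rewrite /bilin -mulmxA mxE big_ord1 mxE.
  have alc : bilin al c c = al 0 0 * (c 0 0 * c 0 0) by rewrite bilinE !big_ord1.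
  have cE : c 0 0 = - (al 0 0)^-1 * (r *m x) 0 0 by rewrite mxE.
  have rrE : bilin (r^T *m r) x x = (r *m x) 0 0 * (r *m x) 0 0.
    by rewrite -[r^T]mulmx1 bilin_congr bilin1 big_ord1.
  have -> : (x^T *m (L2 - (al 0 0)^-1 *: (r^T *m r)) *m x) 0 0 =
      bilin L2 x x - (al 0 0)^-1 * ((r *m x) 0 0 * (r *m x) 0 0).
    by rewrite -/(bilin _ _ _) bilinD -scaleNr bilinZ rrE mulNr.
  move: pos; rewrite (bilinC r^T) trmxK rc alc cE.
  rewrite (_ : _ + bilin L2 x x = bilin L2 x x - (al 0 0)^-1 * ((r *m x) 0 0 * (r *m x) 0 0)) //.
  by field; rewrite gt_eqF.
exists (block_mx s%:M (s^-1 *: r) 0 G2).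
rewrite tr_block_mx mulmx_block !trmx0 !mulmx0 !mul0mx !addr0 LE.
have rT : (s^-1 *: r)^T = s^-1 *: r^T by rewrite linearZ.
rewrite tr_scalar_mx rT; congr block_mx.
- by rewrite mul_scalar_mx scale_scalar_mx s2 -mx11_scalar.
- by rewrite mul_scalar_mx scalerA ?mulVf ?mulfV // scale1r.
- by rewrite mul_mx_scalar scalerA ?mulVf ?mulfV // scale1r.
- by rewrite -scalemxAl -scalemxAr scalerA -invfM s2 -G2E addrC subrK.
Qed.

Lemma sqr_sum_le n (F : 'I_n -> R) : (\sum_i F i) ^+ 2 <= n%:R * \sum_i F i ^+ 2.
Proof.
elim: n F => [|n IH] F; first by rewrite !big_ord0 expr0n mul0r.
rewrite !big_ord_recl; set a := F ord0; set S := \sum_i _; set Q := \sum_i _.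
have SQ : S ^+ 2 <= n%:R * Q := IH _.
have cross : 2 * (a * S) <= n%:R * a ^+ 2 + Q.
  rewrite /S /Q !mulr_sumr.
  have -> : n%:R * a ^+ 2 = \sum_(i < n) a ^+ 2.
    by rewrite sumr_const card_ord mulr_natl.
  rewrite -big_split; apply: ler_sum => i _ /=.
  by have := sqr_ge0 (a - F (lift ord0 i)); nra.
rewrite -natr1; lra.
Qed.

(** With [L = G^T G] the form is the squared norm of [G x], and [x] is recovered
    from [G x] by the inverse of [G]. *)
Lemma posdef_coercive n (L : 'M[R]_n) : posdef L ->
  exists2 e : R, 0 < e & forall x : 'cV[R]_n, e * \sum_i x i 0 ^+ 2 <= bilin L x x.
Proof.
move=> pL; have [G LE] := cholesky pL.
have normG x : bilin L x x = \sum_i (G *m x) i 0 ^+ 2.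
  rewrite LE -[G^T]mulmx1 bilin_congr bilin1.
  by apply: eq_bigr => i _; rewrite expr2.
have Gunit : G \in unitmx.
  rewrite -unitmx_tr -row_free_unit; apply/inj_row_free => v /(congr1 trmx).
  rewrite trmx_mul trmxK trmx0 => Gv; apply: trmx_inj; rewrite trmx0.
  apply/eqP; apply: contraT => v0; have := pL.2 _ v0; rewrite -/(bilin _ _ _) normG Gv.
  by rewrite big1 ?ltxx // => i _; rewrite mxE expr0n.
pose K : R := 1 + \sum_i \sum_j n%:R * invmx G i j ^+ 2.
have K0 : 0 < K.
  by rewrite ltr_pwDl // sumr_ge0 // => i _; rewrite sumr_ge0 // => j _; rewrite mulr_ge0 ?sqr_ge0.
exists K^-1; first by rewrite invr_gt0.
move=> x; rewrite mulrC ler_pdivrMr // normG.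
have xE : x = invmx G *m (G *m x) by rewrite mulKmx.
set y := G *m x in xE *.
have yle j : y j 0 ^+ 2 <= \sum_i y i 0 ^+ 2.
  by rewrite (bigD1 j) //= lerDl sumr_ge0 // => ? _; exact: sqr_ge0.
rewrite mulrDr mulr1 -[leLHS]add0r; apply: lerD; first by rewrite sumr_ge0 // => ? _; exact: sqr_ge0.
rewrite mulr_sumr; apply: ler_sum => i _; rewrite {1}xE mxE.
apply: le_trans (sqr_sum_le _) _; rewrite -mulr_sumr mulrCA ler_wpM2l //.
rewrite mulr_sumr; apply: ler_sum => j _.
by rewrite exprMn mulrC ler_wpM2r ?sqr_ge0.
Qed.

End PositiveDefinite.

(** * Vector signals *)

Section VectorSignals.
Variable R : realType.
Local Notation mu := (@lebesgue_measure R).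
Local Notation J := (@primitive R).
Local Open Scope classical_set_scope.

Definition sq_vec n (u : R -> 'cV[R]_n) : Prop := forall i, sq_loc_integrable (fun t => u t i 0).

Lemma sq_vec_mul m n (M : 'M[R]_(m, n)) u : sq_vec u -> sq_vec (fun t => M *m u t).
Proof.
move=> us i; under [X in sq_loc_integrable X]eq_fun do rewrite mxE.
exact: sq_loc_integrable_sum.
Qed.

Lemma sq_vecD n (u v : R -> 'cV[R]_n) : sq_vec u -> sq_vec v -> sq_vec (fun t => u t + v t).
Proof.
move=> us vs i; under [X in sq_loc_integrable X]eq_fun do rewrite mxE.
exact: sq_loc_integrableD.
Qed.

Lemma sq_vec_col_mx m n (u : R -> 'cV[R]_m) (v : R -> 'cV[R]_n) :
  sq_vec u -> sq_vec v -> sq_vec (fun t => col_mx (u t) (v t)).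
Proof.
move=> us vs i; case: (split_ordP i) => j ->.
  by under [X in sq_loc_integrable X]eq_fun do rewrite col_mxEu; exact: us.
by under [X in sq_loc_integrable X]eq_fun do rewrite col_mxEd; exact: vs.
Qed.

Lemma loc_integrable_bilin m n (M : 'M[R]_(m, n)) u v :
  sq_vec u -> sq_vec v -> loc_integrable (fun t => bilin M (u t) (v t)).
Proof.
move=> us vs; under [X in loc_integrable X]eq_fun do rewrite bilinE.
do 2 (apply: loc_integrable_sum => ?); apply: loc_integrableZ.
exact: sq_loc_integrableM.
Qed.

Lemma L2e_sq_vec n (u : R -> 'cV[R]_n) : L2e u -> sq_vec u.
Proof.
move=> H i; have [mu_ fin] := H i; split=> //.
apply: loc_integrable_ge0 => T T0; apply/integrableP; split.
  apply/measurable_EFinP; apply: measurable_itv0.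
  exact: measurable_funX.
apply: le_lt_trans (fin T T0); rewrite le_eqVlt; apply/orP; left; apply/eqP.
by apply: eq_integral => t _; rewrite /= ger0_norm ?sqr_ge0.
Qed.

(** Local absolute continuity on the half-line, with a locally square integrable
    derivative, in integrated form. *)
Definition vec_deriv n (u u' : R -> 'cV[R]_n) : Prop := sq_vec u' /\
  forall t i, 0 <= t -> u t i 0 = u 0 i 0 + J (fun s => u' s i 0) t.

Lemma vec_deriv_sq_vec n (u u' : R -> 'cV[R]_n) : vec_deriv u u' -> sq_vec u.
Proof.
move=> [u's uE] i; have u'i := sq_loc_integrable_loc (u's i).
apply: continuous_sq_loc_integrable => T T0.
have : {within `[0, T], continuous (fun t => u 0 i 0 + J (fun s => u' s i 0) t)}.
  move=> t; apply: cvgD; first exact: cvg_cst.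
  by apply: primitive_continuous.
apply: subspace_eq_continuous => t; rewrite inE /= in_itv /= => /andP[t0 _].
by rewrite /from_subspace [RHS]uE.
Qed.

Lemma vec_deriv_col_mx m n (u u' : R -> 'cV[R]_m) (v v' : R -> 'cV[R]_n) :
  vec_deriv u u' -> vec_deriv v v' ->
  vec_deriv (fun t => col_mx (u t) (v t)) (fun t => col_mx (u' t) (v' t)).
Proof.
move=> [us uE] [vs vE]; split; first exact: sq_vec_col_mx.
move=> t i t0; case: (split_ordP i) => j ->.
  rewrite !col_mxEu uE //; congr (_ + _); apply: eq_primitive => s _.
  by rewrite col_mxEu.
rewrite !col_mxEd vE //; congr (_ + _); apply: eq_primitive => s _.
by rewrite col_mxEd.
Qed.

Lemma vec_deriv_bilin m n (M : 'M[R]_(m, n)) u u' v v' T : 0 <= T ->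
  vec_deriv u u' -> vec_deriv v v' ->
  bilin M (u T) (v T) = bilin M (u 0) (v 0)
    + J (fun t => bilin M (u' t) (v t) + bilin M (u t) (v' t)) T.
Proof.
move=> T0 du dv; have us := vec_deriv_sq_vec du; have vs := vec_deriv_sq_vec dv.
have [u's uE] := du; have [v's vE] := dv.
pose F i j t := M i j * (u' t i 0 * v t j 0 + u t i 0 * v' t j 0).
have Fi i j : loc_integrable (F i j).
  by apply: loc_integrableZ; apply: loc_integrableD; exact: sq_loc_integrableM.
have -> : J (fun t => bilin M (u' t) (v t) + bilin M (u t) (v' t)) T =
    J (fun t => \sum_i \sum_j F i j t) T.
  apply: eq_primitive => t _; rewrite !bilinE -big_split; apply: eq_bigr => i _.
  by rewrite -big_split; apply: eq_bigr => j _ /=; rewrite -mulrDr.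
rewrite primitive_sum; last by move=> i; exact: loc_integrable_sum.
rewrite !bilinE -big_split; apply: eq_bigr => i _ /=.
rewrite primitive_sum // -big_split; apply: eq_bigr => j _ /=.
rewrite /F primitiveZ; last by apply: loc_integrableD; exact: sq_loc_integrableM.
rewrite -mulrDr; congr (_ * _).
set p := fun s => u' s i 0; set q := fun s => v' s j 0.
have pi : loc_integrable p by apply: sq_loc_integrable_loc; exact: u's.
have qi : loc_integrable q by apply: sq_loc_integrable_loc; exact: v's.
have pJ : loc_integrable (fun s => p s * J q s).
  by apply: sq_loc_integrableM; [exact: u's | exact: primitive_sq_loc_integrable].
have Jq : loc_integrable (fun s => J p s * q s).
  by apply: sq_loc_integrableM; [exact: primitive_sq_loc_integrable | exact: v's].
rewrite (@eq_primitive _ _ (fun s => (v 0 j 0 * p s + u 0 i 0 * q s)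
    + (p s * J q s + J p s * q s))); last first.
  by move=> s /andP[s0 _]; rewrite uE // vE // /p /q; ring.
rewrite primitiveD; [| by apply: loc_integrableD; exact: loc_integrableZ
  | exact: loc_integrableD].
rewrite primitiveD ?primitiveZ; try exact: loc_integrableZ; try by [].
by rewrite -primitiveM // uE // vE // -/p -/q; ring.
Qed.

End VectorSignals.

(** * The quadratic constraint for filtered signals *)

Section FilterIQC.
Variable R : realType.
Local Notation mu := (@lebesgue_measure R).
Local Notation J := (@primitive R).
Local Notation "A ^P" := (map_mx polyC A) (at level 8, format "A ^P").
Local Open Scope classical_set_scope.

Definition filter_state n k (A : 'M[R]_n) (B : 'M[R]_(n, k)) (z : R -> 'cV[R]_k) (t : R) :
    'cV[R]_n :=
  \col_i conv_state A (fun i s => (B *m z s) i 0) i t.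

Section FilterState.
Variables (n k : nat) (A : 'M[R]_n) (B : 'M[R]_(n, k)) (z : R -> 'cV[R]_k).
Hypothesis zs : sq_vec z.
Let x := filter_state A B z.

Let Bzi i : loc_integrable (fun s => (B *m z s) i 0).
Proof. exact: sq_loc_integrable_loc (sq_vec_mul B zs i). Qed.

Lemma filter_stateE t i : x t i 0 = J (fun s => (A *m x s + B *m z s) i 0) t.
Proof.
rewrite /x mxE conv_stateE //; apply: eq_primitive => s _.
rewrite [in RHS]mxE [in RHS]mxE; congr (_ + _); apply: eq_bigr => l _.
by rewrite [filter_state _ _ _ _ _ _]mxE.
Qed.

Lemma filter_state0 : x 0 = 0.
Proof. by apply/colP => i; rewrite filter_stateE primitive0 mxE. Qed.

Lemma filter_state_deriv : vec_deriv x (fun s => A *m x s + B *m z s).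
Proof.
have xi i : loc_integrable (fun t => x t i 0).
  apply: eq_loc_integrable (loc_integrable_conv_state A Bzi i) => t _.
  by rewrite /x mxE.
have Axi i : loc_integrable (fun s => (A *m x s + B *m z s) i 0).
  have := loc_integrableD (@loc_integrable_sum _ _ (index_enum 'I_n) (fun l s => A i l * x s l 0)
    (fun l => loc_integrableZ (A i l) (xi l))) (Bzi i).
  by apply: eq_loc_integrable => s _; rewrite [in RHS]mxE [in RHS]mxE.
have xs : sq_vec x.
  move=> i; have -> : (fun t => x t i 0) = J (fun s => (A *m x s + B *m z s) i 0).
    by apply/funext => t; exact: filter_stateE.
  exact: primitive_sq_loc_integrable.
split; first by apply: sq_vecD; exact: sq_vec_mul.
by move=> t i t0; rewrite filter_state0 [X in X + _]mxE add0r filter_stateE.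
Qed.

End FilterState.

Lemma op_polyC_eval c (x : op_signal R) t : (c%:P *: x : signal R) t = c * (x : signal R) t.
Proof. by rewrite -[LHS]/((polyact (@integrate R) c%:P x : signal R) t) polyactC. Qed.

Lemma op_X_eval (x : op_signal R) t : ('X *: x : signal R) t = J (x : signal R) t.
Proof. by rewrite -[LHS]/((polyact (@integrate R) 'X x : signal R) t) polyactX. Qed.

Lemma mxact_polyC_eval m n (A : 'M[R]_(m, n)) (v : 'I_n -> op_signal R) i t :
  (mxact A^P v i : signal R) t = \sum_j A i j * (v j : signal R) t.
Proof.
rewrite /mxact; have := @signal_sumE R _ (index_enum 'I_n) (fun j => A^P i j *: v j) t.
by move=> ->; apply: eq_bigr => j _; rewrite mxE op_polyC_eval.
Qed.

Definition vec_signal n (u : R -> 'cV[R]_n) (us : sq_vec u) (i : 'I_n) : op_signal R :=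
  to_signal (sq_loc_integrable_loc (us i)).

Lemma vec_signalE n (u : R -> 'cV[R]_n) (us : sq_vec u) i t :
  (vec_signal us i : signal R) t = J (fun s => u s i 0) t.
Proof. by []. Qed.

Lemma mxact_vec_signal m n (A : 'M[R]_(m, n)) u (us : sq_vec u) i t :
  (mxact A^P (vec_signal us) i : signal R) t = J (fun s => (A *m u s) i 0) t.
Proof.
rewrite mxact_polyC_eval.
have -> : J (fun s => (A *m u s) i 0) t = J (fun s => \sum_j A i j * u s j 0) t.
  by apply: eq_primitive => s _; rewrite mxE.
have ui j := sq_loc_integrable_loc (us j).
rewrite primitive_sum; last by move=> j; exact: loc_integrableZ.
by apply: eq_bigr => j _; rewrite primitiveZ.
Qed.

Lemma state_eq_filter n k (A : 'M[R]_n) (B : 'M[R]_(n, k)) z (zs : sq_vec z)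
    (xs : sq_vec (filter_state A B z)) :
  state_eq A B (vec_signal xs) (vec_signal zs).
Proof.
move=> i; apply: signalP => t t0; rewrite vec_signalE op_X_eval; apply: eq_primitive => s _.
rewrite signal_addE !mxact_vec_signal -primitiveD; last 2 first.
- exact: sq_loc_integrable_loc (sq_vec_mul A xs i).
- exact: sq_loc_integrable_loc (sq_vec_mul B zs i).
by rewrite filter_stateE //; apply: eq_primitive => r _; rewrite mxE.
Qed.

Lemma lti_mapE k l (S : lti R k l) (z : R -> 'cV[R]_k) t : sq_vec z ->
  lti_map S z t = lti_C S *m filter_state (lti_A S) (lti_B S) z t + lti_D S *m z t.
Proof.
move=> zs; rewrite /lti_map; congr (_ + _); apply/colP => i; rewrite mxE.
have fi j := sq_loc_integrable_loc (sq_vec_mul (lti_B S) zs j).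
pose F j s := \sum_l expmx ((t - s) *: lti_A S) j l * (lti_B S *m z s) l 0.
have Fi j : loc_integrable (F j).
  apply: loc_integrable_sum => r; apply: (@convol_integrand _ (fun x => expmx (x *: lti_A S) j r) _ _ (fi r)).
  move=> x; apply: differentiable_continuous; apply/derivable1_diffP.
  by have [] := is_derive_expmx_entry (lti_A S) x j r.
rewrite mxE; under [RHS]eq_bigr => j _ do rewrite mxE.
rewrite -[LHS]/(J _ t) (@eq_primitive _ _ (fun s => \sum_j lti_C S i j * F j s)); last first.
  move=> s _; rewrite -!mulmxA mxE; apply: eq_bigr => j _; congr (_ * _).
  by rewrite mxE.
rewrite primitive_sum; last by move=> j; exact: loc_integrableZ.
by apply: eq_bigr => j _; rewrite primitiveZ.
Qed.

Definition filter_state_input n k (A : 'M[R]_n) (B : 'M[R]_(n, k)) (z : R -> 'cV[R]_k) t :=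
  col_mx (filter_state A B z t) (z t).

(** The uncertainty is a multiple [b / a] of the identity, so it commutes with the
    filter: the filter state of [w], and [w] itself, arise from those of [z] by
    [b / a] in every entry. Factoring [L = G^T G] writes the integrand as the
    sum, over the entries of [G (xi, z)] and [G (xi', w)], of quadratic forms
    in two scalar signals that are related by [b / a], and [scalar_iqc] applies
    to each of them. *)
Lemma multiplier_iqc nu k np (P : 'I_nu -> 'M[R]_2) (S : lti R k k)
    (Ap : 'M[R]_np) (Bp : 'M[R]_(np, k)) (L : 'M[R]_(np + k)) z w i T :
  (forall i, P i \is symmetricmx) -> (forall i, P i 1 1 <= 0) ->
  uncertainty (repeated_set k P) S -> posdef L -> sq_vec z -> sq_vec w ->
  {ae mu, forall t : R, 0 <= t -> w t = lti_map S z t} -> 0 <= T ->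
  0 <= J (fun t =>
    P i 0 0 * bilin L (filter_state_input Ap Bp z t) (filter_state_input Ap Bp z t)
    + 2 * P i 0 1 * bilin L (filter_state_input Ap Bp z t) (filter_state_input Ap Bp w t)
    + P i 1 1 * bilin L (filter_state_input Ap Bp w t) (filter_state_input Ap Bp w t)) T.
Proof.
(* Without channels all signals vanish, and no diagonal entry defines [b / a]. *)
case: k S Bp L z w => [|k] S Bp L z w hP hP22 hS pL zs ws hw T0;
  set vz := filter_state_input Ap Bp z; set vw := filter_state_input Ap Bp w.
  have fs0 u t : filter_state Ap Bp u t = 0.
    apply/colP => j; rewrite !mxE /conv_state.
    rewrite -[LHS]/(J _ t) (@eq_primitive _ _ (fun=> 0)) ?primitive_cst0 // => s _.
    by rewrite big1 // => l _; rewrite (flatmx0 (u s)) mulmx0 [X in _ * X]mxE mulr0.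
  rewrite (@eq_primitive _ _ (fun=> 0)) ?primitive_cst0 // => s _.
  rewrite /vz /vw /filter_state_input !fs0 (flatmx0 (z s)) (flatmx0 (w s)) col_mx0 !bilin0l; ring.
have [a [b [am sb ha TE hN]]] := repeated_uncertainty hP hS.
pose m := (size a).-1.
have numE := repeated_numer_mx am sb TE.
have xs := vec_deriv_sq_vec (filter_state_deriv (lti_A S) (lti_B S) zs).
have xzs := vec_deriv_sq_vec (filter_state_deriv Ap Bp zs).
have xws := vec_deriv_sq_vec (filter_state_deriv Ap Bp ws).
have wE j : vec_signal ws j = mxact (lti_C S)^P (vec_signal xs) j
    + mxact (lti_D S)^P (vec_signal zs) j.
  apply: signalP => t t0; rewrite signal_addE !mxact_vec_signal -primitiveD; last 2 first.
  - exact: sq_loc_integrable_loc (sq_vec_mul _ xs j).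
  - exact: sq_loc_integrable_loc (sq_vec_mul _ zs j).
  rewrite vec_signalE; apply: primitive_ae.
  - exact: sq_loc_integrable_loc (ws j).
  - apply: loc_integrableD.
      exact: sq_loc_integrable_loc (sq_vec_mul _ xs j).
    exact: sq_loc_integrable_loc (sq_vec_mul _ zs j).
  apply: ae_imp hw => s hs s0; rewrite hs // lti_mapE //.
  by rewrite [in LHS]mxE.
have rel := scalar_lti_relation (@op_signal_inj R) numE (state_eq_filter zs xs) wE.
have relx := filter_commutes (@op_signal_inj R) (state_eq_filter zs xzs)
  (state_eq_filter ws xws) rel.
have [G LE] := cholesky pL.
have vzs : sq_vec vz by exact: sq_vec_col_mx.
have vws : sq_vec vw by exact: sq_vec_col_mx.
have relv j : revp m a *: vec_signal vws j = revp m b *: vec_signal vzs j.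
  case: (split_ordP j) => j' ->.
    have -> : vec_signal vws (lshift k.+1 j') = vec_signal xws j'.
      by apply: signalP => t t0; rewrite !vec_signalE; apply: eq_primitive => s _; rewrite col_mxEu.
    have -> : vec_signal vzs (lshift k.+1 j') = vec_signal xzs j'.
      by apply: signalP => t t0; rewrite !vec_signalE; apply: eq_primitive => s _; rewrite col_mxEu.
    exact: relx.
  have -> : vec_signal vws (rshift np j') = vec_signal ws j'.
    by apply: signalP => t t0; rewrite !vec_signalE; apply: eq_primitive => s _; rewrite col_mxEd.
  have -> : vec_signal vzs (rshift np j') = vec_signal zs j'.
    by apply: signalP => t t0; rewrite !vec_signalE; apply: eq_primitive => s _; rewrite col_mxEd.
  exact: rel.
have gs := sq_vec_mul G vzs; have hs := sq_vec_mul G vws.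
have relg j : revp m a *: vec_signal hs j = revp m b *: vec_signal gs j.
  have E u (us : sq_vec u) (Gus : sq_vec (fun t => G *m u t)) :
      vec_signal Gus j = mxact G^P (vec_signal us) j.
    by apply: signalP => t t0; rewrite mxact_vec_signal.
  rewrite (E _ vws) (E _ vzs) -!mxact_scale; exact: eq_mxact.
have pos j := scalar_iqc am sb ha (hP22 i) (hN i) T0 (relg j).
rewrite (@eq_primitive _ _ (fun t => \sum_j (P i 0 0 * (G *m vz t) j 0 ^+ 2
    + 2 * P i 0 1 * ((G *m vz t) j 0 * (G *m vw t) j 0) + P i 1 1 * (G *m vw t) j 0 ^+ 2))).
  rewrite primitive_sum; first by apply: sumr_ge0 => j _; exact: pos.
  move=> j; apply: loc_integrableD; last exact: loc_integrableZ (hs j).2.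
  apply: loc_integrableD; first exact: loc_integrableZ (gs j).2.
  by apply: loc_integrableZ; exact: sq_loc_integrableM.
move=> t _; have LG u v : bilin L u v = \sum_j (G *m u) j 0 * (G *m v) j 0.
  by rewrite LE -[G^T]mulmx1 bilin_congr bilin1.
rewrite !LG !mulr_sumr -!big_split; apply: eq_bigr => j _ /=; ring.
Qed.

End FilterIQC.

(** * The matrix inequalities *)

Section MatrixInequalities.
Variable R : realType.

Lemma bilin_multiplier_lmi np mp k (Ap : 'M[R]_np) (Bp : 'M[R]_(np, k))
    (Cp : 'M[R]_(mp, np)) (Dp : 'M[R]_(mp, k)) Y M (x1 : 'cV[R]_np) (u1 : 'cV[R]_k)
    (x2 : 'cV[R]_np) (u2 : 'cV[R]_k) :
  bilin (multiplier_lmi Ap Bp Cp Dp Y M) (col_mx x1 u1) (col_mx x2 u2) =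
  bilin Y x1 (Ap *m x2 + Bp *m u2) + bilin Y (Ap *m x1 + Bp *m u1) x2
  + bilin M (Cp *m x1 + Dp *m u1) (Cp *m x2 + Dp *m u2).
Proof.
rewrite /multiplier_lmi bilinD !bilin_congr !mul_block_col !mul_row_col.
by rewrite !mul1mx !mul0mx !addr0 bilin_block !bilin0 add0r addr0.
Qed.

Lemma bilin_kron2 p q (P : 'M[R]_2) (M : 'M[R]_(p, q)) (u1 u2 : 'cV[R]_p)
    (v1 v2 : 'cV[R]_q) :
  bilin (kron2 P M) (col_mx u1 u2) (col_mx v1 v2) =
  P 0 0 * bilin M u1 v1 + P 0 1 * bilin M u1 v2 + P 1 0 * bilin M u2 v1
  + P 1 1 * bilin M u2 v2.
Proof. by rewrite kron2E bilin_block !bilinZ. Qed.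

Lemma outer_factorE n np mp k (A : 'M[R]_n) (B : 'M[R]_(n, k)) (C : 'M[R]_(k, n))
    (D : 'M[R]_k) (Ap : 'M[R]_np) (Bp : 'M[R]_(np, k)) (Cp : 'M[R]_(mp, np))
    (Dp : 'M[R]_(mp, k)) (xz xw : 'cV[R]_np) (x : 'cV[R]_n)
    (w : 'cV[R]_k) (z := C *m x + D *m w) :
  outer_factor A B C D Ap Bp Cp Dp *m col_mx (col_mx (col_mx xz xw) x) w =
  col_mx (col_mx (col_mx (col_mx xz xw) x)
                 (col_mx (col_mx (Ap *m xz + Bp *m z) (Ap *m xw + Bp *m w))
                         (A *m x + B *m w)))
         (col_mx (Cp *m xz + Dp *m z) (Cp *m xw + Dp *m w)).
Proof.
have dl m' n' (J : 'M[R]_(m', n')) u v :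
    diag2 J *m col_mx u v = col_mx (J *m u) (J *m v).
  by rewrite /diag2 mul_block_col !mul0mx addr0 add0r.
rewrite /outer_factor !mul_col_mx !mul_row_col !mul0mx !mul1mx !addr0 !add0r.
by rewrite !dl !mul_col_mx !mulmx0 !mul0mx !mulmx1 !add_col_mx !addr0 /z !mulmxDr !mulmxA !addrA.
Qed.

Lemma bilin_stability_lmi nu n np mp k (A : 'M[R]_n) (B : 'M[R]_(n, k)) (C : 'M[R]_(k, n))
    (D : 'M[R]_k) (Ap : 'M[R]_np) (Bp : 'M[R]_(np, k)) (Cp : 'M[R]_(mp, np))
    (Dp : 'M[R]_(mp, k)) (P : 'I_nu -> 'M[R]_2) (X : 'M[R]_((np + np) + n))
    (M : 'I_nu -> 'M[R]_mp) (xz xw : 'cV[R]_np) (x : 'cV[R]_n)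
    (w : 'cV[R]_k) (z := C *m x + D *m w)
    (chi := col_mx (col_mx xz xw) x)
    (chi' := col_mx (col_mx (Ap *m xz + Bp *m z) (Ap *m xw + Bp *m w)) (A *m x + B *m w))
    (yz := Cp *m xz + Dp *m z) (yw := Cp *m xw + Dp *m w) :
  bilin (stability_lmi A B C D Ap Bp Cp Dp P X M) (col_mx chi w) (col_mx chi w) =
  bilin X chi chi' + bilin X chi' chi
  + \sum_i (P i 0 0 * bilin (M i) yz yz + P i 0 1 * bilin (M i) yz yw
            + P i 1 0 * bilin (M i) yw yz + P i 1 1 * bilin (M i) yw yw).
Proof.
rewrite /stability_lmi bilin_congr outer_factorE.
rewrite bilin_block !bilin0 !addr0 bilin_block !bilin0 add0r addr0 bilin_sum.
by congr (_ + _); apply: eq_bigr => i _; rewrite bilin_kron2.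
Qed.

Lemma bilin_coupling_lmi nu n np (P : 'I_nu -> 'M[R]_2) (X : 'M[R]_((np + np) + n))
    (Y : 'I_nu -> 'M[R]_np) (xz xw : 'cV[R]_np) (x : 'cV[R]_n) (chi := col_mx (col_mx xz xw) x) :
  bilin (coupling_lmi P X Y) chi chi = bilin X chi chi
  - \sum_i (P i 0 0 * bilin (Y i) xz xz + P i 0 1 * bilin (Y i) xz xw
            + P i 1 0 * bilin (Y i) xw xz + P i 1 1 * bilin (Y i) xw xw).
Proof.
rewrite /coupling_lmi bilinD -scaleN1r bilinZ mulN1r; congr (_ - _).
rewrite bilin_block !bilin0 !addr0 bilin_sum.
by apply: eq_bigr => i _; rewrite bilin_kron2.
Qed.

Lemma symmetric2 (P : 'M[R]_2) : P \is symmetricmx -> P 1 0 = P 0 1.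
Proof. by move=> /symmetricmxP/matrixP/(_ 0 1); rewrite mxE. Qed.

(** A null vector [z] of [I - v D] satisfies [z = D w] with [w = v z]. For zero
    states and input [w], the form of the stability inequality, summed over
    real and imaginary parts, is the sum over [i] of the [i]-th quadratic
    constraint at [v] times the [i]-th multiplier form at [z]. Both factors are
    nonnegative, while the form is negative unless [w] vanishes. *)
Lemma lmi_well_posed nu n np mp k (A : 'M[R]_n) (B : 'M[R]_(n, k)) (C : 'M[R]_(k, n))
    (D : 'M[R]_k) (Ap : 'M[R]_np) (Bp : 'M[R]_(np, k)) (Cp : 'M[R]_(mp, np))
    (Dp : 'M[R]_(mp, k)) (P : 'I_nu -> 'M[R]_2) X Y M :
  (forall i, P i \is symmetricmx) ->
  (forall i, posdef (multiplier_lmi Ap Bp Cp Dp (Y i) (M i))) ->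
  negdef (stability_lmi A B C D Ap Bp Cp Dp P X M) ->
  well_posed D (repeated_set k P).
Proof.
move=> hP hM [hSsym hS] W [v [-> hv]]; apply/negP; rewrite -det_tr => /det0P[u u0 uD].
pose z : 'I_k -> R[i] := fun i => u 0 i.
have zE i : z i = \sum_j (D i j)%:C * (v * z j).
  have /rowP/(_ i) := uD; rewrite [RHS]mxE mxE => E.
  apply/eqP; rewrite -subr_eq0; apply/eqP; rewrite -[RHS]E.
  rewrite mul_mx_scalar /z.
  rewrite [X in X - _](_ : _ = \sum_j u 0 j * ((i == j)%:R : R[i])); last first.
    rewrite (bigD1 i) //= eqxx mulr1 big1 ?addr0 // => j ji.
    by rewrite eq_sym (negPf ji) mulr0.
  rewrite -sumrB; apply: eq_bigr => j _; rewrite !mxE mulrBr; congr (_ - _).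
  ring.
pose re (f : 'I_k -> R[i]) : 'cV[R]_k := \col_i complex.Re (f i).
pose im (f : 'I_k -> R[i]) : 'cV[R]_k := \col_i complex.Im (f i).
have ReD (a b : R[i]) : complex.Re (a + b) = complex.Re a + complex.Re b by case: a; case: b.
have ImD (a b : R[i]) : complex.Im (a + b) = complex.Im a + complex.Im b by case: a; case: b.
have reD f : re (fun i => \sum_j (D i j)%:C * f j) = D *m re f.
  apply/colP => i; rewrite !mxE (big_morph _ ReD (erefl _)); apply: eq_bigr => j _.
  by rewrite mxE; case: (f j) => x y /=; rewrite mul0r subr0.
have imD f : im (fun i => \sum_j (D i j)%:C * f j) = D *m im f.
  apply/colP => i; rewrite !mxE (big_morph _ ImD (erefl _)); apply: eq_bigr => j _.
  by rewrite mxE; case: (f j) => x y /=; rewrite mul0r addr0.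
pose w j := v * z j.
have zr : re z = D *m re w by rewrite -reD; apply/colP => i; rewrite !mxE zE.
have zi : im z = D *m im w by rewrite -imD; apply/colP => i; rewrite !mxE zE.
set s := complex.Re v; set t := complex.Im v.
have wr : re w = s *: re z - t *: im z.
  by apply/colP => i; rewrite !mxE /w /s /t; case: (v) (z i) => ? ? [? ?].
have wi : im w = s *: im z + t *: re z.
  by apply/colP => i; rewrite !mxE /w /s /t; case: (v) (z i) => ? ? [? ?] /=; ring.
pose q i (x y : 'cV[R]_k) := bilin (M i) (Dp *m x) (Dp *m y).
have qsum i : 0 <= q i (re z) (re z) + q i (im z) (im z).
  have pos x : 0 <= q i x x.
    have [->|x0] := eqVneq x 0; first by rewrite /q mulmx0 bilin0l.
    have := (hM i).2 (col_mx 0 x); rewrite -/(bilin _ _ _) bilin_multiplier_lmi.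
    rewrite bilin0l bilin0r !mulmx0 !add0r => h; apply/ltW/h.
    apply: contra_neq x0 => /colP e; apply/colP => j.
    by have := e (rshift np j); rewrite col_mxEd !mxE.
  by rewrite addr_ge0.
have lmi x : bilin (stability_lmi A B C D Ap Bp Cp Dp P X M)
    (col_mx (col_mx (col_mx 0 0) 0) x) (col_mx (col_mx (col_mx 0 0) 0) x) =
    \sum_i (P i 0 0 * q i (D *m x) (D *m x) + P i 0 1 * q i (D *m x) x
            + P i 1 0 * q i x (D *m x) + P i 1 1 * q i x x).
  rewrite bilin_stability_lmi !mulmx0 !add0r.
  by rewrite !col_mx0 bilin0l bilin0r !add0r.
have neg x : x != 0 -> bilin (stability_lmi A B C D Ap Bp Cp Dp P X M)
    (col_mx (col_mx (col_mx 0 0) 0) x) (col_mx (col_mx (col_mx 0 0) 0) x) < 0.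
  move=> x0; apply: hS; apply: contra_neq x0 => /colP e; apply/colP => j.
  by have := e (rshift _ j); rewrite col_mxEd !mxE.
have npos x : bilin (stability_lmi A B C D Ap Bp Cp Dp P X M)
    (col_mx (col_mx (col_mx 0 0) 0) x) (col_mx (col_mx (col_mx 0 0) 0) x) <= 0.
  have [->|/neg/ltW//] := eqVneq x 0.
  by rewrite !col_mx0 bilin0l.
have sum0 : 0 <= bilin (stability_lmi A B C D Ap Bp Cp Dp P X M)
      (col_mx (col_mx (col_mx 0 0) 0) (re w)) (col_mx (col_mx (col_mx 0 0) 0) (re w))
    + bilin (stability_lmi A B C D Ap Bp Cp Dp P X M)
      (col_mx (col_mx (col_mx 0 0) 0) (im w)) (col_mx (col_mx (col_mx 0 0) 0) (im w)).
  rewrite !lmi -zr -zi -big_split; apply: sumr_ge0 => i _ /=.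
  have qDl a b x y y' : q i (a *: x + b *: y) y' = a * q i x y' + b * q i y y'.
    by rewrite /q mulmxDr -!scalemxAr bilinDl !bilinZl.
  have qDr a b x y y' : q i y' (a *: x + b *: y) = a * q i y' x + b * q i y' y.
    by rewrite /q mulmxDr -!scalemxAr bilinDr !bilinZr.
  have wr' : re w = s *: re z + (- t) *: im z by rewrite wr scaleNr.
  rewrite wr' wi !qDl !qDr (symmetric2 (hP i)).
  have vpos : 0 <= P i 0 0 + 2 * P i 0 1 * s + P i 1 1 * (s ^+ 2 + t ^+ 2).
    have := quadratic_constraintE v (hP i) => /= E; have := hv i; rewrite /= E.
    by rewrite -[0 : R[i]]/(0%:C) lecR.
  apply: (le_trans (mulr_ge0 vpos (qsum i))); rewrite le_eqVlt; apply/orP; left.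
  by apply/eqP; ring.
have w0 : re w = 0 /\ im w = 0.
  have n1 := npos (re w); have n2 := npos (im w).
  split; apply/eqP; apply: contraT => /neg h; move: h n1 n2 sum0; clear; lra.
case/eqP: u0; apply/rowP => j; rewrite mxE -/(z j).
have := zr; have := zi; rewrite w0.1 w0.2 mulmx0 => /colP/(_ j) + /colP/(_ j).
by rewrite !mxE; case: (z j) => x y /= -> ->.
Qed.

End MatrixInequalities.

(** * Dissipation along trajectories *)

Section Convergence.
Variable R : realType.
Local Notation mu := (@lebesgue_measure R).
Local Notation J := (@primitive R).
Local Open Scope classical_set_scope.
Implicit Types f g phi : R -> R.

Lemma primitive_increment_le f phi s t : loc_integrable f -> loc_integrable phi ->
  (forall r, 0 <= r -> f r <= phi r) -> 0 <= s <= t ->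
  J f t - J f s <= J phi t - J phi s.
Proof.
move=> fi pi fp st; rewrite !primitive_split //; apply: le_Rintegral => //.
- apply: (integrableS _ _ _ (fi t)); try exact: measurable_itv.
  by apply: subset_itvr; rewrite bnd_simp; case/andP: st.
- apply: (integrableS _ _ _ (pi t)); try exact: measurable_itv.
  by apply: subset_itvr; rewrite bnd_simp; case/andP: st.
move=> r; rewrite /= in_itv /= => /andP[sr _]; apply: fp; move: st => /andP[s0 _].
exact: le_trans s0 (ltW sr).
Qed.

(** A variant of Barbalat's lemma: after a late time the integrable bound [phi] on
    the derivative leaves no room for growth, and by integrability of [f] there
    is a still later time at which [f] is small. *)
Lemma integrable_derivative_cvg0 f g phi (c : R) : loc_integrable f ->
  loc_integrable g -> loc_integrable phi -> (forall t, 0 <= t -> 0 <= f t) ->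
  (forall t, 0 <= t -> f t = f 0 + J g t) ->
  (forall t, 0 <= t -> 0 <= phi t) -> (forall t, 0 <= t -> g t <= phi t) ->
  (forall t, 0 <= t -> J f t <= c) -> (forall t, 0 <= t -> J phi t <= c) ->
  forall e : R, 0 < e -> exists2 T : R, 0 <= T & forall t, T <= t -> f t < e.
Proof.
move=> fi gi pi f0 fE p0 gp fc pc e e0.
have e2 : 0 < e / 2 by rewrite divr_gt0.
pose E := [set J phi t | t in [set t : R | 0 <= t]].
have Es : has_sup E.
  split; first by exists (J phi 0); exists 0 => //=.
  by exists c => _ [t t0 <-]; exact: pc.
have [_ [T1 T10 <-] T1P] := sup_adherent e2 Es.
have [T2 /andP[T12 fT2]] : exists T2, (T1 <= T2) && (f T2 < e / 2).
  apply: contrapT => /forallNP H.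
  have big t : T1 <= t -> e / 2 <= f t.
    by move=> t1; rewrite leNgt; apply/negP => ft; apply: (H t); rewrite t1.
  have c0 : 0 <= c by apply: le_trans (fc 0 (lexx 0)); rewrite primitive0.
  pose T := T1 + (c + 1) / (e / 2).
  have T1T : 0 <= T1 <= T.
    by rewrite T10 /= lerDl divr_ge0 ?(ltW e2) // addr_ge0.
  have := primitive_split fi T1T.
  have : e / 2 * (T - T1) <= \int[mu]_(x in `]T1, T]) f x.
    rewrite -Rintegral_oc_cst; last by case/andP: T1T.
    apply: le_Rintegral => //.
    - have ci : loc_integrable (fun=> e / 2).
        by apply: eq_loc_integrable (loc_integrableZ (e / 2) (@loc_integrable1 R)) => ? _; rewrite mulr1.
      apply: (integrableS _ _ _ (ci T)); try exact: measurable_itv.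
      by apply: subset_itvr; rewrite bnd_simp.
    - apply: (integrableS _ _ _ (fi T)); try exact: measurable_itv.
      by apply: subset_itvr; rewrite bnd_simp.
    by move=> r; rewrite /= in_itv /= => /andP[/ltW/big].
  have -> : e / 2 * (T - T1) = c + 1 by rewrite /T; field; rewrite gt_eqF.
  move=> le1 E1; have : J f T <= c by apply: fc; case/andP: T1T => [? ?]; exact: le_trans T10 _.
  have : 0 <= J f T1 by apply: primitive_ge0 => s /andP[s0 _]; exact: f0.
  move: le1; rewrite -E1; lra.
have T20 : 0 <= T2 by exact: le_trans T10 T12.
exists T2 => // t T2t; have t0 : 0 <= t by exact: le_trans T20 T2t.
have := @primitive_increment_le g phi T2 t gi pi gp; rewrite T20 T2t => /(_ isT) inc.
have pT : J phi T1 <= J phi T2 by apply: primitive_nondecreasing; rewrite ?T10.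
have pt : J phi t <= sup E by apply: sup_upper_bound => //; exists t.
have fEt := fE t t0; have fET := fE T2 T20; lra.
Qed.

End Convergence.

Section Dissipation.
Variable R : realType.
Local Notation mu := (@lebesgue_measure R).
Local Notation J := (@primitive R).
Local Open Scope classical_set_scope.

Definition sqr_norm n (u : 'cV[R]_n) : R := \sum_i u i 0 ^+ 2.

Lemma sqr_norm_ge0 n (u : 'cV[R]_n) : 0 <= sqr_norm u.
Proof. by apply: sumr_ge0 => i _; exact: sqr_ge0. Qed.

Lemma sqr_norm_col_mx m n (u : 'cV[R]_m) (v : 'cV[R]_n) :
  sqr_norm (col_mx u v) = sqr_norm u + sqr_norm v.
Proof.
rewrite /sqr_norm big_split_ord; congr (_ + _); apply: eq_bigr => i _.
  by rewrite col_mxEu.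
by rewrite col_mxEd.
Qed.

Lemma le_sqr_norm n (u : 'cV[R]_n) i : u i 0 ^+ 2 <= sqr_norm u.
Proof. by rewrite /sqr_norm (bigD1 i) //= lerDl sumr_ge0 // => j _; exact: sqr_ge0. Qed.

Lemma bilin1_sqr_norm n (u : 'cV[R]_n) : bilin 1%:M u u = sqr_norm u.
Proof. by rewrite bilin1; apply: eq_bigr => i _; rewrite expr2. Qed.

Lemma bilin_le n (M : 'M[R]_n) (u : 'cV[R]_n) :
  bilin M u u <= (\sum_i \sum_j `|M i j|) * sqr_norm u.
Proof.
rewrite bilinE mulr_suml; apply: ler_sum => i _; rewrite mulr_suml; apply: ler_sum => j _.
apply: le_trans (ler_norm _) _; rewrite normrM ler_wpM2l // ler_norml.
have := le_sqr_norm u i; have := le_sqr_norm u j.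
have := sqr_ge0 (u i 0 - u j 0); have := sqr_ge0 (u i 0 + u j 0); nra.
Qed.

Lemma loc_integrable_sqr_norm n (u : R -> 'cV[R]_n) :
  sq_vec u -> loc_integrable (fun t => sqr_norm (u t)).
Proof. by move=> us; apply: loc_integrable_sum => i; case: (us i). Qed.

Lemma primitive_comb3 (p q r : R) (a b c : R -> R) T :
  loc_integrable a -> loc_integrable b -> loc_integrable c ->
  J (fun t => p * a t + q * b t + r * c t) T = p * J a T + q * J b T + r * J c T.
Proof.
move=> ai bi ci; have li s (f : R -> R) := @loc_integrableZ R s f.
rewrite primitiveD; [|exact: loc_integrableD (li _ _ ai) (li _ _ bi)|exact: li].
by rewrite primitiveD ?primitiveZ //; exact: li.
Qed.

Lemma negdef_coercive n (L : 'M[R]_n) : negdef L ->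
  exists2 e : R, 0 < e & forall x : 'cV[R]_n, bilin L x x <= - (e * sqr_norm x).
Proof.
move=> [/symmetricmxP sL nL]; have [|e e0 he] := @posdef_coercive _ _ (- L).
  split; first by apply/symmetricmxP; rewrite linearN /= sL.
  by move=> x /nL; rewrite mulmxN mulNmx [X in _ -> 0 < X]mxE oppr_gt0.
by exists e => // x; have := he x; rewrite -scaleN1r bilinZ mulN1r lerNr.
Qed.

Section Trajectory.
Variables (nu n np mp k : nat).
Variables (A : 'M[R]_n) (B : 'M[R]_(n, k)) (C : 'M[R]_(k, n)) (D : 'M[R]_k).
Variables (Ap : 'M[R]_np) (Bp : 'M[R]_(np, k)) (Cp : 'M[R]_(mp, np)) (Dp : 'M[R]_(mp, k)).
Variable P : 'I_nu -> 'M[R]_2.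
Hypothesis hP : forall i, P i \is symmetricmx.
Hypothesis hP22 : forall i, P i 1 1 <= 0.
Variables (X : 'M[R]_((np + np) + n)) (Y : 'I_nu -> 'M[R]_np) (M : 'I_nu -> 'M[R]_mp).
Hypothesis hY : forall i, Y i \is symmetricmx.
Hypothesis hM : forall i, M i \is symmetricmx.
Hypothesis hL : forall i, posdef (multiplier_lmi Ap Bp Cp Dp (Y i) (M i)).
Variables (e1 e2 : R).
Hypothesis e1ge0 : 0 <= e1.
Hypothesis e2ge0 : 0 <= e2.
Hypothesis coupling : forall chi, e1 * sqr_norm chi <= bilin (coupling_lmi P X Y) chi chi.
Hypothesis stability : forall chi,
  bilin (stability_lmi A B C D Ap Bp Cp Dp P X M) chi chi <= - (e2 * sqr_norm chi).
Variables (S : lti R k k) (x : R -> 'cV[R]_n) (w z : R -> 'cV[R]_k).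
Hypothesis hS : uncertainty (repeated_set k P) S.
Hypothesis ws : sq_vec w.
Hypothesis zs : sq_vec z.
Hypothesis dx : vec_deriv x (fun t => A *m x t + B *m w t).
Hypothesis hz : {ae mu, forall t : R, 0 <= t -> z t = C *m x t + D *m w t}.
Hypothesis hw : {ae mu, forall t : R, 0 <= t -> w t = lti_map S z t}.

(** Integrate the stability inequality along the trajectory of the system
    extended by the filters of [z] and [w]. The multipliers contribute the
    integrals of [Q i], and [multiplier_iqc] bounds these from below by minus
    the terminal values of the forms [Y i] in the filter states, as the
    remaining part [DY i] of its integrand is the derivative of these forms.
    The terminal values are compensated by the coupling inequality. The filters
    start at rest, so that only [x 0] enters on the right. *)
Lemma dissipation T : 0 <= T ->
  e1 * sqr_norm (x T) + e2 * J (fun t => sqr_norm (x t) + sqr_norm (w t)) T <=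
  bilin X (col_mx 0 (x 0)) (col_mx 0 (x 0)).
Proof.
move=> T0.
pose xz := filter_state Ap Bp z; pose xw := filter_state Ap Bp w.
have iqc0 i : 0 <= J (fun t =>
    P i 0 0 * bilin (multiplier_lmi Ap Bp Cp Dp (Y i) (M i))
      (col_mx (xz t) (z t)) (col_mx (xz t) (z t))
    + 2 * P i 0 1 * bilin (multiplier_lmi Ap Bp Cp Dp (Y i) (M i))
      (col_mx (xz t) (z t)) (col_mx (xw t) (w t))
    + P i 1 1 * bilin (multiplier_lmi Ap Bp Cp Dp (Y i) (M i))
      (col_mx (xw t) (w t)) (col_mx (xw t) (w t))) T.
  exact: (@multiplier_iqc _ _ _ _ P S Ap Bp _ z w i T hP hP22 hS (hL i) zs ws hw T0).
pose xz' t := Ap *m xz t + Bp *m z t; pose xw' t := Ap *m xw t + Bp *m w t.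
have dz : vec_deriv xz xz' := filter_state_deriv Ap Bp zs.
have dw : vec_deriv xw xw' := filter_state_deriv Ap Bp ws.
have xz0 : xz 0 = 0 := filter_state0 Ap Bp zs.
have xw0 : xw 0 = 0 := filter_state0 Ap Bp ws.
clearbody xz xw.
pose chi t := col_mx (col_mx (xz t) (xw t)) (x t).
pose chi' t := col_mx (col_mx (xz' t) (xw' t)) (A *m x t + B *m w t).
have dchi : vec_deriv chi chi' by do 2 apply: vec_deriv_col_mx => //.
pose yz t := Cp *m xz t + Dp *m z t; pose yw t := Cp *m xw t + Dp *m w t.
have xzs := vec_deriv_sq_vec dz; have xws := vec_deriv_sq_vec dw.
have xs := vec_deriv_sq_vec dx; have chis := vec_deriv_sq_vec dchi.
have yzs : sq_vec yz by apply: sq_vecD; exact: sq_vec_mul.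
have yws : sq_vec yw by apply: sq_vecD; exact: sq_vec_mul.
pose DX t := bilin X (chi' t) (chi t) + bilin X (chi t) (chi' t).
pose DY i t := P i 0 0 * (bilin (Y i) (xz' t) (xz t) + bilin (Y i) (xz t) (xz' t))
  + 2 * P i 0 1 * (bilin (Y i) (xz' t) (xw t) + bilin (Y i) (xz t) (xw' t))
  + P i 1 1 * (bilin (Y i) (xw' t) (xw t) + bilin (Y i) (xw t) (xw' t)).
pose Q i t := P i 0 0 * bilin (M i) (yz t) (yz t)
  + 2 * P i 0 1 * bilin (M i) (yz t) (yw t) + P i 1 1 * bilin (M i) (yw t) (yw t).
have DXi : loc_integrable DX.
  by apply: loc_integrableD; apply: loc_integrable_bilin => //; case: dchi.
have Ydi i (u u' v v' : R -> 'cV[R]_np) : vec_deriv u u' -> vec_deriv v v' ->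
    loc_integrable (fun t => bilin (Y i) (u' t) (v t) + bilin (Y i) (u t) (v' t)).
  move=> du dv; apply: loc_integrableD; apply: loc_integrable_bilin.
  - by case: du.
  - exact: vec_deriv_sq_vec dv.
  - exact: vec_deriv_sq_vec du.
  - by case: dv.
have DYi i : loc_integrable (DY i).
  apply: loc_integrableD; [apply: loc_integrableD|];
  apply: loc_integrableZ; exact: Ydi.
have Qi i : loc_integrable (Q i).
  apply: loc_integrableD; [apply: loc_integrableD|];
  apply: loc_integrableZ; exact: loc_integrable_bilin.
have iqc i : 0 <= J (fun t => DY i t + Q i t) T.
  have := iqc0 i.
  congr (0 <= _); apply: eq_primitive => t _.
  rewrite !bilin_multiplier_lmi -/(xz' t) -/(xw' t).
  by rewrite -/(yz t) -/(yw t) /DY /Q; ring.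
have P10 i := symmetric2 (hP i).
have XT : bilin X (chi T) (chi T) = bilin X (chi 0) (chi 0) + J DX T.
  exact: vec_deriv_bilin.
have Y2 i u v : bilin (Y i) u v = bilin (Y i) v u.
  by rewrite bilinC (symmetricmxP _ (hY i)).
have M2 i u v : bilin (M i) u v = bilin (M i) v u.
  by rewrite bilinC (symmetricmxP _ (hM i)).
have YT i : P i 0 0 * bilin (Y i) (xz T) (xz T) + P i 0 1 * bilin (Y i) (xz T) (xw T)
    + P i 1 0 * bilin (Y i) (xw T) (xz T) + P i 1 1 * bilin (Y i) (xw T) (xw T)
    = J (DY i) T.
  have E u u' v v' : vec_deriv u u' -> vec_deriv v v' -> u 0 = 0 ->
      bilin (Y i) (u T) (v T) =
      J (fun t => bilin (Y i) (u' t) (v t) + bilin (Y i) (u t) (v' t)) T.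
    by move=> du dv u0; rewrite (vec_deriv_bilin _ T0 du dv) u0 bilin0l add0r.
  rewrite P10 (Y2 i (xw T) (xz T)) (E _ _ _ _ dz dz) // (E _ _ _ _ dz dw) // (E _ _ _ _ dw dw) //.
  rewrite (primitive_comb3 (P i 0 0) (2 * P i 0 1) (P i 1 1) T (Ydi i _ _ _ _ dz dz)
    (Ydi i _ _ _ _ dz dw) (Ydi i _ _ _ _ dw dw)); ring.
have := coupling (chi T); rewrite bilin_coupling_lmi.
rewrite (eq_bigr _ (fun i _ => YT i)) XT => coupT.
pose DS t := DX t + \sum_i Q i t.
have DSi : loc_integrable DS by apply: loc_integrableD => //; exact: loc_integrable_sum.
have sum_iqc : 0 <= \sum_i J (DY i) T + \sum_i J (Q i) T.
  rewrite -big_split; apply: sumr_ge0 => i _ /=.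
  by rewrite -primitiveD.
have JDS : J DS T = J DX T + \sum_i J (Q i) T.
  by rewrite primitiveD ?primitive_sum //; exact: loc_integrable_sum.
pose SS t := bilin (stability_lmi A B C D Ap Bp Cp Dp P X M) (col_mx (chi t) (w t))
  (col_mx (chi t) (w t)).
have SSi : loc_integrable SS.
  by apply: loc_integrable_bilin; exact: sq_vec_col_mx.
have DSE : J DS T = J SS T.
  apply: primitive_ae => //; apply: ae_imp hz => t hzt t0.
  rewrite /SS bilin_stability_lmi -(hzt t0) /DS /DX; congr (_ + _); first exact: addrC.
  by apply: eq_bigr => i _; rewrite P10 (M2 i (_ *m xw t + _)) /Q; ring.
have ni : loc_integrable (fun t => sqr_norm (x t) + sqr_norm (w t)).
  by apply: loc_integrableD; exact: loc_integrable_sqr_norm.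
have SSle : J SS T <= J (fun t => - e2 * (sqr_norm (x t) + sqr_norm (w t))) T.
  apply: le_primitive => // [|t _]; first exact: loc_integrableZ.
  apply: le_trans (stability _) _; rewrite mulNr lerN2 ler_wpM2l //.
  by rewrite !sqr_norm_col_mx lerD2r lerDr addr_ge0 ?sqr_norm_ge0.
rewrite primitiveZ // in SSle.
have xT : e1 * sqr_norm (x T) <= e1 * sqr_norm (chi T).
  by rewrite ler_wpM2l // sqr_norm_col_mx lerDr sqr_norm_ge0.
have chi0 : chi 0 = col_mx 0 (x 0).
  by rewrite /chi xz0 xw0 col_mx0.
rewrite -chi0; lra.
Qed.

End Trajectory.
End Dissipation.

Section Trajectories.
Variable R : realType.
Local Notation mu := (@lebesgue_measure R).
Local Notation J := (@primitive R).
Local Open Scope classical_set_scope.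

Lemma continuous_sq_vec n (x : R -> 'cV[R]_n) :
  {within (`[0, +oo[ : set R), continuous x} -> sq_vec x.
Proof.
move=> cx i; apply: continuous_sq_loc_integrable => T _.
apply: (@continuous_subspaceW _ _ _ (`[0, +oo[ : set R)).
  by move=> t; rewrite /= !in_itv /= andbT => /andP[].
move=> t; apply: (@cvg_comp _ _ _ x (fun u : 'cV[R]_n => u i 0) _ _ _ (cx t)).
exact: (@coord_continuous R n 1 i 0 (x t)).
Qed.

Lemma sqr_norm_cvg0 n (x : R -> 'cV[R]_n) :
  (forall e : R, 0 < e -> exists2 T : R, 0 <= T & forall t, T <= t -> sqr_norm (x t) < e) ->
  x t @[t --> +oo] --> (0 : 'cV[R]_n).
Proof.
move=> H; apply/cvg_ballP => e e0.
have [T T0 hT] := H (e ^+ 2) (exprn_gt0 _ e0).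
apply: filterS (nbhs_pinfty_ge (num_real T)) => t Tt.
split=> // i j; rewrite ord1 /ball /= mxE sub0r normrN.
rewrite -(@ltr_pXn2r _ 2) ?nnegrE ?normr_ge0 ?(ltW e0) // real_normK ?num_real //.
exact: le_lt_trans (le_sqr_norm _ i) (hT _ Tt).
Qed.

Lemma trajectory_deriv n l (A : 'M[R]_n) (B : 'M[R]_(n, l)) x (w : R -> 'cV[R]_l) :
  sq_vec x -> sq_vec w ->
  (forall t : R, 0 <= t -> x t = x 0 + integralmx 0 t (fun s => A *m x s + B *m w s)) ->
  vec_deriv x (fun t => A *m x t + B *m w t).
Proof.
move=> xs ws xE; split; first by apply: sq_vecD; exact: sq_vec_mul.
by move=> t i t0; rewrite {1}xE // !mxE.
Qed.

(** The squared norm of [x] is integrable, and so is a bound on its derivative. *)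
Lemma energy_cvg0 n k (A : 'M[R]_n) (B : 'M[R]_(n, k)) x (w : R -> 'cV[R]_k) (c : R) :
  sq_vec w -> vec_deriv x (fun t => A *m x t + B *m w t) ->
  (forall T, 0 <= T -> J (fun t => sqr_norm (x t) + sqr_norm (w t)) T <= c) ->
  x t @[t --> +oo] --> (0 : 'cV[R]_n).
Proof.
move=> ws dx hc; have xs := vec_deriv_sq_vec dx; have [x's xE] := dx.
pose x' t := A *m x t + B *m w t.
pose F := row_mx A B; pose K := \sum_i \sum_j `|(F^T *m 1%:M *m F) i j|.
have K0 : 0 <= K by apply: sumr_ge0 => i _; apply: sumr_ge0.
have x'K t : sqr_norm (x' t) <= K * (sqr_norm (x t) + sqr_norm (w t)).
  have -> : x' t = F *m col_mx (x t) (w t) by rewrite mul_row_col.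
  by rewrite -bilin1_sqr_norm -bilin_congr -sqr_norm_col_mx; exact: bilin_le.
pose nn t := sqr_norm (x t) + sqr_norm (w t).
pose phi t := sqr_norm (x t) + sqr_norm (x' t).
have xi : loc_integrable (fun t => sqr_norm (x t)) by exact: loc_integrable_sqr_norm.
have ni : loc_integrable nn by apply: loc_integrableD => //; exact: loc_integrable_sqr_norm.
have pi : loc_integrable phi by apply: loc_integrableD => //; exact: loc_integrable_sqr_norm.
pose g t := bilin 1%:M (x' t) (x t) + bilin 1%:M (x t) (x' t).
have gi : loc_integrable g by apply: loc_integrableD; exact: loc_integrable_bilin.
have fE t : 0 <= t -> sqr_norm (x t) = sqr_norm (x 0) + J g t.
  by move=> t0; rewrite -!bilin1_sqr_norm; exact: vec_deriv_bilin.
have gp t : 0 <= t -> g t <= phi t.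
  move=> _; rewrite /g /phi !bilin1 /sqr_norm -!big_split; apply: ler_sum => i _ /=.
  by have := sqr_ge0 (x t i 0 - x' t i 0); lra.
have cc T : 0 <= T -> J nn T <= (1 + K) * c.
  move=> T0; apply: le_trans (hc T T0) _; rewrite mulrDl mul1r lerDl mulr_ge0 //.
  by apply: le_trans (hc 0 (lexx 0)); rewrite primitive0.
apply: sqr_norm_cvg0.
apply: (integrable_derivative_cvg0 (c := (1 + K) * c) xi gi pi) => //.
- by move=> t _; exact: sqr_norm_ge0.
- by move=> t _; rewrite addr_ge0 ?sqr_norm_ge0.
- move=> t t0; apply: le_trans (cc t t0); apply: le_primitive => // s _.
  by rewrite lerDl sqr_norm_ge0.
- move=> t t0; apply: (@le_trans _ _ (J (fun s => (1 + K) * nn s) t)).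
    apply: le_primitive => // [|s _]; first exact: loc_integrableZ.
    rewrite mulrDl mul1r lerD ?x'K //.
    by rewrite lerDl sqr_norm_ge0.
  by rewrite primitiveZ // ler_wpM2l ?addr_ge0 // hc.
Qed.

End Trajectories.

Theorem theorem8 (R : realType) (nu n np mp k : nat)
    (A : 'M[R]_n) (B : 'M[R]_(n, k)) (C : 'M[R]_(k, n)) (D : 'M[R]_k)
    (P : 'I_nu -> 'M[R]_2)
    (hPsym : forall i, P i \is symmetricmx)
    (hP22 : forall i, P i 1 1 <= 0)
    (Ap : 'M[R]_np) (Bp : 'M[R]_(np, k))
    (Cp : 'M[R]_(mp, np)) (Dp : 'M[R]_(mp, k))
    (hAp : hurwitz Ap) :
  (exists (X : 'M[R]_((np + np) + n)) (Y : 'I_nu -> 'M[R]_np)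
          (M : 'I_nu -> 'M[R]_mp),
      X \is symmetricmx /\
      (forall i, Y i \is symmetricmx) /\
      (forall i, M i \is symmetricmx) /\
      (forall i, posdef (multiplier_lmi Ap Bp Cp Dp (Y i) (M i))) /\
      negdef (stability_lmi A B C D Ap Bp Cp Dp P X M) /\
      posdef (coupling_lmi P X Y)) ->
  robustly_stable A B C D (repeated_set k P).
Proof.
move=> [X [Y [M [_ [hY [hM [hL [hS hC]]]]]]]]; split; first exact: lmi_well_posed hPsym hL hS.
have [e1 e10 coupling] := posdef_coercive hC.
have [e2 e20 stability] := negdef_coercive hS.
pose N := \sum_i \sum_j `|X i j| + 1.
have N0 : 0 < N by rewrite ltr_wpDl // sumr_ge0 // => i _; rewrite sumr_ge0.
exists (Num.sqrt (N / e1)); split; first by rewrite sqrtr_gt0 divr_gt0.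
move=> S hD x [cx [w [z [/L2e_sq_vec ws /L2e_sq_vec zs xE hz hw]]]].
have xs := continuous_sq_vec cx; have dx := trajectory_deriv xs ws xE.
have diss T := @dissipation R nu n np mp k A B C D Ap Bp Cp Dp P hPsym hP22 X Y M hY hM hL
  e1 e2 (ltW e10) (ltW e20) coupling stability S x w z hD ws zs dx hz hw T.
have X0 : bilin X (col_mx 0 (x 0)) (col_mx 0 (x 0)) <= N * sqr_norm (x 0).
  apply: le_trans (bilin_le _ _) _; rewrite sqr_norm_col_mx.
  have -> : sqr_norm (0 : 'cV[R]_(np + np)) = 0.
    by rewrite /sqr_norm big1 // => i _; rewrite mxE expr0n.
  by rewrite add0r ler_wpM2r ?sqr_norm_ge0 // lerDl.
split.
  apply: (@energy_cvg0 _ _ _ A B x w (N * sqr_norm (x 0) / e2)) => // T T0.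
  rewrite ler_pdivlMr // mulrC; apply: le_trans X0; apply: le_trans (diss T T0).
  by rewrite lerDr mulr_ge0 ?sqr_norm_ge0 // ltW.
move=> t t0; rewrite /norm2 -sqrtrM ?divr_ge0 ?(ltW N0) ?(ltW e10) //; apply: ler_wsqrtr.
rewrite mulrAC ler_pdivlMr // mulrC; apply: le_trans X0; apply: le_trans (diss t t0).
rewrite lerDl mulr_ge0 ?(ltW e20) //; apply: primitive_ge0 => s _.
by rewrite addr_ge0 ?sqr_norm_ge0.
Qed.
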